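(* Let $Z=(Z_k)_{k\ge0}$ be a process of one of the types (A), (B), (C) described in the context. For $T\in\mathbb{N}$ let $$\tau_T:=\arg\max\{Z_k:\ k=0,\ldots,T\},\qquad N_T:=|\{k\le T:\ Z_k>0\}|.$$ Let $n=n(T)$ be a function with values in $\mathbb{N}_+=\{1,2,\ldots\}$ such that $n(T)=T^{o(1)}$ as $T\to\infty$. Then, as $T\to\infty$, $$\mathbb{P}\Big[\max_{k=1,\ldots,T}Z_k\le0\Big]\ \le\ \mathbb{P}[\tau_T<n]\ \le\ \mathbb{P}\Big[\max_{k=1,\ldots,T}Z_k\le0\Big]\cdot T^{o(1)},$$ $$\mathbb{P}\Big[\max_{k=1,\ldots,T}Z_k\le0\Big]\ \le\ \mathbb{P}[N_T<n]\ \le\ \mathbb{P}\Big[\max_{k=1,\ldots,T}Z_k\le0\Big]\cdot T^{o(1)}.$$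
   Context: $T^{o(1)}$ denotes a quantity of the form $T^{\varepsilon(T)}$ with $\varepsilon(T)\to0$ as $T\to\infty$. The process $Z$ is of one of the following types. (A) One-dimensional random walk in random scenery: $S_0=0$, $S_n=X_1+\dots+X_n$ with $(X_n)_{n\ge1}$ i.i.d. $\mathbb{Z}$-valued and centered, belonging to the normal domain of attraction of a strictly stable law $\mathcal{S}_\alpha$ of index $\alpha\in(1,2]$ with characteristic function $\phi(u)=e^{-|u|^\alpha(A_1+iA_2\,\mathrm{sgn}(u))}$, where $0<A_1<\infty$ and $|A_1^{-1}A_2|\le|\tan(\pi\alpha/2)|$ (i.e. $n^{-1/\alpha}S_n$ converges in distribution to $\mathcal{S}_\alpha$); $(\xi_x)_{x\in\mathbb{Z}}$ are i.i.d. standard Gaussian $\mathcal{N}(0,1)$, independent of $S$; $Z_0=0$ and $Z_n=\sum_{i=1}^n\xi_{S_i}$ for $n\ge1$. (B) Random walk in random scenery with $d=2$ or a transient walk: $S_0=0$ and $S$ is a random walk in $\mathbb{Z}^d$ with i.i.d. increments $(X_n)_{n\ge 1}$ such that either $d=2$, $X_1$ is centered with finite non-singular covariance matrix and the characteristic function $\varphi$ of $S_1$ satisfies $\varphi(u)=1$ if and only if $u\in2\pi\mathbb{Z}^2$; or $d\ge1$ and $S$ is transient; $(\xi_x)_{x\in\mathbb{Z}^d}$ are i.i.d. standard Gaussian $\mathcal{N}(0,1)$, independent of $S$; $Z_0=0$ and $Z_n=\sum_{i=1}^n\xi_{S_i}$ for $n\ge1$. (C) Sums of a stationary Gaussian sequence: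 $(X_i)_{i\ge0}$ is a stationary Gaussian sequence with mean $0$, variance $1$ and correlations $r(j)=\mathbb{E}[X_0X_j]\ge0$ (with $r(-j)=r(j)$) satisfying $\sum_{i,j=1}^nr(i-j)\sim Kn^{2H}\ell(n)$ as $n\to\infty$, where $H\in[\frac12,1)$, $K>0$ and $\ell$ is slowly varying at infinity; $Z_0=0$ and $Z_n=\sum_{i=1}^nX_i$ for $n\ge1$. In (A) and (B), $\mathbb{P}$ is the joint law of $S$ and $\xi$. *)

(* Defs.v *)
(* MathComp + MathComp-Analysis; R[i] from mathcomp-real-closed. *)
From HB Require Import structures.
From mathcomp Require Import all_boot all_order all_algebra.
From mathcomp Require Import all_classical all_reals all_analysis.
From mathcomp.real_closed Require Import complex.
Set Implicit Arguments.
Unset Strict Implicit.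
Unset Printing Implicit Defensive.
Import Order.TTheory GRing.Theory Num.Theory.
Import numFieldNormedType.Exports.
Local Open Scope classical_set_scope.
Local Open Scope ring_scope.
Local Open Scope complex_scope.

Section asymptotics.
Context {R : realType}.

(* q(T) = T^{o(1)}: the identity is only required for large T (at T = 1 it
   would force q(1) = 1). *)
Definition subpolynomial (q : nat -> R) : Prop :=
  exists eps : nat -> R,
    eps @ \oo --> (0 : R) /\ \forall T \near \oo, q T = T%:R `^ eps T.

(* Karamata: a positive measurable function on some [a, +oo) with
   ell (c x) / ell x --> 1 for every c > 0; values below a are irrelevant. *)
Definition slowly_varying (ell : R -> R) : Prop :=
  (exists a : R, measurable_fun `[a, +oo[ ell /\
     forall x, a <= x -> 0 < ell x) /\
  forall c : R, 0 < c -> ell (c * x) / ell x @[x --> +oo] --> (1 : R).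

Definition cexp (z : R[i]) : R[i] :=
  let: a +i* b := z in (expR a * cos b) +i* (expR a * sin b).

(* exp (- |u|^alpha (A1 + i A2 sgn u)) *)
Definition stable_char (alpha A1 A2 : R) (u : R) : R[i] :=
  cexp (- (`|u| `^ alpha)%:C * (A1 +i* (A2 * Num.sg u))).

End asymptotics.

Section probability_notions.
Context {d : measure_display} {Omega : measurableType d} {R : realType}.
Variable P : probability Omega R.

Definition cexpectation (f : Omega -> R[i]) : R[i] :=
  (\int[P]_w complex.Re (f w)) +i* (\int[P]_w complex.Im (f w)).

Definition char_fun (Y : Omega -> R) (u : R) : R[i] :=
  cexpectation (fun w => cexp (0 +i* (u * Y w))).

Definition char_fun_vec (m : nat) (Y : Omega -> 'rV[R]_m) (u : 'rV[R]_m) :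
    R[i] :=
  cexpectation (fun w => cexp (0 +i* (\sum_(j < m) u ord0 j * Y w ord0 j))).

Definition centered (Y : Omega -> R) : Prop :=
  P.-integrable setT (EFin \o Y) /\ ('E_P[Y] = 0)%E.

Definition mutually_independent (I : eqType) (F : I -> set (set Omega)) : Prop :=
  forall (s : seq I) (A : I -> set Omega), uniq s ->
    (forall i, i \in s -> F i (A i)) ->
    P (\bigcap_(i in [set` s]) A i) = (\prod_(i <- s) P (A i))%E.

Definition independent_systems (F G : set (set Omega)) : Prop :=
  forall A B, F A -> G B -> P (A `&` B) = (P A * P B)%E.

(* Events determined by a variable with values in a countable set, which is
   given the discrete sigma-algebra. *)
Definition discrete_events (V : Type) (Y : Omega -> V) : set (set Omega) :=
  preimage_set_system setT Y [set: set V].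

End probability_notions.

(* Convergence in distribution of (Y_n) to the law mu. *)
Definition cvg_in_distribution {d : measure_display} {Omega : measurableType d}
    {R : realType} (P : probability Omega R) (Y : nat -> Omega -> R)
    (mu : probability R R) : Prop :=
  forall f : R -> R, continuous f -> (exists M, forall x, `|f x| <= M) ->
    ('E_P[f \o Y n] @[n --> \oo] --> 'E_mu[f])%E.

Section random_walk_in_random_scenery.
Context {d : measure_display} {Omega : measurableType d} {R : realType}.
Variable P : probability Omega R.

Section scenery.
Context {V : countZmodType}.

(* X k is the (k+1)-st increment, so that S_n = X 0 + ... + X (n-1). *)
Definition walk (X : nat -> Omega -> V) (n : nat) (w : Omega) : V :=
  \sum_(k < n) X k w.

Definition rwrs (X : nat -> Omega -> V) (xi : V -> Omega -> R)
    (n : nat) (w : Omega) : R :=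
  \sum_(1 <= k < n.+1) xi (walk X k w) w.

Definition iid_increments (X : nat -> Omega -> V) : Prop :=
  [/\ forall k, discrete_events (X k) `<=` measurable,
      mutually_independent P (fun k => discrete_events (X k)) &
      forall k (A : set V), P (X k @^-1` A) = P (X 0%N @^-1` A)].

Definition iid_standard_gaussian (xi : V -> {RV P >-> R}) : Prop :=
  mutually_independent P (fun x => g_sigma_algebra_preimage (xi x)) /\
  forall x (A : set R), measurable A ->
    distribution P (xi x) A = normal_prob 0 1 A.

Definition walk_independent_of_scenery
    (X : nat -> Omega -> V) (xi : V -> {RV P >-> R}) : Prop :=
  independent_systems P
    <<s \bigcup_n discrete_events (walk X n) >>
    <<s \bigcup_x g_sigma_algebra_preimage (xi x) >>.

Definition is_rwrs (X : nat -> Omega -> V) (xi : V -> {RV P >-> R})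
    (Z : nat -> Omega -> R) : Prop :=
  [/\ iid_increments X, iid_standard_gaussian xi,
      walk_independent_of_scenery X xi &
      forall n w, Z n w = rwrs X xi n w].

(* Probability of never returning to the origin is positive. *)
Definition transient (X : nat -> Omega -> V) : Prop :=
  (0 < P [set w | forall n, (0 < n)%N -> walk X n w <> 0%R])%E.

End scenery.

Definition stable_normal_attraction (X : nat -> Omega -> int) : Prop :=
  exists alpha A1 A2 : R,
    [/\ 1 < alpha <= 2, 0 < A1, `|A1^-1 * A2| <= `|tan (pi * alpha / 2)| &
        exists mu : probability R R,
          (forall u, char_fun mu id u = stable_char alpha A1 A2 u) /\
          cvg_in_distribution P
            (fun n w => n%:R `^ (- alpha^-1) * (walk X n w)%:~R) mu].

Definition planar_condition (m : nat) (Y : Omega -> 'rV[int]_m) : Prop :=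
  let YR : Omega -> 'rV[R]_m := fun w => map_mx intr (Y w) in
  let coord (j : 'I_m) : Omega -> R := fun w => YR w ord0 j in
  [/\ forall j, centered P (coord j),
      forall j, coord j \in Lfun P 2%:E,
      \matrix_(j < m, k < m) fine (covariance P (coord j) (coord k))
        \in unitmx &
      forall u : 'rV[R]_m, char_fun_vec P YR u = 1 <->
        exists v : 'rV[int]_m, u = (2 * pi) *: map_mx intr v].

Definition type_A (Z : nat -> Omega -> R) : Prop :=
  exists (X : nat -> Omega -> int) (xi : int -> {RV P >-> R}),
    [/\ is_rwrs X xi Z, centered P (fun w => (X 0%N w)%:~R) &
        stable_normal_attraction X].

Definition type_B (Z : nat -> Omega -> R) : Prop :=
  exists (m : nat) (X : nat -> Omega -> 'rV[int]_m)
      (xi : 'rV[int]_m -> {RV P >-> R}),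
    [/\ (0 < m)%N, is_rwrs X xi Z &
        (m = 2%N /\ planar_condition (X 0%N)) \/ transient X].

End random_walk_in_random_scenery.

Section stationary_gaussian_sums.
Context {d : measure_display} {Omega : measurableType d} {R : realType}.
Variable P : probability Omega R.

(* Normal or degenerate law. The point masses are listed separately because
   [normal_prob m 0] is not a point mass in the library. *)
Definition gaussian_variable (Y : Omega -> R) : Prop :=
  (exists m s : R, 0 < s /\
     forall A : set R, measurable A -> P (Y @^-1` A) = normal_prob m s A) \/
  (exists m : R,
     forall A : set R, measurable A -> P (Y @^-1` A) = \d_m A).

Definition gaussian_sequence (X : nat -> {RV P >-> R}) : Prop :=
  forall (n : nat) (a : nat -> R),
    gaussian_variable (fun w => \sum_(i < n) a i * X i w).

Definition stationary (X : nat -> {RV P >-> R}) : Prop :=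
  forall (n h : nat) (B : set (n.-tuple R)), measurable B ->
    P [set w | B [tuple X (i + h)%N w | i < n]] =
    P [set w | B [tuple X i w | i < n]].

Definition correlation (X : nat -> {RV P >-> R}) (j : nat) : R :=
  fine ('E_P[(fun w => X 0%N w * X j w)%R])%E.

(* r (i - j) is written r `|i - j|, as r is even. *)
Definition type_C (Z : nat -> Omega -> R) : Prop :=
  exists X : nat -> {RV P >-> R},
    [/\ stationary X /\ gaussian_sequence X,
        forall i, ('E_P[X i] = 0 /\ 'V_P[X i] = 1)%E,
        forall j, 0 <= correlation X j,
        exists (H K : R) (ell : R -> R),
          [/\ 2^-1 <= H < 1, 0 < K, slowly_varying ell &
              (fun n : nat => \sum_(1 <= i < n.+1) \sum_(1 <= j < n.+1)
                 correlation X `|i%:Z - j%:Z|%N : R^o) ~_\oo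
              (fun n : nat => K * n%:R `^ (2 * H) * ell n%:R : R^o)] &
        forall n w, Z n w = \sum_(1 <= i < n.+1) X i w].

End stationary_gaussian_sums.

Section functionals.
Context {Omega : Type} {R : realType}.
Variable Z : nat -> Omega -> R.

(* max_{k = 1..T} Z_k for T >= 1; the seed Z_1 is one of the terms. *)
Definition running_max (T : nat) (w : Omega) : R :=
  \big[Order.max/Z 1%N w]_(1 <= k < T.+1) Z k w.

(* Least maximizer of k |-> Z_k over {0, ..., T}. *)
Definition argmax_time (T : nat) (w : Omega) : nat :=
  find (fun k => all (fun j => Z j w <= Z k w) (iota 0 T.+1)) (iota 0 T.+1).

Definition positive_count (T : nat) (w : Omega) : nat :=
  count (fun k => 0 < Z k w) (iota 0 T.+1).

End functionals.

(* Main.v *)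
Require Import Defs.
From HB Require Import structures.
From mathcomp Require Import all_boot all_order all_algebra.
From mathcomp Require Import all_classical all_reals all_analysis.
From mathcomp Require Import measurable_realfun.
From mathcomp Require Import ring lra zify.
Set Implicit Arguments.
Unset Strict Implicit.
Unset Printing Implicit Defensive.
Import Order.TTheory GRing.Theory Num.Theory.
Import numFieldNormedType.Exports.
Local Open Scope classical_set_scope.
Local Open Scope ring_scope.

(** Let p_T be the probability that Z_j <= 0 for all j <= T. The lower bounds hold
    because Z_1, ..., Z_T <= 0 implies that the least maximizer is 0 and that no
    value is positive. For the upper bounds, let E be one of the events
    tau_T < n and N_T < n.

    If all steps of Z up to time T are at most a, then E implies Z_j <= n a for
    all j <= T ([path_bounded_argmax], [path_bounded_count]): a maximum reached
    before time n is at most n a, and a value above n a is the last of n positive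
    values. The steps have Gaussian tails, so with a = 6 ln T the exceptional event
    has probability O(T^-5). It remains to compare p_T with the probability
    of staying below the level h = n a = T^o(1), and to bound p_T from below.

    Both follow from [pr_below_level]: for some kappa > 0,
      kappa P(Z_j <= h for all j <= T) <= (h^2 + 2) p_T.
    By stationarity of the increments, the left-hand event may be started at a time
    m >= h^2 instead of 0. All covariances being nonnegative, requiring in addition
    Z_m <= - h costs no more than a constant factor. But then the path on
    [0, m + T] has a maximizer k <= m, so that Z_(k+j) <= Z_k for all j <= T, an
    event of probability p_T for each of the m + 1 values of k. With h = T a the
    same inequality gives p_T >= c T^-4, so the exceptional event is negligible
    ([persistence_comparison]).

    The correlation inequality is obtained by conditioning on the single variable
    W = Z_m: each increment Z_(m+j) - Z_m is the sum of a part independent of W and of a nonnegative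
    multiple of W, so the event that they all stay below h becomes less likely
    as W increases ([half_space_correlation], [gaussian_drop_before]).

    The Gaussian facts are derived from characteristic functions. The function of
    the normal density solves a differential equation ([normal_cos]); equality
    of the means of all cosines of linear forms, possibly with weights, implies
    equality for intersections of half-spaces ([cramer_wold]). The latter rests on
    the remark that the functions preserving such an equality form an algebra
    closed under bounded pointwise limits, to which signs of affine forms belong.

    For sums of a stationary Gaussian sequence all this applies directly
    ([stationary_gaussian_persistence]). For random walk in random scenery it
    applies conditionally on the countably many paths of the walk, Z being then a
    sum of Gaussian variables with covariances 0 and 1 ([rwrs_persistence]). *)

(** * Bounded random variables *)

Section bounded_variables.
Context {d : measure_display} {Omega : measurableType d} {R : realType}.
Variable P : probability Omega R.

Lemma measurable_rv_le (f : Omega -> R) (r : R) :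
  measurable_fun setT f -> measurable [set w | f w <= r].
Proof.
move=> mf; have mle : measurable_fun setT (fun w => f w <= r) by exact: measurable_fun_ler.
by have := mle measurableT [set true] I; rewrite setTI.
Qed.

Lemma measurable_rv_abs_gt (f : Omega -> R) (r : R) :
  measurable_fun setT f -> measurable [set w | r < `|f w|].
Proof.
move=> mf; have mlt : measurable_fun setT (fun w => r < `|f w|).
  by apply: measurable_fun_ltr => //; exact: measurableT_comp.
by have := mlt measurableT [set true] I; rewrite setTI.
Qed.

Lemma measurable_upto (A : nat -> set Omega) T : (forall j, measurable (A j)) ->
  measurable [set w | forall j, (j <= T)%N -> A j w].
Proof.
move=> mA; rewrite (_ : [set w | _] = \bigcap_j [set w | (j <= T)%N -> A j w]); last first.
  by apply/seteqP; split => [w h k _|w h k]; [exact: h|exact: (h k I)].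
apply: bigcap_measurableType => k _.
have [kT|kT] := boolP (k <= T)%N.
  by rewrite (_ : [set w | _] = A k)//; apply/seteqP; split => [w h|w h _]; [exact: h|].
by rewrite (_ : [set w | _] = setT)//; apply/seteqP; split.
Qed.

Definition bounded_rv (f : Omega -> R) : Prop :=
  measurable_fun setT f /\ exists M, forall w, `|f w| <= M.

Lemma bounded_rv_integrable f : bounded_rv f -> P.-integrable setT (EFin \o f).
Proof.
move=> [mf [M fM]]; apply: measurable_bounded_integrable => //.
  by rewrite (le_lt_trans (probability_le1 _ _))// ltry.
exists M; split; first exact: num_real.
by move=> x Mx w _ /=; rewrite (le_trans (fM w))// ltW.
Qed.

Lemma bounded_rv_cst c : bounded_rv (fun=> c).
Proof. by split=> //; exists `|c|. Qed.

Lemma bounded_rvD f g : bounded_rv f -> bounded_rv g ->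
  bounded_rv (fun w => f w + g w).
Proof.
move=> [mf [M fM]] [mg [N gN]]; split; first exact: measurable_funD.
by exists (M + N) => w; rewrite (le_trans (ler_normD _ _))// lerD.
Qed.

Lemma bounded_rvM f g : bounded_rv f -> bounded_rv g ->
  bounded_rv (fun w => f w * g w).
Proof.
move=> [mf [M fM]] [mg [N gN]]; split; first exact: measurable_funM.
by exists (M * N) => w; rewrite normrM ler_pM.
Qed.

Lemma bounded_rv_cos f : measurable_fun setT f -> bounded_rv (fun w => cos (f w)).
Proof.
move=> mf; split.
  by apply: measurableT_comp => //; apply: continuous_measurable_fun; exact: continuous_cos.
by exists 1 => w; rewrite ler_norml cos_geN1 cos_le1.
Qed.

Lemma bounded_rv_indic (A : set Omega) : measurable A -> bounded_rv (\1_A).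
Proof.
move=> mA; split; first exact: measurable_indic.
by exists 1 => w; rewrite indicE ger0_norm// lern1 leq_b1.
Qed.

Lemma mean_cst c : \int[P]_w c = c.
Proof. by rewrite Rintegral_cst//= probability_setT mulr1. Qed.

Lemma meanD f g : bounded_rv f -> bounded_rv g ->
  \int[P]_w (f w + g w) = \int[P]_w f w + \int[P]_w g w.
Proof. by move=> *; rewrite RintegralD//; exact: bounded_rv_integrable. Qed.

Lemma meanZ c f : bounded_rv f -> \int[P]_w (c * f w) = c * \int[P]_w f w.
Proof. by move=> *; rewrite RintegralZl//; exact: bounded_rv_integrable. Qed.

Lemma mean_indic (A : set Omega) : measurable A -> \int[P]_w \1_A w = fine (P A).
Proof. by move=> mA; rewrite /Rintegral integral_indic// setIT. Qed.

(** Every limit of expectations below, except those behind derivatives and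
    improper integrals, is taken under a constant bound, so that dominated
    convergence is only used in this form. *)
Lemma bounded_rv_cvg (f_ : nat -> Omega -> R) (f : Omega -> R) M :
  (forall n, measurable_fun setT (f_ n)) -> (forall n w, `|f_ n w| <= M) ->
  (forall w, f_ ^~ w @ \oo --> f w) ->
  bounded_rv f /\ \int[P]_w f_ n w @[n --> \oo] --> \int[P]_w f w.
Proof.
move=> mf_ f_M cvf.
have mf : measurable_fun setT f.
  by apply: (measurable_fun_cvg mf_) => x _; exact: cvf.
have bf : bounded_rv f.
  split=> //; exists M => w.
  have /cvg_norm := cvf w => cvn.
  rewrite -(cvg_lim _ cvn)//; apply: limr_le; first by apply/cvg_ex; exists `|f w|.
  by apply: nearW => n; exact: f_M.
split=> //.
have bM := bounded_rv_integrable (bounded_rv_cst M).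
have [|||||_ _ h] := @dominated_convergence _ _ _ P setT measurableT
    (fun n w => (f_ n w)%:E) (fun w => (f w)%:E) (fun=> M%:E).
- by move=> n; exact/measurable_EFinP.
- exact/measurable_EFinP.
- by apply: aeW => w _; apply: cvg_EFin; [exact: nearW | exact: cvf].
- exact: bM.
- by apply: aeW => w n _ /=; rewrite lee_fin.
apply: fine_cvg; rewrite fineK//.
by apply: integrable_fin_num => //; exact: bounded_rv_integrable.
Qed.
End bounded_variables.

Lemma measurable_lower_ray {R : realType} (r : R) : measurable [set x : R | x <= r].
Proof.
have mle : measurable_fun setT (fun x : R => x <= r) by exact: measurable_fun_ler.
by have := mle measurableT [set true] I; rewrite setTI.
Qed.

Lemma measurable_two_tails {R : realType} (r : R) : measurable [set x : R | r < `|x|].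
Proof.
have mlt : measurable_fun setT (fun x : R => r < `|x|).
  by apply: measurable_fun_ltr => //; exact: normr_measurable.
by have := mlt measurableT [set true] I; rewrite setTI.
Qed.

(** * The sign as a limit of polynomials in the sine *)

Section halving_cubic.
Context {R : realType}.

(** The cubic 3/2 y - 1/2 y^3 maps [-1, 1] to itself and fixes -1, 0 and 1; the
    fixed point 0 is repelling and the two others attract, so that its iterates
    are polynomials, bounded on [-1, 1], which converge there to the sign. *)
Definition sign_step (y : R) : R := (3 * y - y * y * y) / 2.

Lemma sign_iter_le1 n (y : R) : `|y| <= 1 -> `|iter n sign_step y| <= 1.
Proof.
move=> y1; elim: n => //= n; move: (iter n _ y) => {y1}y.
rewrite !ler_norml /sign_step => /andP[y1 y2].
have h1 : 0 <= (y + 1) * (y + 1) * (2 - y) by rewrite !mulr_ge0//; lra.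
have h2 : 0 <= (1 - y) * (1 - y) * (2 + y) by rewrite !mulr_ge0//; lra.
by apply/andP; split; lra.
Qed.

Lemma sign_iterN n (y : R) : iter n sign_step (- y) = - iter n sign_step y.
Proof. by elim: n => //= n ->; rewrite /sign_step; field. Qed.

(** One step replaces e = 1 - y by e * (e * (3 - e) / 2), and e * (3 - e) / 2
    increases with e on [0, 1]. Its value at the starting point is therefore a
    contraction factor for the whole orbit. *)
Lemma sign_iter_pos (y : R) : 0 < y <= 1 ->
  iter n sign_step y @[n --> \oo] --> (1 : R).
Proof.
move=> /andP[y0 y1].
pose e := 1 - y; pose r := e * (3 - e) / 2.
have r0 : 0 <= r < 1 by rewrite /r /e; apply/andP; split; nra.
have bnd n : 0 <= 1 - iter n sign_step y <= r ^+ n * e /\ 1 - iter n sign_step y <= e.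
  elim: n => [|n [/andP[h1 h2] h3]] /=; first by rewrite expr0 mul1r /e lexx andbT; lra.
  set z := iter n _ y in h1 h2 h3 *.
  have step : 1 - sign_step z = (1 - z) * ((1 - z) * (3 - (1 - z)) / 2).
    by rewrite /sign_step; field.
  have e1 : e < 1 by rewrite /e; lra.
  have f0 : 0 <= (1 - z) * (3 - (1 - z)) / 2 by nra.
  have fr : (1 - z) * (3 - (1 - z)) / 2 <= r by rewrite /r; nra.
  move: r0 => /andP[r0 r1].
  split; last by rewrite step; nra.
  have -> : r ^+ n.+1 * e = r ^+ n * e * r by rewrite exprS; ring.
  by rewrite step mulr_ge0//= ler_pM.
have cvr : r ^+ n * e @[n --> \oo] --> (0 : R).
  rewrite -(mul0r e); apply: cvgM; last exact: cvg_cst.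
  by move: r0 => /andP[r0 r1]; apply: cvg_expr; rewrite ger0_norm.
have cv0 : 1 - iter n sign_step y @[n --> \oo] --> (0 : R).
  apply: (squeeze_cvgr _ (cvg_cst 0) cvr).
  by apply: nearW => n; have [] := bnd n.
have -> : (fun n => iter n sign_step y) = (fun n => 1 - (1 - iter n sign_step y)).
  by apply/funext => n; ring.
rewrite -[X in _ --> X]subr0; apply: cvgB => //; exact: cvg_cst.
Qed.

Lemma sign_iter_cvg (y : R) : `|y| <= 1 ->
  iter n sign_step y @[n --> \oo] --> Num.sg y.
Proof.
rewrite ler_norml => /andP[yN1 y1].
have [->|y0|y0] := sgrP y.
- have -> : (fun n => iter n sign_step (0 : R)) = fun=> 0.
    by apply/funext; elim=> //= n ->; rewrite /sign_step; ring.
  exact: cvg_cst.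
- by apply: sign_iter_pos; rewrite y0.
- have -> : (fun n => iter n sign_step y) = (fun n => - iter n sign_step (- y)).
    by apply/funext => n; rewrite sign_iterN opprK.
  by apply: cvgN; apply: sign_iter_pos; apply/andP; split; lra.
Qed.

(** Polynomials are bounded on bounded sets only, whence the detour through the
    sine: z / n eventually lies in (-pi, pi), where the sine has the sign of its
    argument. *)
Lemma sg_sin_cvg (z : R) : Num.sg (sin (z / n.+1%:R)) @[n --> \oo] --> Num.sg z.
Proof.
have [->|z0] := eqVneq z 0.
  by under eq_fun do rewrite mul0r sin0; exact: cvg_cst.
apply: cvg_near_cst.
have zpi : \forall n \near \oo, `|z| / n.+1%:R < pi.
  exists (Num.bound (`|z| / pi)) => // n /= hn.
  rewrite ltr_pdivrMr// mulrC -ltr_pdivrMr ?pi_gt0//.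
  have : 0 <= `|z| / pi by rewrite divr_ge0// pi_ge0.
  move=> /archi_boundP /lt_le_trans; apply.
  by rewrite ler_nat (leq_trans hn).
near=> n.
have h : `|z| / n.+1%:R < pi by near: n.
have n0 : (0 : R) < n.+1%:R by [].
have [z1|z1] := ltP 0 z.
  rewrite (gtr0_sg z1) gtr0_sg//; apply: sin_gt0_pi.
  by rewrite divr_gt0//= -(gtr0_norm z1).
have {}z1 : z < 0 by rewrite lt_neqAle z0.
rewrite (ltr0_sg z1) ltr0_sg// -oppr_gt0 -sinN; apply: sin_gt0_pi.
by rewrite -mulNr divr_gt0 ?oppr_gt0//= -(ltr0_norm z1).
Unshelve. all: by end_near. Qed.

End halving_cubic.

(** * Half-space probabilities are determined by cosines *)

Section cramer_wold.
Context {d : measure_display} {Omega : measurableType d} {R : realType}.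
Variable P : probability Omega R.
Variables (N : nat) (Y Y' : nat -> Omega -> R) (F F' : Omega -> R).
Hypothesis mY : forall i, measurable_fun setT (Y i).
Hypothesis mY' : forall i, measurable_fun setT (Y' i).
Hypothesis bF : bounded_rv F.
Hypothesis bF' : bounded_rv F'.

Local Notation lin a y := (\sum_(i < N) (a : nat -> R) i * y i).
Local Notation at_ g y w := (g (fun i => y i w)).

(** [Y] and [Y'] are two vectors with weights [F] and [F']. The first two
    definitions speak of functions [g] of the vector, so that the same [g] can be
    evaluated at [Y] and at [Y']; taking [F = F' = 1] compares two laws, and
    taking [Y = Y'] with [F'] constant expresses independence of [F] from [Y]. *)
Definition testable (g : (nat -> R) -> R) : Prop :=
  bounded_rv (fun w => at_ g Y w) /\ bounded_rv (fun w => at_ g Y' w).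

Definition cosines_agree (g : (nat -> R) -> R) : Prop := forall (a : nat -> R) t,
  \int[P]_w (F w * at_ g Y w * cos (lin a (Y ^~ w) + t)) =
  \int[P]_w (F' w * at_ g Y' w * cos (lin a (Y' ^~ w) + t)).

(** Functions whose insertion preserves the equality of all weighted cosine
    means. Unlike the functions for which this equality holds, they are closed
    under products; this is what makes polynomials available. *)
Definition multiplier (h : (nat -> R) -> R) : Prop :=
  testable h /\ forall g, testable g -> cosines_agree g -> cosines_agree (fun y => g y * h y).

Lemma measurable_lin (X : nat -> Omega -> R) (a : nat -> R) n :
  (forall i, measurable_fun setT (X i)) ->
  measurable_fun setT (fun w => \sum_(i < n) a i * X i w).
Proof.
by move=> mX; apply: measurable_sum => i; apply: measurable_funM.
Qed.

Lemma testable_cos (a : nat -> R) t : testable (fun y => cos (lin a y + t)).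
Proof.
by split; apply: bounded_rv_cos;
  [exact: (measurable_funD (measurable_lin a N mY) (measurable_cst t))
  |exact: (measurable_funD (measurable_lin a N mY') (measurable_cst t))].
Qed.

Lemma testableM g h : testable g -> testable h -> testable (fun y => g y * h y).
Proof. by move=> [? ?] [? ?]; split; exact: bounded_rvM. Qed.

Lemma testableD g h : testable g -> testable h -> testable (fun y => g y + h y).
Proof. by move=> [? ?] [? ?]; split; exact: bounded_rvD. Qed.

Lemma testable_cst c : testable (fun=> c).
Proof. by split; exact: bounded_rv_cst. Qed.

Lemma cosines_agreeZ c g : testable g -> cosines_agree g -> cosines_agree (fun y => c * g y).
Proof.
move=> [g1 g2] ag a t; have [c1 c2] := testable_cos a t.
transitivity (c * \int[P]_w (F w * at_ g Y w * cos (lin a (Y ^~ w) + t))).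
  rewrite -meanZ; last by do 2 apply: bounded_rvM => //.
  by apply: eq_Rintegral => w _; ring.
rewrite ag -meanZ; last by do 2 apply: bounded_rvM => //.
by apply: eq_Rintegral => w _; ring.
Qed.

Lemma cosines_agreeD g h : testable g -> testable h -> cosines_agree g -> cosines_agree h ->
  cosines_agree (fun y => g y + h y).
Proof.
move=> [g1 g2] [h1 h2] ag ah a t; have [c1 c2] := testable_cos a t.
under eq_Rintegral do rewrite mulrDr mulrDl.
rewrite meanD ?ag ?ah; [|by do 2 apply: bounded_rvM => //..].
rewrite -meanD; [|by do 2 apply: bounded_rvM => //..].
by apply: eq_Rintegral => w _; ring.
Qed.

Lemma multiplier_cst c : multiplier (fun=> c).
Proof.
split; first exact: testable_cst.
move=> g tg ag; rewrite (_ : (fun y : nat -> R => g y * c) = (fun y : nat -> R => c * g y)).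
  exact: cosines_agreeZ.
by apply/funext => y; rewrite mulrC.
Qed.

Lemma multiplierM g h : multiplier g -> multiplier h ->
  multiplier (fun y => g y * h y).
Proof.
move=> [tg mg] [th mh]; split; first exact: testableM.
move=> k tk ak; rewrite (_ : (fun y : nat -> R => _) = (fun y : nat -> R => (k y * g y) * h y)).
  by apply: mh; [exact: testableM|exact: mg].
by apply/funext => y; rewrite mulrA.
Qed.

Lemma multiplierD g h : multiplier g -> multiplier h ->
  multiplier (fun y => g y + h y).
Proof.
move=> [tg mg] [th mh]; split; first exact: testableD.
move=> k tk ak; rewrite (_ : (fun y : nat -> R => _) = (fun y : nat -> R => k y * g y + k y * h y)).
  by apply: cosines_agreeD; [exact: testableM|exact: testableM|exact: mg|exact: mh].
by apply/funext => y; rewrite mulrDr.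
Qed.

(** Product formula: 2 cos u cos v = cos (u + v) + cos (u - v). *)
Lemma multiplier_cos (a : nat -> R) t : multiplier (fun y => cos (lin a y + t)).
Proof.
split; first exact: testable_cos.
move=> g tg ag b s.
have E (y : nat -> R) (k : R) : k * cos (lin a y + t) * cos (lin b y + s) =
    2^-1 * (k * cos (lin (fun i => a i + b i) y + (t + s)) +
            k * cos (lin (fun i => a i - b i) y + (t - s))).
  have -> : lin (fun i => a i + b i) y = lin a y + lin b y.
    by rewrite -big_split/=; apply: eq_bigr => i _; rewrite mulrDl.
  have -> : lin (fun i => a i - b i) y = lin a y - lin b y.
    by rewrite -sumrB; apply: eq_bigr => i _; rewrite mulrBl.
  set A := lin a y; set B := lin b y.
  have -> : A + B + (t + s) = (A + t) + (B + s) by ring.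
  have -> : A - B + (t - s) = (A + t) - (B + s) by ring.
  by move: (A + t) (B + s) => u v; rewrite cosD cosB; field.
have [g1 g2] := tg.
have [c1 c2] := testable_cos (fun i => a i + b i) (t + s).
have [e1 e2] := testable_cos (fun i => a i - b i) (t - s).
have split_mean (G : Omega -> R) (V : nat -> Omega -> R) :
    \int[P]_w (G w * (at_ g V w * cos (lin a (V ^~ w) + t)) * cos (lin b (V ^~ w) + s)) =
    \int[P]_w (2^-1 * (G w * at_ g V w * cos (lin (fun i => a i + b i) (V ^~ w) + (t + s)) +
      G w * at_ g V w * cos (lin (fun i => a i - b i) (V ^~ w) + (t - s)))).
  by apply: eq_Rintegral => w _; rewrite -(E (V ^~ w)); ring.
rewrite !split_mean.
rewrite !meanZ; [|by apply: bounded_rvD; do 2 apply: bounded_rvM => //..].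
rewrite !meanD; [|by do 2 apply: bounded_rvM => //..].
by congr (_ * (_ + _)); [exact: (ag (fun i => a i + b i) (t + s))|exact: (ag (fun i => a i - b i) (t - s))].
Qed.

Lemma multiplier_cvg (h_ : nat -> (nat -> R) -> R) h M :
  (forall n, multiplier (h_ n)) -> (forall n y, `|h_ n y| <= M) ->
  (forall y, h_ n y @[n --> \oo] --> h y) -> multiplier h.
Proof.
move=> mh hM hc.
have [b1 _] := @bounded_rv_cvg _ _ _ P (fun n w => at_ (h_ n) Y w)
  (fun w => at_ h Y w) M (fun n => (mh n).1.1.1) (fun n w => hM n _) (fun w => hc _).
have [b2 _] := @bounded_rv_cvg _ _ _ P (fun n w => at_ (h_ n) Y' w)
  (fun w => at_ h Y' w) M (fun n => (mh n).1.2.1) (fun n w => hM n _) (fun w => hc _).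
split=> // g tg ag a t.
have [g1 g2] := tg; have [c1 c2] := testable_cos a t.
have lim_ (G : Omega -> R) (V : nat -> Omega -> R) : bounded_rv G ->
    (forall n, bounded_rv (fun w => at_ (h_ n) V w)) ->
    (\int[P]_w (G w * at_ (h_ n) V w)) @[n --> \oo] --> \int[P]_w (G w * at_ h V w).
  move=> bG bV; have [_ [K GK]] := bG.
  have [|||_ //] := @bounded_rv_cvg _ _ _ P (fun n w => G w * at_ (h_ n) V w)
    (fun w => G w * at_ h V w) (K * M).
  - by move=> n; apply: (bounded_rvM bG (bV n)).1.
  - by move=> n w; rewrite normrM ler_pM.
  - by move=> w; apply: cvgM; [exact: cvg_cst|exact: hc].
have B1 := bounded_rvM (bounded_rvM bF g1) c1.
have B2 := bounded_rvM (bounded_rvM bF' g2) c2.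
have L1 := lim_ _ _ B1 (fun n => (mh n).1.1).
have L2 := lim_ _ _ B2 (fun n => (mh n).1.2).
have E : (fun n => \int[P]_w (F w * at_ g Y w * cos (lin a (Y ^~ w) + t) * at_ (h_ n) Y w)) =
    (fun n => \int[P]_w (F' w * at_ g Y' w * cos (lin a (Y' ^~ w) + t) * at_ (h_ n) Y' w)).
  apply/funext => n.
  transitivity (\int[P]_w (F w * (at_ g Y w * at_ (h_ n) Y w) * cos (lin a (Y ^~ w) + t))).
    by apply: eq_Rintegral => w _; ring.
  rewrite ((mh n).2 g tg ag).
  by apply: eq_Rintegral => w _; ring.
rewrite E in L1.
transitivity (\int[P]_w (F w * at_ g Y w * cos (lin a (Y ^~ w) + t) * at_ h Y w)).
  by apply: eq_Rintegral => w _; ring.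
rewrite (cvg_unique _ L1 L2)//.
by apply: eq_Rintegral => w _; ring.
Qed.

(** Two successive bounded limits: iterating the cubic on the sine gives the sign
    of the sine, and rescaling the argument gives the sign. *)
Lemma multiplier_sg (a : nat -> R) t : multiplier (fun y => Num.sg (lin a y + t)).
Proof.
apply: (@multiplier_cvg (fun n y => Num.sg (sin ((lin a y + t) / n.+1%:R))) _ 1).
- move=> n.
  apply: (@multiplier_cvg (fun k y => iter k sign_step (sin ((lin a y + t) / n.+1%:R))) _ 1).
  + elim=> [|k IH] /=.
      (* sin x = cos (x - pi / 2) *)
      rewrite (_ : (fun y : nat -> R => _) = (fun y : nat -> R => cos (lin (fun i => a i / n.+1%:R) y +
         (t / n.+1%:R - pi / 2)))).
        exact: (multiplier_cos (fun i => a i / n.+1%:R) (t / n.+1%:R - pi / 2)).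
      apply/funext => y; rewrite addrA cosB cos_pihalf sin_pihalf mulr0 add0r mulr1.
      congr sin; rewrite mulrDl; congr (_ + _); rewrite mulr_suml.
      by apply: eq_bigr => i _; rewrite mulrAC.
    rewrite /sign_step; apply: (multiplierM _ (multiplier_cst _)).
    apply: multiplierD; first exact: (multiplierM (multiplier_cst _)).
    rewrite (_ : (fun y : nat -> R => _) = (fun y : nat -> R => (-1) * (iter k sign_step (sin ((lin a y + t) / n.+1%:R)) *
      iter k sign_step (sin ((lin a y + t) / n.+1%:R)) *
      iter k sign_step (sin ((lin a y + t) / n.+1%:R))))).
      by apply: multiplierM; [exact: multiplier_cst|do 2 apply: multiplierM => //].
    by apply/funext => y; rewrite mulN1r.
  + by move=> k y; apply: sign_iter_le1; rewrite ler_norml sin_geN1 sin_le1.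
  + by move=> y; apply: sign_iter_cvg; rewrite ler_norml sin_geN1 sin_le1.
- by move=> n y; rewrite normr_sg lern1 leq_b1.
- by move=> y; exact: sg_sin_cvg.
Qed.

Lemma multiplier_half_space (a : nat -> R) t : multiplier (fun y => (lin a y <= t)%R%:R).
Proof.
rewrite (_ : (fun y : nat -> R => _) = (fun y : nat -> R => 1 + (- 2^-1) *
  (Num.sg (lin a y + - t) + Num.sg (lin a y + - t) * Num.sg (lin a y + - t)))).
  have h := multiplier_sg a (- t).
  apply: multiplierD; first exact: multiplier_cst.
  apply: multiplierM; first exact: multiplier_cst.
  by apply: multiplierD => //; exact: multiplierM.
apply/funext => y; rewrite -subr_le0; set z := _ - t.
by rewrite -sgr_le0; have [_|_|_] := sgrP z; rewrite ?lexx ?lerN10 ?ler10 /=; field.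
Qed.

(** A Cramer-Wold device with weights. Indicators of half-spaces are polynomials in
    signs of affine forms, hence multipliers, and so are their products. *)
Theorem cramer_wold : cosines_agree (fun=> 1) ->
  forall (K : nat) (a : nat -> nat -> R) (t : nat -> R),
  \int[P]_w (F w * \1_[set w | forall k, (k < K)%N -> \sum_(i < N) a k i * Y i w <= t k] w) =
  \int[P]_w (F' w * \1_[set w | forall k, (k < K)%N -> \sum_(i < N) a k i * Y' i w <= t k] w).
Proof.
move=> a1 K a t.
pose g K (y : nat -> R) : R := \1_[set y | forall k, (k < K)%N -> lin (a k) y <= t k] y.
have mg : multiplier (g K).
  elim: K => [|K IH].
    rewrite (_ : g 0%N = fun=> 1); first exact: multiplier_cst.
    by apply/funext => y; rewrite /g indicE mem_set.
  rewrite (_ : g K.+1 = fun y => g K y * (lin (a K) y <= t K)%R%:R).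
    by apply: multiplierM => //; exact: multiplier_half_space.
  apply/funext => y; rewrite /g !indicE -natrM mulnb; congr (nat_of_bool _)%:R.
  apply/idP/andP => [/set_mem/= h|[/set_mem/= h h']].
    by split; [apply/mem_set => k kK; apply: h; exact: ltnW|exact: h].
  by apply/mem_set => k /=; rewrite ltnS leq_eqVlt => /predU1P[->//|]; exact: h.
have evaluate (G : Omega -> R) (V : nat -> Omega -> R) :
    \int[P]_w (G w * \1_[set w | forall k, (k < K)%N -> \sum_(i < N) a k i * V i w <= t k] w) =
    \int[P]_w (G w * (1 * at_ (g K) V w) * cos (lin (fun=> 0) (V ^~ w) + 0)).
  apply: eq_Rintegral => w _.
  rewrite big1; last by move=> i _; rewrite mul0r.
  by rewrite addr0 cos0 mulr1 mul1r /g !indicE.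
by rewrite !evaluate; exact: (mg.2 _ (testable_cst 1) a1 (fun=> 0) 0).
Qed.

End cramer_wold.

(** * The characteristic function of the normal density *)

Section normal_cos.
Context {R : realType}.
Local Notation mu := (@lebesgue_measure R).

Lemma is_derive_affine (a b c x : R) :
  is_derive x 1 (fun y : R => a * (y - b) + c) a.
Proof.
rewrite (_ : (fun y => _) = a *: (id - cst b) + cst c); last by apply/funext.
by apply: is_derive_eq; rewrite subr0 addr0 /GRing.scale/= mulr1.
Qed.

Lemma is_derive_cos_affine (a b c x : R) :
  is_derive x 1 (fun y : R => cos (a * (y - b) + c)) (- sin (a * (x - b) + c) * a).
Proof.
exact: (@is_derive1_comp _ (@cos R) (fun y => a * (y - b) + c) x _ _
  (is_derive_cos _) (is_derive_affine a b c x)).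
Qed.

Lemma is_derive_sin_affine (a b c x : R) :
  is_derive x 1 (fun y : R => sin (a * (y - b) + c)) (cos (a * (x - b) + c) * a).
Proof.
exact: (@is_derive1_comp _ (@sin R) (fun y => a * (y - b) + c) x _ _
  (is_derive_sin _) (is_derive_affine a b c x)).
Qed.

Lemma is_derive_normal_pdf (m s x : R) : s != 0 ->
  is_derive x 1 (normal_pdf m s) (- (x - m) / s ^+ 2 * normal_pdf m s x).
Proof.
move=> s0; rewrite normal_pdfE//.
have hq : is_derive x 1 (fun y : R => - (y - m) ^+ 2 / (s ^+ 2 *+ 2)) (- (x - m) / s ^+ 2).
  rewrite (_ : (fun y => _) = (- (s ^+ 2 *+ 2)^-1) *: (id - cst m) ^+ 2); last first.
    by apply/funext => y /=; rewrite !fctE /GRing.scale/= mulNr mulrC mulNr.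
  apply: is_derive_eq; rewrite subr0 /GRing.scale/= expr1 mulr1 -[(_ - _) x]/(x - m).
  by field.
have hE := @is_derive1_comp _ (@expR R) _ x _ _ (is_derive_expR _) hq.
rewrite (_ : (fun y => _) = normal_peak s *: (expR \o (fun y : R => - (y - m) ^+ 2 / (s ^+ 2 *+ 2))));
  last by apply/funext.
by apply: is_derive_eq; rewrite /normal_fun /GRing.scale/=; ring.
Qed.

(** The fundamental theorem of calculus on growing intervals centred at [m]. *)
Lemma Rintegral_derive0 (m : R) (F f : R -> R) :
  continuous f -> mu.-integrable setT (EFin \o f) ->
  (forall x : R, is_derive x 1 F (f x)) ->
  F (m + n.+1%:R) @[n --> \oo] --> (0 : R) ->
  F (m - n.+1%:R) @[n --> \oo] --> (0 : R) ->
  \int[mu]_x f x = 0.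
Proof.
move=> cf intf dF F1 F2.
pose A n := `[m - n.+1%:R, m + n.+1%:R]%classic.
have mf : measurable_fun setT f by exact: continuous_measurable_fun.
have cF : continuous F.
  move=> x; apply: differentiable_continuous; apply/derivable1_diffP.
  by have [] := dF x.
have EA n : (\int[mu]_x (f x * \1_(A n) x)%:E = (F (m + n.+1%:R) - F (m - n.+1%:R))%:E)%E.
  rewrite EFinB -(@continuous_FTC2 _ f); first last.
  - by move=> x _; rewrite derive1E; have [_ ->] := dF x.
  - split; first by move=> x _; have [] := dF x.
      by apply: cvg_at_right_filter; exact: cF.
    by apply: cvg_at_left_filter; exact: cF.
  - exact: continuous_subspaceT.
  - by rewrite ltrD2l gt0_cp.
  rewrite [RHS]integral_mkcond; apply: eq_integral => x _.
  by rewrite patchE indicE; case: ifP; rewrite ?mulr1 ?mulr0.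
have [|||||_ _ h] := @dominated_convergence _ _ _ mu setT measurableT
    (fun n x => (f x * \1_(A n) x)%:E) (fun x => (f x)%:E) (fun x => `|f x|%:E).
- by move=> n; apply/measurable_EFinP/measurable_funM => //; apply: measurable_indic; exact: measurable_itv.
- exact/measurable_EFinP.
- apply: aeW => x _; apply: cvg_EFin; first exact: nearW.
  apply: cvg_near_cst; exists (Num.bound `|x - m|) => // n /= hn.
  rewrite /= indicE mem_set ?mulr1//.
  have : `|x - m| <= n.+1%:R.
    rewrite (le_trans (ltW (archi_boundP _)))// ler_nat.
    exact: leq_trans hn _.
  by rewrite /A/= in_itv/= ler_distl => /andP[-> ->].
- by apply: eq_integrable (integrable_norm intf).
- apply: aeW => x n _ /=; rewrite lee_fin normrM ler_piMr// indicE.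
  by rewrite ger0_norm// lern1 leq_b1.
have /fine_cvg : (fun n => \int[mu]_x (f x * \1_(A n) x)%:E)%E @ \oo --> (\int[mu]_x f x)%:E.
  by rewrite fineK//; exact: integrable_fin_num.
rewrite (_ : fine \o _ = fun n => F (m + n.+1%:R) - F (m - n.+1%:R)); last first.
  by apply/funext => n /=; rewrite EA.
move=> c1; have c2 : F (m + n.+1%:R) - F (m - n.+1%:R) @[n --> \oo] --> (0 - 0 : R).
  exact: cvgB.
by rewrite subr0 in c2; exact: cvg_unique c1 c2.
Qed.

End normal_cos.

Section normal_characteristic_function.
Context {R : realType}.
Local Notation mu := (@lebesgue_measure R).
Variables (m s : R).
Hypothesis s0 : s != 0.

Let s2_gt0 : 0 < s ^+ 2. Proof. by rewrite exprn_even_gt0. Qed.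

Lemma normal_pdf_le_inv (z : R) : 1 <= `|z| ->
  normal_pdf m s (m + z) <= normal_peak s * (s ^+ 2 *+ 2) / `|z|.
Proof.
move=> z1; have z0 : 0 < `|z| by lra.
rewrite normal_pdfE// /normal_fun -mulrA ler_wpM2l ?normal_peak_ge0//.
have -> : - (m + z - m) ^+ 2 / (s ^+ 2 *+ 2) = - (`|z| ^+ 2 / (s ^+ 2 *+ 2)).
  by rewrite real_normK ?num_real//; field.
set u := _ / _.
have u0 : 0 < u by rewrite divr_gt0 ?exprn_gt0// pmulrn_lgt0.
rewrite expRN.
have h : u^-1 <= (s ^+ 2 *+ 2) / `|z|.
  rewrite /u invf_div ler_wpM2l//; first by rewrite pmulrn_lge0// ltW.
  by rewrite lef_pV2 ?posrE ?exprn_gt0// expr2 ler_pMr.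
apply: le_trans h; rewrite lef_pV2 ?posrE ?expR_gt0//.
by apply: le_trans (expR_ge1Dx u); lra.
Qed.

Lemma normal_pdf_cvg0 (e : bool) :
  normal_pdf m s (m + (-1) ^+ e * n.+1%:R) @[n --> \oo] --> (0 : R).
Proof.
have c : normal_peak s * (s ^+ 2 *+ 2) * n.+1%:R^-1 @[n --> \oo] --> (0 : R).
  rewrite -[X in _ --> X](mulr0 (normal_peak s * (s ^+ 2 *+ 2))).
  by apply: cvgM; [exact: cvg_cst|exact: cvg_harmonic].
apply: (squeeze_cvgr _ (cvg_cst 0) c); apply: nearW => n.
rewrite normal_pdf_ge0/=.
have E : `|(-1) ^+ e * n.+1%:R| = n.+1%:R :> R.
  by rewrite normrM normrX normrN1 expr1n mul1r ger0_norm.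
by rewrite -[X in _ / X]E; apply: normal_pdf_le_inv; rewrite E ler1n.
Qed.

(** With a = |x - m| / |s|, one has a <= 1 + a^2 / 4 <= exp (a^2 / 4). This costs
    half of the Gaussian exponent, and the remaining decay is at least that of the
    density with standard deviation [2 * s]. *)
Lemma normal_pdf_moment_le (x : R) :
  `|x - m| * normal_pdf m s x <=
  `|s| * normal_peak s / normal_peak (2 * s) * normal_pdf m (2 * s) x.
Proof.
have s20 : 2 * s != 0 by rewrite mulf_neq0.
have p0 : normal_peak (2 * s) != 0 by rewrite gt_eqF// normal_peak_gt0.
rewrite !normal_pdfE//.
suff : `|x - m| * normal_fun m s x <= `|s| * normal_fun m (2 * s) x.
  move=> /(ler_wpM2l (normal_peak_ge0 s)) h.
  have -> : `|x - m| * (normal_peak s * normal_fun m s x) =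
    normal_peak s * (`|x - m| * normal_fun m s x) by ring.
  by apply: le_trans h _; rewrite le_eqVlt; apply/orP; left; apply/eqP; field.
rewrite /normal_fun.
set z := x - m.
have sn0 : 0 < `|s| by rewrite normr_gt0.
have -> : - z ^+ 2 / (s ^+ 2 *+ 2) = - ((`|z| / `|s|) ^+ 2 / 2).
  by rewrite expr_div_n !real_normK ?num_real//; field.
have -> : - z ^+ 2 / ((2 * s) ^+ 2 *+ 2) = - ((`|z| / `|s|) ^+ 2 / 8).
  by rewrite expr_div_n !real_normK ?num_real//; field.
have : 0 <= `|z| / `|s| by rewrite divr_ge0.
have : `|z| = `|s| * (`|z| / `|s|) by rewrite mulrC divfK// gt_eqF.
move: (`|z| / `|s|) => a -> a0; rewrite -mulrA ler_pM2l//.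
apply: (@le_trans _ _ (expR (a ^+ 2 / 4) * expR (- (a ^+ 2 / 2)))).
  rewrite ler_wpM2r ?expR_ge0//; apply: le_trans (expR_ge1Dx _).
  by have := sqr_ge0 (1 - a / 2); lra.
by rewrite -expRD ler_expR; have := sqr_ge0 a; lra.
Qed.

Lemma integrable_normal_moment :
  mu.-integrable setT (EFin \o (fun x => `|x - m| * normal_pdf m s x)).
Proof.
pose C := `|s| * normal_peak s / normal_peak (2 * s).
have i2 : mu.-integrable setT (EFin \o (fun x => C * normal_pdf m (2 * s) x)).
  rewrite (_ : EFin \o _ = (fun x => C%:E * (normal_pdf m (2 * s) x)%:E)%E).
    by apply: integrableZl => //; exact: integrable_normal_pdf.
  by apply/funext => x /=; rewrite EFinM.
apply: le_integrable i2 => //.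
  apply/measurable_EFinP/measurable_funM; last exact: measurable_normal_pdf.
  by apply: measurableT_comp => //; exact: measurable_funB.
move=> x _; rewrite /= lee_fin ger0_norm ?mulr_ge0 ?normal_pdf_ge0//.
by apply: le_trans (normal_pdf_moment_le x) (ler_norm _).
Qed.

Lemma integrable_normal_bounded (g : R -> R) :
  measurable_fun setT g -> (forall x, `|g x| <= 1) ->
  mu.-integrable setT (EFin \o (fun x => g x * normal_pdf m s x)).
Proof.
move=> mg g1.
have i1 : mu.-integrable setT (EFin \o normal_pdf m s) by exact: integrable_normal_pdf.
apply: le_integrable i1 => //.
  by apply/measurable_EFinP/measurable_funM => //; exact: measurable_normal_pdf.
by move=> x _; rewrite /= lee_fin normrM ler_piMl.
Qed.

Lemma integrable_normal_moment_bounded (g : R -> R) :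
  measurable_fun setT g -> (forall x, `|g x| <= 1) ->
  mu.-integrable setT (EFin \o (fun x => (x - m) * g x * normal_pdf m s x)).
Proof.
move=> mg g1.
apply: le_integrable integrable_normal_moment => //.
  apply/measurable_EFinP/measurable_funM; last exact: measurable_normal_pdf.
  by apply: measurable_funM => //; exact: measurable_funB.
move=> x _; rewrite /= lee_fin !normrM normr_id ler_wpM2r//.
by rewrite ler_piMr.
Qed.

Lemma measurable_cos_affine (t c : R) :
  measurable_fun setT (fun x : R => cos (t * (x - m) + c)).
Proof.
apply: continuous_measurable_fun => x; apply: differentiable_continuous.
by apply/derivable1_diffP; have [] := is_derive_cos_affine t m c x.
Qed.

Lemma measurable_sin_affine (t c : R) :
  measurable_fun setT (fun x : R => sin (t * (x - m) + c)).
Proof.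
apply: continuous_measurable_fun => x; apply: differentiable_continuous.
by apply/derivable1_diffP; have [] := is_derive_sin_affine t m c x.
Qed.

(** Stein's identity: the density satisfies f' = - (x - m) / s^2 f, so that the
    derivative of sin (t (x - m) + c) f(x), whose integral vanishes, is a
    combination of the two integrands. *)
Lemma normal_sin_moment (t c : R) :
  \int[mu]_x ((x - m) * sin (t * (x - m) + c) * normal_pdf m s x) =
  s ^+ 2 * t * \int[mu]_x (cos (t * (x - m) + c) * normal_pdf m s x).
Proof.
have cos1 x : `|cos (t * (x - m) + c)| <= 1 by rewrite ler_norml cos_geN1 cos_le1.
have sin1 x : `|sin (t * (x - m) + c)| <= 1 by rewrite ler_norml sin_geN1 sin_le1.
have icos := integrable_normal_bounded (measurable_cos_affine t c) cos1.
have isin := integrable_normal_moment_bounded (measurable_sin_affine t c) sin1.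
pose f x := t * (cos (t * (x - m) + c) * normal_pdf m s x) -
   (s ^+ 2)^-1 * ((x - m) * sin (t * (x - m) + c) * normal_pdf m s x).
pose F x := sin (t * (x - m) + c) * normal_pdf m s x.
have dF (x : R) : is_derive x 1 F (f x).
  have h1 := is_derive_sin_affine t m c x.
  have h2 := is_derive_normal_pdf m x s0.
  rewrite (_ : F = (fun y => sin (t * (y - m) + c)) * normal_pdf m s)//.
  by apply: is_derive_eq; rewrite /f /GRing.scale/=; field.
have cpdf := @continuous_normal_pdf R m s s0.
have cf : continuous f.
  move=> x; apply: cvgB; apply: cvgM; try exact: cvg_cst.
    apply: cvgM; last exact: cpdf.
    apply: differentiable_continuous; apply/derivable1_diffP.
    by have [] := is_derive_cos_affine t m c x.
  apply: cvgM; last exact: cpdf.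
  apply: cvgM; first by apply: cvgB; [exact: cvg_id|exact: cvg_cst].
  apply: differentiable_continuous; apply/derivable1_diffP.
  by have [] := is_derive_sin_affine t m c x.
have tiny (e : bool) : F (m + (-1) ^+ e * n.+1%:R) @[n --> \oo] --> (0 : R).
  apply/norm_cvg0P; apply: (squeeze_cvgr _ (cvg_cst 0) (normal_pdf_cvg0 e)).
  apply: nearW => n; rewrite normr_ge0/= normrM [X in _ * X <= _]ger0_norm ?normal_pdf_ge0//.
  by rewrite ler_piMl ?normal_pdf_ge0//.
have iZ (k : R) g : mu.-integrable setT (EFin \o g) ->
    mu.-integrable setT (EFin \o (fun x => k * g x)).
  move=> ig; rewrite (_ : EFin \o _ = (fun x => k%:E * (EFin \o g) x)%E).
    exact: integrableZl.
  by apply/funext => x /=; rewrite EFinM.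
have i1 := iZ t _ icos; have i2 := iZ (s ^+ 2)^-1 _ isin.
have fi : mu.-integrable setT (EFin \o f).
  exact: eq_integrable (integrableB measurableT i1 i2).
have := Rintegral_derive0 cf fi dF.
move=> /(_ m); have t1 := tiny false; have t2 := tiny true.
rewrite (_ : (fun n => F (m + (-1) ^+ false * n.+1%:R)) = (fun n => F (m + n.+1%:R))) in t1;
  last by apply/funext => n; rewrite mul1r.
rewrite (_ : (fun n => F (m + (-1) ^+ true * n.+1%:R)) = (fun n => F (m - n.+1%:R))) in t2;
  last by apply/funext => n; rewrite expr1 mulN1r.
move=> /(_ t1 t2).
rewrite RintegralB// RintegralZl// RintegralZl// => /eqP; rewrite subr_eq0 => /eqP E.
by rewrite -mulrA E mulrA divff ?mul1r// gt_eqF.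
Qed.

End normal_characteristic_function.

Section normal_cos_formula.
Context {R : realType}.
Local Notation mu := (@lebesgue_measure R).
Variables (m s : R).
Hypothesis s0 : s != 0.

Lemma is_derive_normal_cos (c t : R) :
  is_derive t 1 (fun u => \int[mu]_x (cos (u * (x - m) + c) * normal_pdf m s x))
    (- (s ^+ 2 * t * \int[mu]_x (cos (t * (x - m) + c) * normal_pdf m s x))).
Proof.
have cos1 u x : `|cos (u * (x - m) + c)| <= 1 by rewrite ler_norml cos_geN1 cos_le1.
have sin1 u x : `|sin (u * (x - m) + c)| <= 1 by rewrite ler_norml sin_geN1 sin_le1.
pose f (u x : R) := cos (u * (x - m) + c) * normal_pdf m s x.
have df (u x : R) : is_derive u 1 (f ^~ x) (- ((x - m) * sin (u * (x - m) + c) * normal_pdf m s x)).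
  have h := is_derive_cos_affine (x - m) 0 c u.
  rewrite (_ : f ^~ x = normal_pdf m s x *: (fun u => cos ((x - m) * (u - 0) + c))).
    by apply: is_derive_eq; rewrite /GRing.scale/= subr0 (mulrC u); ring.
  by apply/funext => v; rewrite /f !fctE /GRing.scale/= subr0 (mulrC v); ring.
have intf u : mu.-integrable setT (EFin \o f u).
  exact: (integrable_normal_bounded m s (measurable_cos_affine m u c) (cos1 u)).
have d1 (u x : R) : partial1of2 f u x = - ((x - m) * sin (u * (x - m) + c) * normal_pdf m s x).
  by rewrite partial1of2E; have [_ ->] := df u x.
have tI : `]t - 1, t + 1[%classic t by rewrite /= in_itv/=; apply/andP; split; lra.
have G_ub (u x : R) : `]t - 1, t + 1[%classic u -> setT x ->
    `|partial1of2 f u x| <= `|x - m| * normal_pdf m s x.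
  move=> _ _; rewrite d1 normrN !normrM [X in _ * X <= _]ger0_norm ?normal_pdf_ge0//.
  by rewrite ler_wpM2r ?normal_pdf_ge0// ler_piMr.
have G0 (x : R) : 0 <= `|x - m| * normal_pdf m s x by rewrite mulr_ge0// normal_pdf_ge0.
have dfI (u x : R) : `]t - 1, t + 1[%classic u -> setT x -> derivable (f ^~ x) u 1.
  by move=> _ _; have [] := df u x.
have der := derivable_under_integral measurableT tI (fun u _ => intf u) dfI G0
  (integrable_normal_moment m s0) G_ub.
have val := differentiation_under_integral measurableT tI (fun u _ => intf u) dfI G0
  (integrable_normal_moment m s0) G_ub.
apply: DeriveDef => //.
rewrite -derive1E val -normal_sin_moment//.
under eq_Rintegral do rewrite d1 -mulN1r.
rewrite RintegralZl ?mulN1r//.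
exact: (integrable_normal_moment_bounded m s0 (measurable_sin_affine m t c) (sin1 t)).
Qed.

(** By the preceding lemmas phi(t) = E cos (t (x - m) + c) solves
    phi' = - s^2 t phi, and phi(0) = cos c. The phase [c] treats the cosine and
    the sine at once. *)
Lemma normal_cos (c t : R) :
  \int[mu]_x (cos (t * (x - m) + c) * normal_pdf m s x) =
  cos c * expR (- (t ^+ 2 * s ^+ 2) / 2).
Proof.
pose phi u := \int[mu]_x (cos (u * (x - m) + c) * normal_pdf m s x).
have phi0 : phi 0 = cos c.
  rewrite /phi; under eq_Rintegral do rewrite mul0r add0r.
  rewrite RintegralZl//; last exact: integrable_normal_pdf.
  by rewrite /Rintegral integral_normal_pdf mulr1.
have dE (u : R) : is_derive u 1 (fun u => expR (u ^+ 2 * s ^+ 2 / 2))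
    (u * s ^+ 2 * expR (u ^+ 2 * s ^+ 2 / 2)).
  have hq : is_derive u 1 (fun u : R => u ^+ 2 * s ^+ 2 / 2) (u * s ^+ 2).
    rewrite (_ : (fun u => _) = (s ^+ 2 / 2) *: (id ^+ 2)).
      by apply: is_derive_eq; rewrite /GRing.scale/= expr1 mulr1; field.
    by apply/funext => v; rewrite !fctE /GRing.scale/=; ring.
  have h := @is_derive1_comp _ (@expR R) _ u _ _ (is_derive_expR _) hq.
  by apply: is_derive_eq; rewrite mulrC.
have cst_ : phi t * expR (t ^+ 2 * s ^+ 2 / 2) = phi 0 * expR (0 ^+ 2 * s ^+ 2 / 2).
  apply: (@is_derive_0_is_cst _ (phi * (fun u => expR (u ^+ 2 * s ^+ 2 / 2)))) => u.
  have h := is_derive_normal_cos c u.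
  by apply: is_derive_eq; rewrite /GRing.scale/= -/(phi u); ring.
rewrite -[LHS]/(phi t) mulNr expRN -phi0.
have := cst_; rewrite expr0n/= !mul0r expR0 mulr1 => <-.
by rewrite mulfK// gt_eqF// expR_gt0.
Qed.

End normal_cos_formula.

(** * Random variables with a normal law *)

Section normal_law.
Context {d : measure_display} {Omega : measurableType d} {R : realType}.
Variable P : probability Omega R.
Local Notation mu := (@lebesgue_measure R).

(** The density of the normal law is its Radon-Nikodym derivative. *)
Lemma integral_normal_prob (m s : R) (f : R -> \bar R) :
  (normal_prob m s).-integrable setT f ->
  (\int[normal_prob m s]_x f x = \int[mu]_x (f x * (normal_pdf m s x)%:E))%E.
Proof.
move=> intf; have dom := normal_prob_dominates m s.
have mpdf : measurable_fun setT (fun x => (normal_pdf m s x)%:E).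
  by apply/measurable_EFinP; exact: measurable_normal_pdf.
have mf : measurable_fun setT f by exact: measurable_int intf.
rewrite -(Radon_Nikodym_change_of_variables dom)//.
apply: ae_eq_integral => //; try exact: emeasurable_funM.
have -> : (fun x => f x * (normal_pdf m s x)%:E)%E = (f \* (EFin \o normal_pdf m s))%E by [].
apply: ae_eqe_mul2l.
rewrite Radon_NikodymE//=; case: cid => /= h [h1 h2 h3].
by apply: integral_ae_eq => // E _ mE; rewrite -h3.
Qed.

Lemma mean_normal_law (L : Omega -> R) (m s : R) (g : R -> R) :
  measurable_fun setT L ->
  (forall A, measurable A -> P (L @^-1` A) = normal_prob m s A) ->
  measurable_fun setT g -> (forall x, `|g x| <= 1) ->
  \int[P]_w g (L w) = \int[mu]_x (g x * normal_pdf m s x).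
Proof.
move=> mL lawL mg g1.
have bg : bounded_rv g by split=> //; exists 1.
have mL' : measurable_fun setT (L : Omega -> measurableTypeR R) by exact: mL.
pose LL : {RV P >-> measurableTypeR R} :=
  @mfun_Sub _ _ Omega (measurableTypeR R) L (mem_set mL').
have ig : (normal_prob m s).-integrable setT (EFin \o g) by exact: bounded_rv_integrable.
rewrite /Rintegral; congr fine.
transitivity (\int[distribution P LL]_x (g x)%:E)%E.
  rewrite integral_distribution//=; first exact/measurable_EFinP.
  apply: bounded_rv_integrable; split; last by exists 1.
  exact: measurableT_comp.
transitivity (\int[normal_prob m s]_x (g x)%:E)%E.
  by apply: eq_measure_integral => A mA _; exact: lawL.
by rewrite integral_normal_prob.
Qed.

Lemma mean_cos_normal_law (L : Omega -> R) (m s : R) : s != 0 ->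
  measurable_fun setT L ->
  (forall A, measurable A -> P (L @^-1` A) = normal_prob m s A) ->
  forall t c, \int[P]_w cos (t * (L w - m) + c) =
    cos c * expR (- (t ^+ 2 * s ^+ 2) / 2).
Proof.
move=> s0 mL lawL t c.
rewrite (@mean_normal_law L m s (fun x => cos (t * (x - m) + c)))//.
- exact: normal_cos.
- exact: measurable_cos_affine.
- by move=> x; rewrite ler_norml cos_geN1 cos_le1.
Qed.

(** Any exponential bound suffices: on |x| > a the standard density is at most
    a multiple of exp (- a) times the density with standard deviation 2. *)
Lemma normal_prob_tail (a : R) : 0 <= a ->
  (normal_prob (0 : R) 1 [set x | (a < `|x|)%R] <= (expR 1 * 2 * expR (- a))%R%:E)%E.
Proof.
move=> a0.
have mA : measurable [set x : R | a < `|x|] by exact: measurable_two_tails.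
have n1 : (1 : R) != 0 by [].
have n2 : (2 : R) != 0 by [].
have E (x : R) : a < `|x| ->
    normal_pdf 0 1 x <= expR 1 * 2 * expR (- a) * normal_pdf 0 2 x.
  move=> ax; rewrite !normal_pdfE// /normal_fun !subr0.
  have -> : normal_peak (1 : R) = 2 * normal_peak 2.
    rewrite /normal_peak expr1n mul1r.
    have -> : (2 : R) ^+ 2 * pi *+ 2 = 2 ^+ 2 * (pi *+ 2) by ring.
    rewrite sqrtrM ?sqr_ge0// sqrtr_sqr ger0_norm// invfM. by rewrite mulVKf.
  have -> : expR 1 * 2 * expR (- a) * (normal_peak 2 * expR (- x ^+ 2 / (2 ^+ 2 *+ 2))) =
    2 * normal_peak 2 * (expR 1 * expR (- a) * expR (- x ^+ 2 / (2 ^+ 2 *+ 2))) by ring.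
  rewrite ler_wpM2l ?mulr_ge0 ?normal_peak_ge0// -!expRD ler_expR.
  have -> : x ^+ 2 = `|x| ^+ 2 by rewrite real_normK ?num_real.
  (* 3/8 x^2 - |x| + 2/3 = 3/8 (|x| - 4/3)^2, and 2/3 <= 1 *)
  have := sqr_ge0 (`|x| - 4 / 3); lra.
have p2 : (\int[mu]_x (normal_pdf 0 2 x)%:E = 1)%E by exact: integral_normal_pdf.
rewrite -[leRHS]mule1 -p2 -ge0_integralZl//; first last.
- by move=> x _; rewrite lee_fin normal_pdf_ge0.
- by apply/measurable_EFinP; exact: measurable_normal_pdf.
have mr : measurable_fun setT
    (fun x => ((expR 1 * 2 * expR (- a))%:E * (normal_pdf 0 2 x)%:E)%E).
  by apply/measurable_EFinP/measurable_funM => //; exact: measurable_normal_pdf.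
have ml : measurable_fun setT (fun x => (normal_pdf (0 : R) 1 x)%:E).
  by apply/measurable_EFinP; exact: measurable_normal_pdf.
apply: (@le_trans _ _ (\int[mu]_(x in [set x | (a < `|x|)%R])
   ((expR 1 * 2 * expR (- a))%:E * (normal_pdf 0 2 x)%:E))%E).
  apply: ge0_le_integral.
  - exact: mA.
  - by move=> x _; rewrite lee_fin normal_pdf_ge0.
  - exact: measurable_funTS ml.
  - exact: measurable_funTS mr.
  - by move=> x /= /E; rewrite -EFinM lee_fin.
apply: ge0_subset_integral.
- exact: mA.
- exact: measurableT.
- exact: mr.
- by move=> x _; rewrite lee_fin !mulr_ge0 ?normal_pdf_ge0// expR_ge0.
- exact: subsetT.
Qed.

Lemma normal_prob_below_gt0 :
  (0 < normal_prob (0 : R) 1 [set x | (x <= -1)%R])%E.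
Proof.
have mA : measurable [set x : R | x <= -1] by exact: measurable_lower_ray.
have mpdf : measurable_fun setT (fun x => (normal_pdf (0 : R) 1 x)%:E).
  by apply/measurable_EFinP; exact: measurable_normal_pdf.
pose c := normal_peak (1 : R) * expR (-2).
have c0 : 0 < c by rewrite mulr_gt0 ?normal_peak_gt0 ?expR_gt0.
apply: (@lt_le_trans _ _ (\int[mu]_(x in `[(-2)%R, (-1)%R]) c%:E)%E).
  rewrite integral_cst//= lebesgue_measure_itv/= lte_fin.
  by rewrite ifT; [rewrite -EFinB -EFinM lte_fin mulr_gt0//; lra|lra].
rewrite /normal_prob.
apply: (@le_trans _ _ (\int[mu]_(x in `[(-2)%R, (-1)%R]) (normal_pdf 0 1 x)%:E)%E).
  apply: ge0_le_integral.
  - exact: measurable_itv.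
  - by move=> x _; rewrite lee_fin ltW.
  - exact: measurable_cst.
  - exact: measurable_funTS mpdf.
  - move=> x; rewrite /= in_itv/= => /andP[x1 x2].
    rewrite lee_fin normal_pdfE// /c ler_wpM2l ?normal_peak_ge0// ler_expR.
    rewrite subr0; nra.
apply: ge0_subset_integral.
- exact: measurable_itv.
- exact: mA.
- exact: measurable_funTS mpdf.
- by move=> x _; rewrite lee_fin normal_pdf_ge0.
- by move=> x; rewrite /= in_itv/= => /andP[].
Qed.

End normal_law.

(** * Gaussian vectors with nonnegative covariances *)

Section covariance_form.
Context {R : realType}.
Variables (N : nat) (c : nat -> nat -> R).

Definition cov_form (a b : nat -> R) : R :=
  \sum_(i < N) \sum_(j < N) a i * b j * c i j.

Lemma cov_formDl a b e : cov_form (fun i => a i + b i) e = cov_form a e + cov_form b e.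
Proof.
rewrite /cov_form -big_split; apply: eq_bigr => i _.
by rewrite -big_split; apply: eq_bigr => j _ /=; ring.
Qed.

Lemma cov_formZl u a e : cov_form (fun i => u * a i) e = u * cov_form a e.
Proof.
rewrite /cov_form mulr_sumr; apply: eq_bigr => i _.
by rewrite mulr_sumr; apply: eq_bigr => j _ /=; ring.
Qed.

Lemma cov_form_suml K (u : nat -> R) (a : nat -> nat -> R) e :
  cov_form (fun i => \sum_(k < K) u k * a k i) e = \sum_(k < K) u k * cov_form (a k) e.
Proof.
elim: K => [|K IH].
  rewrite big_ord0 /cov_form big1// => i _; rewrite big1// => j _.
  by rewrite big_ord0 !mul0r.
rewrite big_ord_recr /= -IH -(cov_formZl (u K)) -cov_formDl; congr (cov_form _ e).
by apply/funext => i; rewrite big_ord_recr.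
Qed.

Hypothesis cC : forall i j, c i j = c j i.

Lemma cov_formC a b : cov_form a b = cov_form b a.
Proof.
rewrite /cov_form exchange_big; apply: eq_bigr => i _; apply: eq_bigr => j _ /=.
by rewrite cC; ring.
Qed.

Lemma cov_form_orthogonal u a e : cov_form a e = 0 ->
  cov_form (fun i => u * e i + a i) (fun i => u * e i + a i) =
  u ^+ 2 * cov_form e e + cov_form a a.
Proof.
move=> ae.
rewrite cov_formDl cov_formZl cov_formC cov_formDl cov_formZl ae.
rewrite (cov_formC a) cov_formDl cov_formZl (cov_formC e a) ae; ring.
Qed.

End covariance_form.

Section gaussian_vector.
Context {d : measure_display} {Omega : measurableType d} {R : realType}.
Variable P : probability Omega R.
Local Notation pr A := (fine (P A)).

(** Gaussian laws are only used through the cosines of linear forms; the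
    phase [t] includes the sines. The entries are indexed by all natural numbers,
    and the first [N] of them are concerned. *)
Definition gaussian_vector (N : nat) (X : nat -> Omega -> R)
    (c : nat -> nat -> R) : Prop :=
  (forall i, measurable_fun setT (X i)) /\
  forall (a : nat -> R) t, \int[P]_w cos (\sum_(i < N) a i * X i w + t) =
    cos t * expR (- cov_form N c a a / 2).

Lemma pr_ge0 A : 0 <= pr A.
Proof. exact: fine_ge0. Qed.

Lemma prE A : measurable A -> P A = (pr A)%:E.
Proof. by move=> mA; rewrite fineK// fin_num_measure. Qed.

Lemma pr_le1 A : measurable A -> pr A <= 1.
Proof. by move=> mA; rewrite -lee_fin -prE// probability_le1. Qed.

Lemma pr_mono A B : measurable A -> measurable B -> A `<=` B -> pr A <= pr B.
Proof.
by move=> mA mB AB; rewrite -lee_fin -!prE//; apply: le_measure => //; rewrite inE.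
Qed.

Lemma pr_split A B : measurable A -> measurable B ->
  pr A = pr (A `&` B) + pr (A `&` ~` B).
Proof.
move=> mA mB; have mI := measurableI _ _ mA mB.
have mD := measurableI _ _ mA (measurableC mB).
apply: EFin_inj; rewrite EFinD -!prE// -measureU//; last first.
  by rewrite setIACA setICr setI0.
by rewrite -setIUr setUv setIT.
Qed.

Lemma measurable_half_spaces N (Y : nat -> Omega -> R) K (a : nat -> nat -> R)
    (t : nat -> R) : (forall i, measurable_fun setT (Y i)) ->
  measurable [set w | forall k, (k < K)%N -> \sum_(i < N) a k i * Y i w <= t k].
Proof.
move=> mY; case: K => [|K].
  by rewrite (_ : [set w | _] = setT)//; apply/seteqP; split.
apply: (measurable_upto (A := fun k => [set w | \sum_(i < N) a k i * Y i w <= t k])) => k.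
by apply: measurable_rv_le; exact: measurable_lin.
Qed.

Variables (N : nat) (X : nat -> Omega -> R) (c : nat -> nat -> R).
Hypothesis gX : gaussian_vector N X c.
Hypothesis cC : forall i j, c i j = c j i.
Local Notation lin a w := (\sum_(i < N) (a : nat -> R) i * X i w).
Local Notation B := (cov_form N c).

Let mX := gX.1.

Lemma measurable_lin_le (a : nat -> R) t : measurable [set w | lin a w <= t].
Proof.
by apply: measurable_rv_le; exact: measurable_lin.
Qed.

(** Uncorrelated linear forms of a Gaussian vector have independent cosines: in the
    product formula both signs give the same quadratic form. *)
Lemma mean_cos_orthogonal (e l : nat -> R) (u t s : R) : B l e = 0 ->
  \int[P]_w (cos (u * lin e w + t) * cos (lin l w + s)) =
  \int[P]_w cos (u * lin e w + t) * \int[P]_w cos (lin l w + s).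
Proof.
move=> le0.
have E (v : R) w : v * lin e w = lin (fun i => v * e i) w.
  by rewrite mulr_sumr; apply: eq_bigr => i _; rewrite mulrA.
have le0' : B (fun i => -1 * l i) e = 0 by rewrite cov_formZl le0 mulr0.
have split_ w : cos (u * lin e w + t) * cos (lin l w + s) =
   2^-1 * (cos (lin (fun i => u * e i + l i) w + (t + s)) +
           cos (lin (fun i => u * e i + -1 * l i) w + (t - s))).
  have -> : lin (fun i => u * e i + l i) w = u * lin e w + lin l w.
    by rewrite E -big_split; apply: eq_bigr => i _ /=; ring.
  have -> : lin (fun i => u * e i + -1 * l i) w = u * lin e w - lin l w.
    by rewrite E -sumrB; apply: eq_bigr => i _ /=; ring.
  have -> : u * lin e w + lin l w + (t + s) = (u * lin e w + t) + (lin l w + s) by ring.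
  have -> : u * lin e w - lin l w + (t - s) = (u * lin e w + t) - (lin l w + s) by ring.
  by move: (u * lin e w + t) (lin l w + s) => x y; rewrite cosD cosB; field.
under eq_Rintegral do rewrite split_.
have bc (a : nat -> R) r : bounded_rv (fun w => cos (lin a w + r)).
  by apply: bounded_rv_cos; exact: (measurable_funD (measurable_lin a N mX) (measurable_cst r)).
have b1 := bc (fun i => u * e i + l i) (t + s).
have b2 := bc (fun i => u * e i + -1 * l i) (t - s).
rewrite (meanZ _ _ (bounded_rvD b1 b2)) (meanD _ b1 b2).
rewrite (gX.2 (fun i => u * e i + l i)) (gX.2 (fun i => u * e i + -1 * l i)) (gX.2 l).
rewrite (cov_form_orthogonal cC u le0) (cov_form_orthogonal cC u le0').
under [X in _ = X * _]eq_Rintegral do rewrite E.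
rewrite (gX.2 (fun i => u * e i)) cov_formZl cov_formC// cov_formZl.
have -> : B (fun i => -1 * l i) (fun i => -1 * l i) = B l l.
  by rewrite cov_formZl cov_formC// cov_formZl; ring.
have -> : - (u ^+ 2 * B e e + B l l) / 2 = - (u * (u * B e e)) / 2 + - B l l / 2 by field.
by rewrite expRD cosD cosB; field.
Qed.

Section half_space_correlation.
Variables (e : nat -> R) (K : nat) (a : nat -> nat -> R) (t : nat -> R) (w0 : R).
Hypothesis e_gt0 : 0 < B e e.
Hypothesis ae_ge0 : forall k, (k < K)%N -> 0 <= B (a k) e.

Let b k := B (a k) e / B e e.
Let Y k w := lin (fun i => a k i - b k * e i) w.
Let A := [set w | forall k, (k < K)%N -> Y k w <= t k - b k * w0].
Let below := [set w | lin e w <= w0].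
Let G := [set w | forall k, (k < K)%N -> lin (a k) w <= t k].

Let mY k : measurable_fun setT (Y k).
Proof. exact: measurable_lin. Qed.

Let YE k w : Y k w = lin (a k) w - b k * lin e w.
Proof.
by rewrite /Y mulr_sumr -sumrB; apply: eq_bigr => i _; ring.
Qed.

Let AE : A = [set w | forall k, (k < K)%N ->
  \sum_(i < K) (i == k :> nat)%:R * Y i w <= t k - b k * w0].
Proof.
apply/seteqP; split=> w h k kK.
- rewrite (bigD1 (Ordinal kK))//= eqxx mul1r big1 ?addr0; first exact: h.
  by move=> i /negbTE ik; rewrite (_ : (i == k :> nat) = false) ?mul0r.
- have := h k kK; rewrite (bigD1 (Ordinal kK))//= eqxx mul1r big1 ?addr0//.
  by move=> i /negbTE ik; rewrite (_ : (i == k :> nat) = false) ?mul0r.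
Qed.

Let mA : measurable A.
Proof.
by rewrite AE; exact: (measurable_half_spaces K K (fun k i => (i == k)%:R) _ mY).
Qed.

Let mbelow : measurable below. Proof. exact: measurable_lin_le. Qed.

Let mG : measurable G. Proof. exact: (measurable_half_spaces N K a t mX). Qed.

(* First half of the independence of A and W: the cosines of W against A. *)
Let cos_indep u s : \int[P]_w (cos (u * lin e w + s) * \1_A w) =
  \int[P]_w cos (u * lin e w + s) * pr A.
Proof.
have bc (v r : R) : bounded_rv (fun w => cos (v * lin e w + r)).
  apply: bounded_rv_cos; apply: (measurable_funD (f := fun w => v * lin e w)) => //.
  by apply: measurable_funM => //; exact: measurable_lin.
have agree1 : cosines_agree P K Y Y (fun w => cos (u * lin e w + s))
    (fun=> \int[P]_w cos (u * lin e w + s)) (fun=> 1).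
  move=> x r.
  have L w : \sum_(i < K) x i * Y i w =
      lin (fun i => \sum_(k < K) x k * (a k i - b k * e i)) w.
    under [RHS]eq_bigr do rewrite mulr_suml.
    rewrite exchange_big; apply: eq_bigr => k _; rewrite /Y mulr_sumr.
    by apply: eq_bigr => i _ /=; ring.
  have le0 : B (fun i => \sum_(k < K) x k * (a k i - b k * e i)) e = 0.
    rewrite (cov_form_suml N c K x (fun k i => a k i - b k * e i)) big1// => k _.
    have -> : (fun i => a k i - b k * e i) = (fun i => a k i + (- b k) * e i).
      by apply/funext => i; ring.
    by rewrite cov_formDl cov_formZl /b mulNr divfK ?gt_eqF// subrr mulr0.
  under eq_Rintegral do rewrite mulr1 L.
  under [RHS]eq_Rintegral do rewrite mulr1 L.
  rewrite (mean_cos_orthogonal u s r le0) meanZ//; apply: bounded_rv_cos.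
  exact: (measurable_funD (measurable_lin
    (fun i => \sum_(k < K) x k * (a k i - b k * e i)) N mX) (measurable_cst r)).
have := cramer_wold mY mY (bc u s) (bounded_rv_cst _) agree1 K
  (fun k i => (i == k)%:R) (fun k => t k - b k * w0).
rewrite -AE => ->; rewrite meanZ ?mean_indic//; exact: bounded_rv_indic.
Qed.

(* Second half: the same criterion for W alone, weighted by the indicator of A. *)
Let indep : pr (A `&` below) = pr A * pr below.
Proof.
pose V (_ : nat) w := lin e w.
have mV i : measurable_fun setT (V i) by exact: measurable_lin.
have agree1 : cosines_agree P 1 V V (\1_A) (fun=> pr A) (fun=> 1).
  move=> x r; under eq_Rintegral do rewrite mulr1 big_ord1 mulrC.
  under [RHS]eq_Rintegral do rewrite mulr1 big_ord1.
  rewrite cos_indep meanZ 1?mulrC//; apply: bounded_rv_cos.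
  apply: (measurable_funD (f := fun w => x ord0 * V 0%N w)) => //.
  exact: measurable_funM.
have := cramer_wold mV mV (bounded_rv_indic mA) (bounded_rv_cst _) agree1 1
  (fun _ _ => 1) (fun=> w0).
have -> : [set w | forall k, (k < 1)%N -> \sum_(i < 1) 1 * V i w <= w0] = below.
  apply/seteqP; split=> w.
    by move=> /(_ 0%N isT); rewrite big_ord1 mul1r.
  by move=> h k _; rewrite big_ord1 mul1r.
rewrite meanZ ?mean_indic//; last exact: bounded_rv_indic.
move=> <-; rewrite -mean_indic//; last exact: measurableI.
by apply: eq_Rintegral => w _; rewrite indicI.
Qed.

(** Write W for the form [lin e]. Each form [lin (a k)] is the sum of a part Y_k
    that is uncorrelated with W and of b_k W, where b_k >= 0. Let A be the event
    that all Y_k + b_k w0 stay below their thresholds; it is independent of W.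
    On W > w0 the event [G] implies A, and on W <= w0 it is implied by A; hence
    the conditional probability of [G] given W <= w0 is at least P(A), which is
    at least the conditional probability given W > w0. *)
Lemma half_space_correlation : pr below * pr G <= pr (G `&` below).
Proof.
have h1 : pr (A `&` below) <= pr (G `&` below).
  apply: pr_mono; [exact: measurableI|exact: measurableI|].
  move=> w [Aw bw]; split=> // k kK.
  have := Aw k kK; rewrite YE => h.
  have bk : 0 <= b k by rewrite divr_ge0 ?ae_ge0// ltW.
  have : b k * lin e w <= b k * w0 by rewrite ler_wpM2l.
  lra.
have h2 : pr (G `&` ~` below) <= pr (A `&` ~` below).
  have mC := measurableC mbelow.
  apply: pr_mono; [exact: measurableI|exact: measurableI|].
  move=> w [Gw bw]; split=> // k kK; rewrite YE.
  have bk : 0 <= b k by rewrite divr_ge0 ?ae_ge0// ltW.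
  have := Gw k kK.
  have : b k * w0 <= b k * lin e w.
    by rewrite ler_wpM2l//; move: bw => /=; rewrite /below/= => /negP; rewrite -ltNge => /ltW.
  lra.
rewrite indep in h1.
rewrite (pr_split mG mbelow).
have := pr_split mA mbelow; rewrite indep => hA.
have hf : pr (A `&` ~` below) = pr A * (1 - pr below) by lra.
rewrite hf in h2.
have := pr_ge0 below; have := pr_le1 mbelow.
have := pr_ge0 (G `&` below).
move: h1 h2; move: (pr below) (pr A) (pr (G `&` _)) (pr (G `&` _)) => p f x y.
nra.
Qed.

End half_space_correlation.

(** The form [lin e] has the law of s X_0, where s^2 = B e e >= h^2. *)
Lemma gaussian_lower_tail (e : nat -> R) (h : R) : (0 < N)%N -> c 0 0 = 1 ->
  0 <= h -> h ^+ 2 <= B e e ->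
  pr [set w | X 0%N w <= -1] <= pr [set w | lin e w <= - h].
Proof.
move=> N0 c00 h0 hB.
pose s := Num.sqrt (B e e).
have B0 : 0 <= B e e by apply: le_trans hB; exact: sqr_ge0.
have s2 : s ^+ 2 = B e e by rewrite sqr_sqrtr.
have hs : h <= s by rewrite -(ger0_norm h0) -sqrtr_sqr ler_wsqrtr.
pose V (_ : nat) w := lin e w.
pose V' (_ : nat) w := s * X 0%N w.
have mV i : measurable_fun setT (V i) by exact: measurable_lin.
have mV' i : measurable_fun setT (V' i) by exact: measurable_funM.
have agree1 : cosines_agree P 1 V V' (fun=> 1) (fun=> 1) (fun=> 1).
  move=> x r.
  under eq_Rintegral do rewrite !mul1r big_ord1.
  under [RHS]eq_Rintegral do rewrite !mul1r big_ord1.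
  transitivity (\int[P]_w cos (lin (fun i => x 0%N * e i) w + r)).
    by apply: eq_Rintegral => w _; congr (cos (_ + _)); rewrite /V mulr_sumr;
      apply: eq_bigr => i _; rewrite mulrA.
  transitivity (\int[P]_w cos (lin (fun i => (i == 0%N)%:R * (x 0%N * s)) w + r)); last first.
    apply: eq_Rintegral => w _; congr (cos (_ + _)).
    rewrite (bigD1 (Ordinal N0))//= mul1r big1 ?addr0 /V' ?mulrA//.
    by move=> i ik; rewrite (_ : (i == 0%N :> nat) = false) ?mul0r//; apply: negbTE.
  rewrite (gX.2 (fun i => x 0%N * e i)) (gX.2 (fun i => (i == 0%N)%:R * (x 0%N * s))).
  congr (_ * expR (- _ / 2)).
  rewrite cov_formZl cov_formC// cov_formZl -s2 /cov_form.
  rewrite (bigD1 (Ordinal N0))//= (bigD1 (Ordinal N0))//=.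
  rewrite big1; last first.
    by move=> i ik; rewrite (_ : (i == 0%N :> nat) = false) ?mul0r ?mulr0 ?mul0r//; apply: negbTE.
  rewrite big1; last first.
    move=> i ik; rewrite big1// => j _.
    by rewrite (_ : (i == 0%N :> nat) = false) ?mul0r//; apply: negbTE.
  by rewrite c00; ring.
have := cramer_wold mV mV' (bounded_rv_cst _) (bounded_rv_cst _) agree1 1
  (fun _ _ => 1) (fun=> - h).
have -> : [set w | forall k, (k < 1)%N -> \sum_(i < 1) 1 * V i w <= - h] =
    [set w | lin e w <= - h].
  apply/seteqP; split=> w.
    by move=> /(_ 0%N isT); rewrite big_ord1 mul1r.
  by move=> g k _; rewrite big_ord1 mul1r.
have -> : [set w | forall k, (k < 1)%N -> \sum_(i < 1) 1 * V' i w <= - h] =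
    [set w | s * X 0%N w <= - h].
  apply/seteqP; split=> w.
    by move=> /(_ 0%N isT); rewrite big_ord1 mul1r.
  by move=> g k _; rewrite big_ord1 mul1r.
under eq_Rintegral do rewrite mul1r.
under [in X in _ = X -> _]eq_Rintegral do rewrite mul1r.
rewrite !mean_indic; [|exact: measurable_rv_le (mV' 0%N)|exact: measurable_rv_le (mV 0%N)].
move=> ->; apply: pr_mono; [exact: measurable_rv_le|exact: measurable_rv_le (mV' 0%N)|].
move=> w /= Xw.
have : s * X 0%N w <= s * -1 by rewrite ler_wpM2l// sqrtr_ge0.
lra.
Qed.

End gaussian_vector.

Section gaussian_increments.
Context {d : measure_display} {Omega : measurableType d} {R : realType}.
Variable P : probability Omega R.
Local Notation pr A := (fine (P A)).

Lemma sum_indicator_range (V : pzRingType) (N m p : nat) (x : nat -> V) :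
  (m + p <= N)%N ->
  \sum_(i < N) (m <= i < m + p)%N%:R * x i = \sum_(m <= i < m + p) x i.
Proof.
move=> mpN; rewrite -(big_mkord xpredT (fun i => (m <= i < m + p)%N%:R * x i)).
rewrite (@big_cat_nat _ _ _ m)//=; last by rewrite (leq_trans _ mpN)// leq_addr.
rewrite (@big_cat_nat _ _ _ (m + p) m)//= ?leq_addr//.
rewrite big_nat big1 ?add0r; last first.
  by move=> i /andP[_ im]; rewrite leqNgt im mul0r.
rewrite [X in _ + X]big_nat [X in _ + X]big1 ?addr0; last first.
  by move=> i /andP[im _]; rewrite [(i < _)%N]ltnNge im andbF mul0r.
by rewrite big_nat [RHS]big_nat; apply: eq_bigr => i ->; rewrite mul1r.
Qed.

(** The drop before time [m] is positively correlated with the ceiling after it,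
    since all covariances are nonnegative. Its variance is at least [m], the sum of
    the diagonal covariances, hence at least h^2: a drop by [h] has at least the
    probability of a drop of a standard variable by 1. *)
Lemma gaussian_drop_before (m T : nat) (X : nat -> Omega -> R)
    (c : nat -> nat -> R) (h : R) :
  gaussian_vector P (m + T) X c -> (forall i j, c i j = c j i) ->
  (forall i j, 0 <= c i j) -> (forall i, c i i = 1) ->
  (0 < m)%N -> 0 <= h -> h ^+ 2 <= m%:R ->
  pr [set w | X 0%N w <= -1] *
  pr [set w | forall j, (j <= T)%N -> \sum_(m <= i < m + j) X i w <= h] <=
  pr ([set w | forall j, (j <= T)%N -> \sum_(m <= i < m + j) X i w <= h] `&`
      [set w | \sum_(0 <= i < m) X i w <= - h]).
Proof.
move=> gX cC c0 c1 m0 h0 hm.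
pose e (i : nat) : R := (0 <= i < 0 + m)%N%:R.
pose a (j i : nat) : R := (m <= i < m + j)%N%:R.
have e0 i : 0 <= e i by [].
have a0 j i : 0 <= a j i by [].
have Bm : m%:R <= cov_form (m + T) c e e.
  apply: (@le_trans _ _ (\sum_(i < m + T) e i)).
    have := @sum_indicator_range R (m + T) 0 m (fun=> 1).
    rewrite add0n leq_addr => /(_ isT); under eq_bigr do rewrite mulr1.
    by rewrite -/e => ->; rewrite sumr_const_nat subn0.
  apply: ler_sum => i _; rewrite (bigD1 i)//= c1 mulr1.
  rewrite (_ : e i * e i = e i); last by rewrite /e -natrM mulnb andbb.
  by rewrite lerDl sumr_ge0// => j _; rewrite !mulr_ge0.
have Be : 0 < cov_form (m + T) c e e.
  by apply: lt_le_trans Bm; rewrite ltr0n.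
have Ba j : (j < T.+1)%N -> 0 <= cov_form (m + T) c (a j) e.
  by move=> _; rewrite /cov_form; do 2 apply: sumr_ge0 => ? _; rewrite !mulr_ge0.
have := half_space_correlation gX cC (fun=> h) (- h) Be Ba.
have -> : [set w | \sum_(i < m + T) e i * X i w <= - h] =
    [set w | \sum_(0 <= i < m) X i w <= - h].
  by apply/seteqP; split => w; rewrite /= /e (@sum_indicator_range R (m + T) 0 m (X ^~ w)) ?leq_addr.
have -> : [set w | forall k, (k < T.+1)%N -> \sum_(i < m + T) a k i * X i w <= h] =
    [set w | forall j, (j <= T)%N -> \sum_(m <= i < m + j) X i w <= h].
  apply/seteqP; split => w g j jT.
    by rewrite -(@sum_indicator_range R (m + T) m j (X ^~ w)) ?leq_add2l//; exact: g.
  by rewrite /a (@sum_indicator_range R (m + T) m j (X ^~ w)) ?leq_add2l//; exact: g.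
apply: le_trans; rewrite ler_wpM2r ?pr_ge0//.
have -> : [set w | \sum_(0 <= i < m) X i w <= - h] =
    [set w | \sum_(i < m + T) e i * X i w <= - h].
  by apply/seteqP; split => w; rewrite /= /e (@sum_indicator_range R (m + T) 0 m (X ^~ w)) ?leq_addr.
apply: (gaussian_lower_tail gX cC) => //.
- by rewrite (leq_trans m0)// leq_addr.
- exact: le_trans hm Bm.
Qed.

End gaussian_increments.

(** * Paths with bounded steps *)

Section paths.
Context {R : realType}.
Implicit Types (z : nat -> R) (T n : nat) (a : R).

Lemma path_le_steps z T a : z 0%N = 0 ->
  (forall i, (i < T)%N -> `|z i.+1 - z i| <= a) ->
  forall j r, (j + r <= T)%N -> z (j + r)%N <= z j + r%:R * a.
Proof.
move=> z0 za j; elim=> [|r IH] jrT; first by rewrite addn0 mul0r addr0.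
rewrite addnS in jrT *.
have := za _ jrT; rewrite ler_norml => /andP[_ h].
have := IH (ltnW jrT); rewrite -natr1; lra.
Qed.

Lemma path_max_exists z T :
  exists2 k, (k <= T)%N & forall j, (j <= T)%N -> z j <= z k.
Proof.
elim: T => [|T [k kT kmax]].
  by exists 0%N => // j; rewrite leqn0 => /eqP ->.
have [h|h] := leP (z T.+1) (z k).
  exists k; first exact: leqW.
  by move=> j; rewrite leq_eqVlt => /predU1P[->//|]; exact: kmax.
exists T.+1 => // j; rewrite leq_eqVlt => /predU1P[->//|jT].
by apply: le_trans (kmax _ jT) (ltW h).
Qed.

Definition is_argmax z T k := all (fun j => z j <= z k) (iota 0 T.+1).

Lemma is_argmaxP z T k :
  reflect (forall j, (j <= T)%N -> z j <= z k) (is_argmax z T k).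
Proof.
apply: (iffP allP) => h j; first by move=> jT; apply: h; rewrite mem_iota add0n ltnS.
by rewrite mem_iota add0n ltnS => /andP[_ /h].
Qed.

Lemma find_argmax_lt z T n :
  (find (is_argmax z T) (iota 0 T.+1) < n)%N =
  has (fun k => (k < n)%N && is_argmax z T k) (iota 0 T.+1).
Proof.
have hasm : has (is_argmax z T) (iota 0 T.+1).
  have [k kT km] := path_max_exists z T.
  by apply/hasP; exists k; [rewrite mem_iota add0n ltnS|exact/is_argmaxP].
apply/idP/hasP => [fn|[k]].
  have fT : (find (is_argmax z T) (iota 0 T.+1) < T.+1)%N.
    by rewrite -[X in (_ < X)%N](size_iota 0) -has_find.
  exists (find (is_argmax z T) (iota 0 T.+1)); first by rewrite mem_iota add0n fT.
  by rewrite fn/=; have := nth_find 0%N hasm; rewrite nth_iota.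
rewrite mem_iota add0n => /andP[_ kT] /andP[kn km].
apply: leq_ltn_trans kn; rewrite leqNgt; apply/negP => kf.
by have := before_find 0%N kf; rewrite nth_iota// add0n km.
Qed.

(** The maximum is reached before time [n], hence after few steps from 0. *)
Lemma path_bounded_argmax z T n a : 0 <= a -> z 0%N = 0 ->
  (forall i, (i < T)%N -> `|z i.+1 - z i| <= a) ->
  (find (is_argmax z T) (iota 0 T.+1) < n)%N ->
  forall j, (j <= T)%N -> z j <= n%:R * a.
Proof.
move=> a0 z0 za; rewrite find_argmax_lt => /hasP[k].
rewrite mem_iota add0n ltnS => kT /andP[kn /is_argmaxP km] j jT.
apply: (le_trans (km j jT)).
have := path_le_steps z0 za (j := 0) (r := k); rewrite add0n z0 add0r => /(_ kT) h.
by apply: (le_trans h); rewrite ler_wpM2r// ler_nat ltnW.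
Qed.

(** A value above n a at time j forces the [n] values at times j - n + 1, ..., j to
    be positive. *)
Lemma path_bounded_count z T n a : 0 <= a -> z 0%N = 0 ->
  (forall i, (i < T)%N -> `|z i.+1 - z i| <= a) ->
  (count (fun k => 0 < z k)%R (iota 0 T.+1) < n)%N ->
  forall j, (j <= T)%N -> z j <= n%:R * a.
Proof.
move=> a0 z0 za cn j jT; rewrite leNgt; apply/negP => zj.
have nj : (n < j)%N.
  rewrite ltnNge; apply/negP => jn.
  have := path_le_steps z0 za (j := 0) (r := j); rewrite add0n z0 add0r => /(_ jT) h.
  have : j%:R * a <= n%:R * a by rewrite ler_wpM2r// ler_nat.
  lra.
have pos k : (j - n < k)%N -> (k <= j)%N -> 0 < z k.
  move=> kn kj.
  have := path_le_steps z0 za (j := k) (r := j - k); rewrite subnKC// => /(_ jT) h.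
  have : (j - k)%:R * a <= n%:R * a.
    by rewrite ler_wpM2r// ler_nat; lia.
  lra.
suff : (n <= count (fun k => 0 < z k)%R (iota 0 T.+1))%N by rewrite leqNgt cn.
(* the middle block consists of the times j - n + 1, ..., j *)
have -> : T.+1 = ((j - n).+1 + (n + (T - j)))%N by lia.
rewrite iotaD count_cat iotaD count_cat.
rewrite (leq_trans _ (leq_addl _ _))// (leq_trans _ (leq_addr _ _))//.
rewrite add0n (eq_in_count (a2 := xpredT)); first by rewrite count_predT size_iota.
by move=> k; rewrite mem_iota => /andP[k1 k2]; rewrite pos//; lia.
Qed.

Lemma nonpositive_path_argmax z T n : (0 < n)%N -> z 0%N = 0 ->
  (forall j, (j <= T)%N -> z j <= 0) ->
  (find (is_argmax z T) (iota 0 T.+1) < n)%N.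
Proof.
move=> n0 z0 zneg; rewrite find_argmax_lt; apply/hasP; exists 0%N => //.
by rewrite n0; apply/is_argmaxP => j jT; rewrite z0 zneg.
Qed.

Lemma nonpositive_path_count z T n : (0 < n)%N ->
  (forall j, (j <= T)%N -> z j <= 0) ->
  (count (fun k => 0 < z k)%R (iota 0 T.+1) < n)%N.
Proof.
move=> n0 zneg; rewrite (eq_in_count (a2 := xpred0)) ?count_pred0//.
by move=> k; rewrite mem_iota add0n ltnS => /andP[_ kT]; rewrite ltNge zneg.
Qed.

(** A drop by [h] before time [m] makes up for a ceiling [h] after it: the later
    path does not exceed its starting value, so that a maximizer over [0, m] is
    never exceeded afterwards. *)
Lemma path_drop_argmax z m T (h : R) : z 0%N = 0 ->
  (forall j, (j <= T)%N -> z (m + j)%N - z m <= h) -> z m <= - h ->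
  exists2 k, (k < m.+1)%N & forall j, (j <= T)%N -> z (k + j)%N - z k <= 0.
Proof.
move=> z0 up down; have [k km kmax] := path_max_exists z m.
exists k => // j jT; rewrite subr_le0.
have [kj|kj] := leqP (k + j) m; first exact: kmax.
have -> : (k + j = m + (k + j - m))%N by rewrite subnKC// ltnW.
have : z (m + (k + j - m))%N - z m <= h by apply: up; lia.
have := kmax 0%N isT; rewrite z0; lra.
Qed.

End paths.

(** * Persistence of processes with stationary increments *)

Section persistence.
Context {d : measure_display} {Omega : measurableType d} {R : realType}.
Variable P : probability Omega R.
Local Notation pr A := (fine (P A)).

Lemma pr_union_bound (S : set Omega) (A : nat -> set Omega) n :
  measurable S -> (forall k, measurable (A k)) ->
  (forall w, S w -> exists2 k, (k < n)%N & A k w) ->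
  pr S <= \sum_(k < n) pr (A k).
Proof.
move=> mS mA SA.
have : (P S <= \sum_(i < n) P (A i))%E.
  apply: content_subadditive => //.
  move=> w /SA[k kn Akw]; rewrite -bigcup_mkord; exists k => //.
rewrite (prE P mS) (eq_bigr (fun i : 'I_n => (pr (A i))%:E)); last by move=> i _; exact: prE.
by rewrite sumEFin lee_fin.
Qed.

Variable Z : nat -> Omega -> R.

Definition increments_below k T (h : R) : set Omega :=
  [set w | forall j, (j <= T)%N -> Z (k + j)%N w - Z k w <= h].

Definition big_step (i : nat) (a : R) : set Omega :=
  [set w | a < `|Z i.+1 w - Z i w|].

(** What the three types of processes have in common: stationary increments, the
    possibility of preparing a drop by [h] at constant cost within h^2 steps, and
    exponential tails of the steps. *)
Record persistence_process (kappa C : R) : Prop := PersistenceProcess {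
  pp_measurable : forall k, measurable_fun setT (Z k);
  pp_start : forall w, Z 0%N w = 0;
  pp_stationary : forall k T h, 0 <= h ->
    pr (increments_below k T h) = pr (increments_below 0 T h);
  pp_drop : forall m T h, (0 < m)%N -> 0 <= h -> h ^+ 2 <= m%:R ->
    kappa * pr (increments_below m T h) <=
    pr (increments_below m T h `&` [set w | Z m w <= - h]);
  pp_step : forall i a, 0 <= a -> pr (big_step i a) <= C * expR (- a)
}.

Variables (kappa C : R).
Hypothesis kappa_gt0 : 0 < kappa.
Hypothesis pp : persistence_process kappa C.

Let mZ := pp_measurable pp.

Lemma measurable_increments_below k T h : measurable (increments_below k T h).
Proof.
by apply: measurable_upto => j; apply: measurable_rv_le; exact: measurable_funB.
Qed.

Lemma measurable_big_step i a : measurable (big_step i a).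
Proof.
by apply: measurable_rv_abs_gt; exact: measurable_funB.
Qed.

Definition persistence T := pr (increments_below 0 T 0).

Lemma persistence_ge0 T : 0 <= persistence T.
Proof. exact: pr_ge0. Qed.

(** The heart of the argument. Start at time [m], where m is about h^2, and require a
    drop by [h] before. Then some k <= m is the start of a path that never exceeds
    its starting value during the next [T] steps, and each of the m + 1 possible
    starts has probability [persistence T]. *)
Lemma pr_below_level T h : 0 <= h ->
  kappa * pr (increments_below 0 T h) <= (h ^+ 2 + 2) * persistence T.
Proof.
move=> h0; pose m := (Num.truncn (h ^+ 2)).+1.
have hm : h ^+ 2 <= m%:R by rewrite ltW// truncnS_gt// sqr_ge0.
have mh : m%:R <= h ^+ 2 + 1.
  by rewrite -natr1 lerD2r truncn_le sqr_ge0.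
have := pp_drop pp T (ltn0Sn _) h0 hm.
rewrite (pp_stationary pp)// => /le_trans; apply.
have mS : measurable (increments_below m T h `&` [set w | Z m w <= - h]).
  by apply: measurableI; [exact: measurable_increments_below|exact: measurable_rv_le].
apply: le_trans (_ : \sum_(k < m.+1) pr (increments_below k T 0) <= _).
  apply: (pr_union_bound mS (fun k => measurable_increments_below k T 0)).
  by move=> w [up down]; exact: (path_drop_argmax (pp_start pp w) up down).
rewrite (eq_bigr (fun=> persistence T)); last first.
  by move=> i _; exact: (pp_stationary pp).
rewrite sumr_const card_ord -[leLHS]mulr_natl ler_wpM2r ?persistence_ge0//.
rewrite -natr1; lra.
Qed.

Definition some_big_step T (a : R) : set Omega :=
  [set w | exists2 i, (i < T)%N & big_step i a w].

Lemma measurable_some_big_step T a : measurable (some_big_step T a).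
Proof.
rewrite (_ : some_big_step T a = \big[setU/set0]_(i < T) big_step i a).
  by apply: bigsetU_measurable => i _; exact: measurable_big_step.
by rewrite -(bigcup_mkord T (big_step ^~ a)); apply/seteqP; split => w [i]; exists i.
Qed.

Lemma pr_some_big_step T a : 0 <= a ->
  pr (some_big_step T a) <= T%:R * (C * expR (- a)).
Proof.
move=> a0.
apply: le_trans (_ : \sum_(i < T) pr (big_step i a) <= _).
  exact: (pr_union_bound (measurable_some_big_step T a)
    (fun k => measurable_big_step k a)).
rewrite mulr_natl -[X in _ *+ X]card_ord -sumr_const; apply: ler_sum => i _.
exact: (pp_step pp).
Qed.

Lemma steps_bounded T a w : ~ some_big_step T a w ->
  forall i, (i < T)%N -> `|Z i.+1 w - Z i w| <= a.
Proof. by move=> h i iT; rewrite leNgt; apply/negP => g; apply: h; exists i. Qed.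

(** Outside of a rare large step, [E] forces the path below the level n a. *)
Lemma pr_confined_event (E : set Omega) T n a : 0 <= a -> measurable E ->
  (forall w, E w -> (forall i, (i < T)%N -> `|Z i.+1 w - Z i w| <= a) ->
     forall j, (j <= T)%N -> Z j w <= n%:R * a) ->
  pr E <= pr (increments_below 0 T (n%:R * a)) + T%:R * (C * expR (- a)).
Proof.
move=> a0 mE hE.
rewrite (pr_split P mE (measurable_some_big_step T a)) addrC lerD//.
  apply: pr_mono.
  - by apply: measurableI => //; apply: measurableC; exact: measurable_some_big_step.
  - exact: measurable_increments_below.
  - move=> w [Ew nb] j jT; rewrite add0n (pp_start pp) subr0.
    by apply: hE => //; exact: steps_bounded.
apply: le_trans (pr_some_big_step _ a0).
by apply: pr_mono; [apply: measurableI => //|..]; try exact: measurable_some_big_step; move=> w [].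
Qed.

(** Without a large step the path stays below T a, an event of probability at least
    1/2. When [a] is of the order of ln T, the resulting lower bound is a negative
    power of [T] up to logarithms, and large steps become negligible. *)
Lemma persistence_lower_bound T a : 0 <= a -> T%:R * (C * expR (- a)) <= 2^-1 ->
  kappa / 2 <= ((T%:R * a) ^+ 2 + 2) * persistence T.
Proof.
move=> a0 tail.
apply: le_trans (pr_below_level T (mulr_ge0 (ler0n _ T) a0)).
rewrite ler_pM2l//.
have := @pr_confined_event setT T T a a0 measurableT.
rewrite probability_setT /=.
suff h : forall w, setT w -> (forall i, (i < T)%N -> `|Z i.+1 w - Z i w| <= a) ->
     forall j, (j <= T)%N -> Z j w <= T%:R * a by move=> /(_ h); lra.
move=> w _ hs j jT.
have := path_le_steps (pp_start pp w) hs (j := 0) (r := j).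
rewrite add0n (pp_start pp) add0r => /(_ jT) hj.
by apply: (le_trans hj); rewrite ler_wpM2r// ler_nat.
Qed.

End persistence.

(** * Comparison with the persistence probability *)

Section subpolynomial.
Context {R : realType}.

Lemma subpolynomialM (q r : nat -> R) : subpolynomial q -> subpolynomial r ->
  subpolynomial (fun T => q T * r T).
Proof.
move=> [e [e0 qe]] [f [f0 rf]]; exists (fun T => e T + f T); split.
  by rewrite -[X in _ --> X]addr0; exact: cvgD.
near=> T; have -> : q T = T%:R `^ e T by near: T.
have -> : r T = T%:R `^ f T by near: T.
rewrite powRD//; apply/implyP => _; rewrite pnatr_eq0 -lt0n.
by near: T; exact: nbhs_infty_gt.
Unshelve. all: by end_near. Qed.

Lemma subpolynomial_ln (q : nat -> R) : (\forall T \near \oo, 0 < q T) ->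
  ln (q T) / ln T%:R @[T --> \oo] --> (0 : R) -> subpolynomial q.
Proof.
move=> q0 ql; exists (fun T => ln (q T) / ln T%:R); split => //.
near=> T; have qT : 0 < q T by near: T.
have T1 : (1 < T)%N by near: T; exact: nbhs_infty_gt.
have T0 : (T%:R : R) != 0 by rewrite pnatr_eq0; lia.
have lT : ln (T%:R : R) != 0 by rewrite gt_eqF// ln_gt0// ltr1n.
by rewrite /powR (negbTE T0) divfK// lnK.
Unshelve. all: by end_near. Qed.

Lemma ln_ge_near (M : R) : \forall T \near \oo, M <= ln T%:R.
Proof.
near=> T; have : expR M <= T%:R by near: T; exact: nbhs_infty_ger.
move=> h; have T0 : 0 < (T%:R : R) by apply: lt_le_trans h; exact: expR_gt0.
by rewrite -ler_expR lnK.
Unshelve. all: by end_near. Qed.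

Lemma subpolynomial_cst (c : R) : 0 < c -> subpolynomial (fun=> c).
Proof.
move=> c0; apply: subpolynomial_ln; first exact: nearW.
apply/cvgrPdist_le => eps eps0; near=> T.
have h : `|ln c| / eps <= ln T%:R by near: T; exact: ln_ge_near.
have l0 : 0 < ln (T%:R : R).
  by apply: lt_le_trans (_ : 1 <= _) => //; near: T; exact: ln_ge_near.
rewrite sub0r normrN normrM normfV (gtr0_norm l0).
by rewrite ler_pdivrMr// mulrC -ler_pdivrMr.
Unshelve. all: by end_near. Qed.

(** ln y = 2 ln (sqrt y) <= 2 sqrt y, with y = ln T. *)
Lemma subpolynomial_log : subpolynomial (fun T => ln T%:R : R).
Proof.
apply: subpolynomial_ln.
  near=> T; apply: lt_le_trans (_ : 1 <= _) => //; near: T; exact: ln_ge_near.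
apply/cvgrPdist_le => eps eps0; near=> T.
have h : (2 / eps) ^+ 2 <= ln T%:R by near: T; exact: ln_ge_near.
have l1 : 1 <= ln (T%:R : R) by near: T; exact: ln_ge_near.
move: h l1; move: (ln T%:R) => y h l1.
have y0 : 0 < y by lra.
have s0 : 0 < Num.sqrt y by rewrite sqrtr_gt0.
have e2 : 0 < 2 / eps by rewrite divr_gt0.
have hs : 2 / eps <= Num.sqrt y.
  by rewrite -(ger0_norm (ltW e2)) -sqrtr_sqr ler_wsqrtr.
rewrite sub0r normrN ger0_norm; last by rewrite divr_ge0 ?ln_ge0// ltW.
rewrite ler_pdivrMr//.
have : y = Num.sqrt y ^+ 2 by rewrite sqr_sqrtr// ltW.
move: hs s0; move: (Num.sqrt y) => s hs s0 ->.
rewrite expr2 lnM ?posrE// mulrA.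
apply: (@le_trans _ _ (2 * s)); first by have := ln_sublinear s0; lra.
rewrite ler_wpM2r ?(ltW s0)//.
by move: hs; rewrite ler_pdivrMr// mulrC.
Unshelve. all: by end_near. Qed.

End subpolynomial.

Lemma running_max_le0E {d : measure_display} {Omega : measurableType d}
    {R : realType} (Z : nat -> Omega -> R) T :
  (forall w, Z 0%N w = 0) -> (0 < T)%N ->
  [set w | running_max Z T w <= 0] = increments_below Z 0 T 0.
Proof.
move=> Z0 T0; apply/seteqP; split => w.
  rewrite /= /running_max => h j jT; rewrite add0n Z0 subr0.
  case: j jT => [|j] jT; first by rewrite Z0.
  apply: le_trans h; apply: le_bigmax_seq => //.
  by rewrite mem_index_iota; lia.
move=> h; rewrite /= /running_max big_seq_cond; apply: bigmax_le.
  by have := h 1%N T0; rewrite add0n Z0 subr0.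
move=> i /andP[]; rewrite mem_index_iota ltnS => /andP[_ iT] _.
by have := h i iT; rewrite add0n Z0 subr0.
Qed.

Section comparison.
Context {d : measure_display} {Omega : measurableType d} {R : realType}.
Variable P : probability Omega R.
Local Notation pr A := (fine (P A)).
Variables (Z : nat -> Omega -> R) (kappa C : R).
Hypothesis kappa_gt0 : 0 < kappa.
Hypothesis pp : persistence_process P Z kappa C.

(** Steps larger than a = 6 ln T have total probability at most C / T^5, which is
    negligible with respect to the lower bound kappa / (76 T^4) on the persistence
    probability. Without them the event lies below the level n a, which is
    subpolynomial, and so is the factor lost in passing from this level to 0. *)
Lemma persistence_comparison (n : nat -> nat) (E : nat -> set Omega) :
  (forall T, (0 < n T)%N) -> subpolynomial (fun T => (n T)%:R : R) ->
  (forall T, measurable (E T)) ->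
  (forall T, increments_below Z 0 T 0 `<=` E T) ->
  (forall T a w, 0 <= a -> E T w ->
     (forall i, (i < T)%N -> `|Z i.+1 w - Z i w| <= a) ->
     forall j, (j <= T)%N -> Z j w <= (n T)%:R * a) ->
  exists q : nat -> R, subpolynomial q /\ \forall T \near \oo,
    (P (increments_below Z 0 T 0) <= P (E T) <=
     P (increments_below Z 0 T 0) * (q T)%:E)%E.
Proof.
move=> n0 nsub mE IE Econf.
have mI T := measurable_increments_below pp 0 T 0.
exists (fun T => (38 / kappa + 1) * (((n T)%:R * (n T)%:R) * (ln T%:R * ln T%:R))).
split.
  apply: subpolynomialM; first by apply: subpolynomial_cst; rewrite ltr_wpDl// divr_ge0// ltW.
  by apply: subpolynomialM; apply: subpolynomialM => //; exact: subpolynomial_log.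
near=> T.
have x1 : 1 <= (T%:R : R) by near: T; exact: nbhs_infty_ger.
have xC : 2 * C <= (T%:R : R) by near: T; exact: nbhs_infty_ger.
have xk : 76 * C / kappa <= (T%:R : R) by near: T; exact: nbhs_infty_ger.
have L1 : 1 <= ln (T%:R : R) by near: T; exact: ln_ge_near.
apply/andP; split; first by apply: le_measure; rewrite ?inE.
rewrite (prE P (mE T)) (prE P (mI T)) -EFinM lee_fin.
set x : R := T%:R in x1 xC xk L1 *; set L := ln x in L1 *.
have x0 : 0 < x by lra.
have Lx : L <= x by rewrite ltW// ln_sublinear.
pose a := 6 * L; have a0 : 0 <= a by rewrite /a; lra.
have ea : expR (- a) = (x ^+ 6)^-1.
  by rewrite expRN /a (expRM_natl 6) lnK.
(* the power 6 leaves a factor 1 / T, which absorbs the constants *)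
have tailE : x * (C * expR (- a)) = C / x ^+ 5.
  by rewrite ea exprS; field; rewrite ?expf_neq0 ?gt_eqF.
pose p := persistence P Z T.
have p0 : 0 <= p by exact: persistence_ge0.
have x5 : x <= x ^+ 5 by rewrite -[leLHS]expr1 ler_weXn2l.
have x50 : 0 < x ^+ 5 by rewrite exprn_gt0.
have x40 : 0 < x ^+ 4 by rewrite exprn_gt0.
have tail2 : x * (C * expR (- a)) <= 2^-1.
  rewrite tailE ler_pdivrMr//; lra.
have low := persistence_lower_bound kappa_gt0 pp a0 tail2.
rewrite -/x -/p in low.
have x4 : (x * a) ^+ 2 + 2 <= 38 * x ^+ 4.
  have h1 : 1 <= x ^+ 4 by rewrite exprn_ege1.
  have h2 : (x * a) ^+ 2 <= 36 * x ^+ 4.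
    have -> : 36 * x ^+ 4 = (x * (6 * x)) ^+ 2 by ring.
    have xa : 0 <= x * a by rewrite mulr_ge0// ltW.
    have xa2 : x * a <= x * (6 * x) by rewrite ler_pM2l// /a; lra.
    by rewrite ler_sqr ?nnegrE//; exact: le_trans xa xa2.
  lra.
have lowp : kappa / 2 <= 38 * x ^+ 4 * p.
  by apply: (le_trans low); rewrite ler_wpM2r.
have tailp : x * (C * expR (- a)) <= p.
  rewrite tailE ler_pdivrMr//.
  have -> : p * x ^+ 5 = x * (x ^+ 4 * p) by ring.
  have h : kappa / 76 <= x ^+ 4 * p by lra.
  have h3 : x * (kappa / 76) <= x * (x ^+ 4 * p) by rewrite ler_pM2l.
  apply: le_trans h3.
  move: xk; rewrite ler_pdivrMr// => xk; lra.
have up := pr_confined_event pp a0 (mE T) (fun w => Econf T a w a0).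
rewrite -/x in up.
pose N : R := (n T)%:R; rewrite -/N in up *.
have N1 : 1 <= N by rewrite /N ler1n.
have lev := pr_below_level pp T (mulr_ge0 (ler0n R (n T)) a0).
rewrite -/N -/p in lev.
rewrite -[leRHS]/(p * _).
have NL : 1 <= (N * N) * (L * L) by rewrite -[leLHS]mulr1 ler_pM// -[leLHS]mulr1 ler_pM.
have lev2 : pr (increments_below Z 0 T (N * a)) <= 38 / kappa * ((N * N) * (L * L)) * p.
  have -> : 38 / kappa * ((N * N) * (L * L)) * p = (38 * ((N * N) * (L * L)) * p) / kappa by field; rewrite gt_eqF.
  rewrite ler_pdivlMr// mulrC; apply: (le_trans lev); rewrite ler_wpM2r//.
  have -> : (N * a) ^+ 2 = 36 * ((N * N) * (L * L)) by rewrite /a; ring.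
  lra.
apply: (le_trans up); apply: (le_trans (lerD lev2 tailp)).
have : p <= (N * N) * (L * L) * p by rewrite ler_peMl.
lra.
Unshelve. all: by end_near. Qed.

End comparison.

Section conclusion.
Context {d : measure_display} {Omega : measurableType d} {R : realType}.
Variable P : probability Omega R.
Variables (Z : nat -> Omega -> R).
Hypothesis mZ : forall k, measurable_fun setT (Z k).

Lemma measurable_argmax_lt T n : measurable [set w | (argmax_time Z T w < n)%N].
Proof.
pose A k := [set w | forall j, (j <= T)%N -> Z j w - Z k w <= 0].
have mA k : measurable (A k).
  by apply: measurable_upto => j; apply: measurable_rv_le; exact: measurable_funB.
rewrite (_ : [set w | _] = \bigcup_(k in [set k | (k < T.+1)%N]) (if (k < n)%N then A k else set0)).
  rewrite bigcup_mkord; apply: bigsetU_measurable => k _.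
  by case: ifP.
apply/seteqP; split => w.
  rewrite /= [argmax_time _ _ _]/(find (is_argmax (Z ^~ w) T) _) find_argmax_lt => /hasP[k].
  rewrite mem_iota add0n => /andP[_ kT] /andP[kn /is_argmaxP km].
  by exists k => //; rewrite kn => j jT; rewrite subr_le0; exact: km.
move=> [k kT]; case: ifP => // kn Akw.
rewrite /= [argmax_time _ _ _]/(find (is_argmax (Z ^~ w) T) _) find_argmax_lt.
apply/hasP; exists k; first by rewrite mem_iota add0n.
by rewrite kn; apply/is_argmaxP => j jT; rewrite -subr_le0; exact: Akw.
Qed.

Lemma measurable_count_lt T n : measurable [set w | (positive_count Z T w < n)%N].
Proof.
have mpos k : measurable_fun setT (fun w => (0 < Z k w)%R%:R : R).
  have mlt : measurable_fun setT (fun w => 0 < Z k w) by exact: measurable_fun_ltr.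
  have mS : measurable [set w | 0 < Z k w].
    by have := mlt measurableT [set true] I; rewrite setTI.
  rewrite (_ : (fun w => _) = \1_[set w | 0 < Z k w]); first exact: measurable_indic.
  by apply/funext => w; rewrite indicE; congr (nat_of_bool _)%:R; apply/idP/idP => [/mem_set|/set_mem].
have mc : measurable_fun setT (fun w => \sum_(k <- iota 0 T.+1) (0 < Z k w)%R%:R : R).
  exact: measurable_sum.
have mlt : measurable_fun setT (fun w => \sum_(k <- iota 0 T.+1) (0 < Z k w)%R%:R < n%:R :> R).
  exact: measurable_fun_ltr.
have := mlt measurableT [set true] I; rewrite setTI; congr measurable.
have E w : \sum_(k <- iota 0 T.+1) (0 < Z k w)%R%:R = (positive_count Z T w)%:R :> R.
  rewrite /positive_count -sum1_count natr_sum [RHS]big_mkcond.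
  by apply: eq_bigr => k _; case: ifP.
by apply/seteqP; split => w /=; rewrite E ltr_nat.
Qed.

Variables (kappa C : R).
Hypothesis kappa_gt0 : 0 < kappa.
Hypothesis pp : persistence_process P Z kappa C.

Lemma persistence_process_comparison (n : nat -> nat) :
  (forall T, (0 < n T)%N) -> subpolynomial (fun T => (n T)%:R : R) ->
  (exists q : nat -> R, subpolynomial q /\
     \forall T \near \oo,
       (P [set w | (running_max Z T w <= 0)%R]
          <= P [set w | (argmax_time Z T w < n T)%N]
          <= P [set w | (running_max Z T w <= 0)%R] * (q T)%:E)%E) /\
  (exists q : nat -> R, subpolynomial q /\
     \forall T \near \oo,
       (P [set w | (running_max Z T w <= 0)%R]
          <= P [set w | (positive_count Z T w < n T)%N]
          <= P [set w | (running_max Z T w <= 0)%R] * (q T)%:E)%E).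
Proof.
move=> n0 nsub.
have transfer (E : nat -> set Omega) :
    (exists q : nat -> R, subpolynomial q /\ \forall T \near \oo,
       (P (increments_below Z 0 T 0) <= P (E T)
          <= P (increments_below Z 0 T 0) * (q T)%:E)%E) ->
    exists q : nat -> R, subpolynomial q /\ \forall T \near \oo,
       (P [set w | (running_max Z T w <= 0)%R] <= P (E T)
          <= P [set w | (running_max Z T w <= 0)%R] * (q T)%:E)%E.
  move=> [q [qs qE]]; exists q; split => //; near=> T.
  rewrite (running_max_le0E (pp_start pp)); first by near: T.
  by near: T; exact: nbhs_infty_gt.
have nonpos T w : increments_below Z 0 T 0 w -> forall j, (j <= T)%N -> Z j w <= 0.
  by move=> h j jT; have := h j jT; rewrite add0n (pp_start pp) subr0.
split.
- apply: (transfer (fun T => [set w | (argmax_time Z T w < n T)%N])).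
  apply: (persistence_comparison kappa_gt0 pp (n := n)) => //.
  + by move=> T; exact: measurable_argmax_lt.
  + move=> T w /nonpos h.
    exact: (@nonpositive_path_argmax _ (Z ^~ w) T (n T) (n0 T) (pp_start pp w) h).
  + move=> T a w a0 En hs.
    exact: (@path_bounded_argmax _ (Z ^~ w) T (n T) a a0 (pp_start pp w) hs En).
- apply: (transfer (fun T => [set w | (positive_count Z T w < n T)%N])).
  apply: (persistence_comparison kappa_gt0 pp (n := n)) => //.
  + by move=> T; exact: measurable_count_lt.
  + move=> T w /nonpos h.
    exact: (@nonpositive_path_count _ (Z ^~ w) T (n T) (n0 T) h).
  + move=> T a w a0 En hs.
    exact: (@path_bounded_count _ (Z ^~ w) T (n T) a a0 (pp_start pp w) hs En).
Unshelve. all: by end_near. Qed.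

End conclusion.

(** * Sums of a stationary Gaussian sequence *)

Section gaussian_moments.
Context {d : measure_display} {Omega : measurableType d} {R : realType}.
Variable P : probability Omega R.

Lemma square_integrable_int (Y : Omega -> R) : measurable_fun setT Y ->
  P.-integrable setT (EFin \o (fun w => Y w ^+ 2)) ->
  P.-integrable setT (EFin \o Y).
Proof.
move=> mY iY2.
have i1 : P.-integrable setT (EFin \o (fun w => 1 + Y w ^+ 2)).
  have := integrableD measurableT (bounded_rv_integrable P (bounded_rv_cst 1)) iY2.
  by apply: eq_integrable.
apply: le_integrable i1 => //; first exact/measurable_EFinP.
move=> w _ /=; rewrite lee_fin [leRHS]ger0_norm; last by rewrite addr_ge0// sqr_ge0.
rewrite -(real_normK (num_real _)).
by have := sqr_ge0 (`|Y w| - 1); have := normr_ge0 (Y w); nra.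
Qed.

Lemma mul_integrable (Y Y' : Omega -> R) : measurable_fun setT Y ->
  measurable_fun setT Y' ->
  P.-integrable setT (EFin \o (fun w => Y w ^+ 2)) ->
  P.-integrable setT (EFin \o (fun w => Y' w ^+ 2)) ->
  P.-integrable setT (EFin \o (fun w => Y w * Y' w)).
Proof.
move=> mY mY' iY iY'.
have i1 : P.-integrable setT (EFin \o (fun w => Y w ^+ 2 + Y' w ^+ 2)).
  by have := integrableD measurableT iY iY'; apply: eq_integrable.
apply: le_integrable i1 => //; first by apply/measurable_EFinP; exact: measurable_funM.
move=> w _ /=; rewrite lee_fin [leRHS]ger0_norm; last by rewrite addr_ge0// sqr_ge0.
rewrite normrM -(real_normK (num_real (Y w))) -(real_normK (num_real (Y' w))).
have := sqr_ge0 (`|Y w| - `|Y' w|); have := normr_ge0 (Y w); have := normr_ge0 (Y' w).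
nra.
Qed.

(** The parameters of a normal law are read off the derivatives at 0 of the
    means of cos (u Y + t). Degenerate laws are included as s = 0. *)
Section moments_of_cosines.
Variables (Y : Omega -> R).
Hypothesis mY : measurable_fun setT Y.
Hypothesis iY2 : P.-integrable setT (EFin \o (fun w => Y w ^+ 2)).

Let iY := square_integrable_int mY iY2.

Let inI (u : R) : `]u - 1, u + 1[%classic u.
Proof. by rewrite /= in_itv/=; apply/andP; split; lra. Qed.

Let m_affine (u t : R) : measurable_fun setT (fun w => u * Y w + t).
Proof. by apply: measurable_funD => //; exact: measurable_funM. Qed.

Let sin_bounded (u t : R) : bounded_rv (fun w => sin (u * Y w + t)).
Proof.
split; last by exists 1 => w; rewrite ler_norml sin_geN1 sin_le1.
by apply: measurableT_comp (m_affine u t); apply: continuous_measurable_fun; exact: continuous_sin.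
Qed.

Let integrable_Ysin u t : P.-integrable setT (EFin \o (fun w => Y w * sin (u * Y w + t))).
Proof.
apply: le_integrable iY => //.
  by apply/measurable_EFinP; apply: measurable_funM => //; exact: (sin_bounded u t).1.
by move=> w _ /=; rewrite lee_fin normrM ler_piMr// ler_norml sin_geN1 sin_le1.
Qed.

Lemma is_derive_mean_cos (u t : R) :
  is_derive u 1 (fun v => \int[P]_w cos (v * Y w + t))
    (- \int[P]_w (Y w * sin (u * Y w + t))).
Proof.
pose f v w := cos (v * Y w + t).
have df (v : R) w : is_derive v 1 (f ^~ w) (- (Y w * sin (v * Y w + t))).
  have h := is_derive_cos_affine (Y w) 0 t v.
  rewrite (_ : f ^~ w = (fun v => cos (Y w * (v - 0) + t))).
    by apply: is_derive_eq; rewrite subr0 mulrC (mulrC v); ring.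
  by apply/funext => x; rewrite /f subr0 mulrC.
have d1 v w : partial1of2 f v w = - (Y w * sin (v * Y w + t)).
  by rewrite partial1of2E; have [_ ->] := df v w.
have intf v : P.-integrable setT (EFin \o f v).
  by apply: bounded_rv_integrable; exact: bounded_rv_cos.
have iG : P.-integrable setT (EFin \o (fun w => `|Y w|)) by exact: integrable_norm iY.
have ub v w : `]u - 1, u + 1[%classic v -> setT w -> `|partial1of2 f v w| <= `|Y w|.
  by move=> _ _; rewrite d1 normrN normrM ler_piMr// ler_norml sin_geN1 sin_le1.
have dfI v w : `]u - 1, u + 1[%classic v -> setT w -> derivable (f ^~ w) (v : R) 1.
  by move=> _ _; have [] := df v w.
have G0 w : 0 <= `|Y w| by [].
have der := derivable_under_integral measurableT (inI u) (fun u _ => intf u) dfI G0 iG ub.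
have val := differentiation_under_integral measurableT (inI u) (fun u _ => intf u) dfI G0 iG ub.
apply: DeriveDef => //.
rewrite -derive1E val; under eq_Rintegral do rewrite d1 -mulN1r.
by rewrite RintegralZl ?mulN1r//; exact: integrable_Ysin.
Qed.

Lemma is_derive_mean_sin (u : R) :
  is_derive u 1 (fun v => \int[P]_w (Y w * sin (v * Y w + 0)))
    (\int[P]_w (Y w ^+ 2 * cos (u * Y w + 0))).
Proof.
pose f v w := Y w * sin (v * Y w + 0).
have df (v : R) w : is_derive v 1 (f ^~ w) (Y w ^+ 2 * cos (v * Y w + 0)).
  have h := is_derive_sin_affine (Y w) 0 0 v.
  rewrite (_ : f ^~ w = Y w *: (fun v => sin (Y w * (v - 0) + 0))).
    by apply: is_derive_eq; rewrite subr0 /GRing.scale/= (mulrC v); ring.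
  by apply/funext => x; rewrite /f !fctE /GRing.scale/= subr0 (mulrC x).
have d1 v w : partial1of2 f v w = Y w ^+ 2 * cos (v * Y w + 0).
  by rewrite partial1of2E; have [_ ->] := df v w.
have G0 w : 0 <= Y w ^+ 2 by exact: sqr_ge0.
have ub v w : `]u - 1, u + 1[%classic v -> setT w -> `|partial1of2 f v w| <= Y w ^+ 2.
  by move=> _ _; rewrite d1 normrM (ger0_norm (G0 w)) ler_piMr// ler_norml cos_geN1 cos_le1.
have dfI v w : `]u - 1, u + 1[%classic v -> setT w -> derivable (f ^~ w) (v : R) 1.
  by move=> _ _; have [] := df v w.
have intf v : P.-integrable setT (EFin \o f v) by exact: integrable_Ysin.
have der := derivable_under_integral measurableT (inI u) (fun u _ => intf u) dfI G0 iY2 ub.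
have val := differentiation_under_integral measurableT (inI u) (fun u _ => intf u) dfI G0 iY2 ub.
apply: DeriveDef => //.
by rewrite -derive1E val; apply: eq_Rintegral => w _; rewrite d1.
Qed.

Variables m s : R.
Hypothesis cosY : forall u t, \int[P]_w cos (u * (Y w - m) + t) =
  cos t * expR (- (u ^+ 2 * s ^+ 2) / 2).

Let cosY' u t : \int[P]_w cos (u * Y w + t) =
  cos (m * (u - 0) + t) * expR (- (u ^+ 2 * s ^+ 2) / 2).
Proof.
rewrite subr0 -cosY; apply: eq_Rintegral => w _; congr cos; ring.
Qed.

Let is_derive_gauss (u : R) : is_derive u 1 (fun v : R => expR (- (v ^+ 2 * s ^+ 2) / 2))
  (- (u * s ^+ 2) * expR (- (u ^+ 2 * s ^+ 2) / 2)).
Proof.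
have hq : is_derive u 1 (fun v : R => - (v ^+ 2 * s ^+ 2) / 2) (- (u * s ^+ 2)).
  rewrite (_ : (fun v => _) = (- (s ^+ 2 / 2)) *: (id ^+ 2)).
    by apply: is_derive_eq; rewrite /GRing.scale/= expr1 mulr1; field.
  by apply/funext => v; rewrite !fctE /GRing.scale/=; ring.
have h := @is_derive1_comp _ (@expR R) _ u _ _ (is_derive_expR _) hq.
by apply: is_derive_eq; rewrite mulrC.
Qed.

(** Derivative of the mean of sin (u Y) at 0, with sin x = cos (x - pi / 2). *)
Lemma mean_of_cosines : \int[P]_w Y w = m.
Proof.
have d1 := is_derive_mean_cos 0 (- (pi / 2)).
have d2 : is_derive (0 : R) 1 (fun v => \int[P]_w cos (v * Y w + - (pi / 2))) m.
  have h1 := is_derive_cos_affine m 0 (- (pi / 2)) 0.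
  have h2 := is_derive_gauss 0.
  rewrite (_ : (fun v => _) = (fun v => cos (m * (v - 0) + - (pi / 2))) *
     (fun v => expR (- (v ^+ 2 * s ^+ 2) / 2))); last by apply/funext => v; rewrite cosY'.
  apply: is_derive_eq; rewrite /GRing.scale/= !mul0r !oppr0 !mul0r expr0n/= !mul0r oppr0 mul0r expR0.
  by rewrite !addr0 !mulr0 !add0r sinN sin_pihalf opprK !mul1r.
have := (@derive_val _ _ _ _ _ _ _ d1); rewrite (@derive_val _ _ _ _ _ _ _ d2) => ->.
rewrite -mulN1r -[RHS]RintegralZl//.
by apply: eq_Rintegral => w _; rewrite mul0r add0r sinN sin_pihalf; ring.
Qed.

Lemma second_moment_of_cosines : m = 0 -> \int[P]_w (Y w ^+ 2) = s ^+ 2.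
Proof.
move=> m0.
have first_ u : \int[P]_w (Y w * sin (u * Y w + 0)) =
    u * s ^+ 2 * expR (- (u ^+ 2 * s ^+ 2) / 2).
  have d1 := is_derive_mean_cos u 0.
  have d2 := is_derive_gauss u.
  rewrite (_ : (fun v => \int[P]_w cos (v * Y w + 0)) =
     (fun v => expR (- (v ^+ 2 * s ^+ 2) / 2))) in d1; last first.
    by apply/funext => v; rewrite cosY' m0 mul0r addr0 cos0 mul1r.
  have := (@derive_val _ _ _ _ _ _ _ d1); rewrite (@derive_val _ _ _ _ _ _ _ d2).
  by move=> /(congr1 -%R); rewrite opprK => <-; ring.
have d1 := is_derive_mean_sin 0.
have d2 : is_derive (0 : R) 1 (fun v => \int[P]_w (Y w * sin (v * Y w + 0))) (s ^+ 2).
  have h2 := is_derive_gauss 0.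
  rewrite (_ : (fun v => _) = (s ^+ 2 *: id) * (fun v => expR (- (v ^+ 2 * s ^+ 2) / 2))); last first.
    by apply/funext => v; rewrite first_ !fctE /GRing.scale/=; ring.
  apply: is_derive_eq; rewrite /GRing.scale/=.
  by rewrite scaler0 mul0r add0r expr0n/= mul0r oppr0 mul0r expR0 mulr1 mul1r.
have := (@derive_val _ _ _ _ _ _ _ d1); rewrite (@derive_val _ _ _ _ _ _ _ d2) => ->.
by apply: eq_Rintegral => w _; rewrite mul0r addr0 cos0 mulr1.
Qed.

End moments_of_cosines.

Lemma dirac_law_cos (Y : Omega -> R) (m : R) : measurable_fun setT Y ->
  (forall A : set R, measurable A -> P (Y @^-1` A) = \d_m A) ->
  forall u t, \int[P]_w cos (u * (Y w - m) + t) =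
    cos t * expR (- (u ^+ 2 * 0 ^+ 2) / 2).
Proof.
move=> mY law u t.
have mD : measurable [set w | Y w = m].
  by rewrite -[X in measurable X]setTI; exact: mY (measurable_set1 m).
have ae1 : {ae P, forall w, Y w = m}.
  exists (~` [set w | Y w = m]); split; first exact: measurableC.
    have := law [set m] (measurable_set1 m); rewrite diracE mem_set//= => h.
    by rewrite probability_setC// [P _]h subee.
  by move=> w /=.
rewrite expr0n/= mulr0 oppr0 mul0r expR0 mulr1 -[RHS](mean_cst P).
rewrite /Rintegral; congr fine; apply: ae_eq_integral => //.
- apply/measurable_EFinP; apply: (bounded_rv_cos _).1.
  by apply: measurable_funD => //; apply: measurable_funM => //; exact: measurable_funB.
- by apply: filterS ae1 => w /= -> _; rewrite subrr mulr0 add0r.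
Qed.

Lemma gaussian_variable_cos (Y : Omega -> R) : measurable_fun setT Y ->
  gaussian_variable P Y -> exists m s, forall u t,
  \int[P]_w cos (u * (Y w - m) + t) = cos t * expR (- (u ^+ 2 * s ^+ 2) / 2).
Proof.
move=> mY [[m [s [s0 law]]]|[m law]]; exists m.
  exists s => u t; apply: mean_cos_normal_law => //; exact: lt0r_neq0.
by exists 0; exact: dirac_law_cos.
Qed.

Lemma gaussian_variable_mean_cos (Y : Omega -> R) : measurable_fun setT Y ->
  P.-integrable setT (EFin \o (fun w => Y w ^+ 2)) ->
  \int[P]_w Y w = 0 -> gaussian_variable P Y ->
  forall t, \int[P]_w cos (Y w + t) = cos t * expR (- (\int[P]_w (Y w ^+ 2)) / 2).
Proof.
move=> mY iY2 EY /(gaussian_variable_cos mY)[m [s cosY]] t.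
have m0 : m = 0 by rewrite -(mean_of_cosines mY iY2 cosY).
rewrite (second_moment_of_cosines mY iY2 cosY m0).
transitivity (\int[P]_w cos (1 * (Y w - m) + t)).
  by apply: eq_Rintegral => w _; rewrite m0 subr0 mul1r.
by rewrite cosY expr1n mul1r.
Qed.

Lemma standard_gaussian_law (Y : Omega -> R) : measurable_fun setT Y ->
  P.-integrable setT (EFin \o (fun w => Y w ^+ 2)) ->
  \int[P]_w Y w = 0 -> \int[P]_w (Y w ^+ 2) = 1 -> gaussian_variable P Y ->
  forall A, measurable A -> P (Y @^-1` A) = normal_prob 0 1 A.
Proof.
move=> mY iY2 EY EY2 gY; have [[m [s [s0 law]]]|[m law]] := gY.
  have s1 : s != 0 by exact: lt0r_neq0.
  have cosY := mean_cos_normal_law s1 mY law.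
  have m0 : m = 0 by rewrite -(mean_of_cosines mY iY2 cosY).
  have := second_moment_of_cosines mY iY2 cosY m0; rewrite EY2 => ss.
  by rewrite -m0 (_ : 1 = s)//; nra.
have cosY := dirac_law_cos mY law.
have m0 : m = 0 by rewrite -(mean_of_cosines mY iY2 cosY).
have := second_moment_of_cosines mY iY2 cosY m0.
by rewrite EY2 expr0n/= => /eqP; rewrite oner_eq0.
Qed.

End gaussian_moments.

Section stationary_gaussian.
Context {d : measure_display} {Omega : measurableType d} {R : realType}.
Variable P : probability Omega R.
Local Notation pr A := (fine (P A)).

Lemma expectationE (f : Omega -> R) : ('E_P[f] = \int[P]_w (f w)%:E)%E.
Proof. by rewrite unlock. Qed.

Lemma distribution_mean (U V : Omega -> R) :
  measurable_fun setT U -> measurable_fun setT V ->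
  P.-integrable setT (EFin \o U) -> P.-integrable setT (EFin \o V) ->
  (forall A, measurable A -> P (U @^-1` A) = P (V @^-1` A)) ->
  \int[P]_w U w = \int[P]_w V w.
Proof.
move=> mU mV iU iV UV.
pose UU : {RV P >-> R} := mfun_Sub (mem_set mU).
pose VV : {RV P >-> R} := mfun_Sub (mem_set mV).
rewrite /Rintegral; congr fine.
transitivity (\int[distribution P UU]_x x%:E)%E.
  by rewrite integral_distribution.
transitivity (\int[distribution P VV]_x x%:E)%E.
  by apply: eq_measure_integral => A mA _; exact: UV.
by rewrite integral_distribution.
Qed.

Lemma mean_sum n (f : nat -> Omega -> R) :
  (forall i, P.-integrable setT (EFin \o f i)) ->
  P.-integrable setT (EFin \o (fun w => \sum_(i < n) f i w)) /\
  \int[P]_w (\sum_(i < n) f i w) = \sum_(i < n) \int[P]_w f i w.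
Proof.
move=> intf; elim: n => [|n [IH1 IH2]].
  split.
    apply: eq_integrable (bounded_rv_integrable P (bounded_rv_cst 0)) => //.
    by move=> w _ /=; rewrite big_ord0.
  by under eq_Rintegral do rewrite big_ord0; rewrite big_ord0 mean_cst.
split.
  apply: eq_integrable (integrableD measurableT IH1 (intf n)) => //.
  by move=> w _ /=; rewrite big_ord_recr.
under eq_Rintegral do rewrite big_ord_recr.
by rewrite big_ord_recr /= RintegralD// IH2.
Qed.

Lemma integrable_scale (k : R) (f : Omega -> R) :
  P.-integrable setT (EFin \o f) -> P.-integrable setT (EFin \o (fun w => k * f w)).
Proof.
move=> intf; rewrite (_ : EFin \o _ = (fun w => k%:E * (EFin \o f) w)%E).
  exact: integrableZl.
by apply/funext => w /=; rewrite EFinM.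
Qed.

Variable X : nat -> {RV P >-> R}.
Hypothesis statX : stationary X.
Hypothesis gaussX : gaussian_sequence X.
Hypothesis momX : forall i, ('E_P[X i] = 0 /\ 'V_P[X i] = 1)%E.
Hypothesis corX : forall j, 0 <= correlation X j.

Let mX i : measurable_fun setT (X i : Omega -> R).
Proof. exact: measurable_funPT. Qed.

Let second_moment i : (\int[P]_w ((X i w) ^+ 2)%:E = 1)%E.
Proof.
have [EX VX] := momX i.
rewrite -VX /variance unlock EX expectationE.
apply: eq_integral => w _.
have -> : (X i w) ^+ 2 = (X i w - 0) * (X i w - 0) by rewrite subr0 expr2.
by [].
Qed.

Let square_integrable i : P.-integrable setT (EFin \o (fun w => (X i w) ^+ 2)).
Proof.
apply/integrableP; split; first by apply/measurable_EFinP; exact: measurable_funX.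
rewrite (eq_integral (fun w => ((X i w) ^+ 2)%:E)) ?second_moment ?ltry//.
by move=> w _ /=; rewrite ger0_norm// sqr_ge0.
Qed.

Let integrable_mul i j : P.-integrable setT (EFin \o (fun w => X i w * X j w)).
Proof. exact: mul_integrable. Qed.

Let integrable_X i : P.-integrable setT (EFin \o (X i : Omega -> R)).
Proof. exact: square_integrable_int. Qed.

Let mean_X i : \int[P]_w X i w = 0.
Proof. by have [EX _] := momX i; rewrite expectationE in EX; rewrite /Rintegral EX. Qed.

Let measurable_tuple_nth n k : measurable_fun setT (fun t : n.-tuple R => nth 0 t k).
Proof.
have [kn|kn] := ltnP k n; last first.
  rewrite (_ : (fun t => _) = cst 0); first exact: measurable_cst.
  by apply/funext => t; rewrite nth_default// size_tuple.
rewrite (_ : (fun t => _) = (@tnth _ R)^~ (Ordinal kn)); first exact: measurable_tnth.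
by apply/funext => t; rewrite (tnth_nth 0).
Qed.

Let nth_path (n h k : nat) w : (k < n)%N ->
  nth 0 [tuple X (i + h)%N w | i < n] k = X (k + h)%N w.
Proof.
by move=> kn; rewrite -[k in LHS]/(nat_of_ord (Ordinal kn)) -tnth_nth tnth_mktuple.
Qed.

Let nth_path0 (n k : nat) w : (k < n)%N ->
  nth 0 [tuple X i w | i < n] k = X k w.
Proof.
by move=> kn; rewrite -[k in LHS]/(nat_of_ord (Ordinal kn)) -tnth_nth tnth_mktuple.
Qed.

(** Stationarity concerns sets of tuples; the law of a product of two entries is a
    special case. *)
Let cov_le i j : (i <= j)%N -> \int[P]_w (X i w * X j w) = correlation X (j - i).
Proof.
move=> ij; rewrite /correlation expectationE -/(\int[P]_w (X 0%N w * X (j - i)%N w)).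
apply: distribution_mean => //; try exact: integrable_mul; try exact: measurable_funM.
move=> A mA; pose n := (j - i).+1.
pose B := [set t : n.-tuple R | A (nth 0 t 0 * nth 0 t (j - i))].
have mB : measurable B.
  have mm : measurable_fun setT (fun t : n.-tuple R => nth 0 t 0 * nth 0 t (j - i)).
    by apply: measurable_funM; exact: measurable_tuple_nth.
  by have := mm measurableT A mA; rewrite setTI.
have := statX i mB.
rewrite (_ : [set w | _] = (fun w => X i w * X j w) @^-1` A); last first.
  by apply/seteqP; split => w; rewrite /B /= !nth_path// add0n subnK.
move=> ->; congr (P _).
by apply/seteqP; split => w; rewrite /B /= !nth_path0.
Qed.

Let c (i j : nat) := correlation X `|i%:Z - j%:Z|%N.

Let covE i j : \int[P]_w (X i w * X j w) = c i j.
Proof.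
rewrite /c; have [ij|ij] := leqP i j.
  by rewrite cov_le// distnEr.
have -> : \int[P]_w (X i w * X j w) = \int[P]_w (X j w * X i w).
  by apply: eq_Rintegral => w _; rewrite mulrC.
by rewrite cov_le ?(ltnW ij)// distnEl// ltnW.
Qed.

Let second_moment_lin n (a : nat -> R) :
  P.-integrable setT (EFin \o (fun w => (\sum_(i < n) a i * X i w) ^+ 2)) /\
  \int[P]_w ((\sum_(i < n) a i * X i w) ^+ 2) = cov_form n c a a.
Proof.
have E : (fun w => (\sum_(i < n) a i * X i w) ^+ 2) =
    (fun w => \sum_(i < n) \sum_(j < n) a i * a j * (X i w * X j w)).
  apply/funext => w; rewrite expr2 mulr_suml; apply: eq_bigr => i _.
  by rewrite mulr_sumr; apply: eq_bigr => j _; ring.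
have iij i j : P.-integrable setT (EFin \o (fun w => a i * a j * (X i w * X j w))).
  exact: integrable_scale.
have [i1 E1] := mean_sum n (fun i => (mean_sum n (iij i)).1).
rewrite E; split; first exact: i1.
rewrite E1; apply: eq_bigr => i _; rewrite (mean_sum n (iij i)).2.
by apply: eq_bigr => j _; rewrite RintegralZl// covE.
Qed.

Let mean_lin n (a : nat -> R) : \int[P]_w (\sum_(i < n) a i * X i w) = 0.
Proof.
have ii i : P.-integrable setT (EFin \o (fun w => a i * X i w)).
  exact: integrable_scale.
rewrite (mean_sum n ii).2 big1// => i _.
by rewrite RintegralZl// mean_X mulr0.
Qed.

Let mean_cos_lin n (a : nat -> R) t :
  \int[P]_w cos (\sum_(i < n) a i * X i w + t) = cos t * expR (- cov_form n c a a / 2).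
Proof.
have [i2 E2] := second_moment_lin n a.
rewrite -E2; apply: gaussian_variable_mean_cos => //.
exact: (measurable_lin a n mX).
Qed.

(** The steps of [Z] are the entries from index 1 on, whence the shift. *)
Lemma stationary_gaussian_vector n :
  gaussian_vector P n (fun i => X i.+1) c.
Proof.
split=> [i|a t]; first exact: mX.
pose b i := if i is i'.+1 then a i' else 0.
transitivity (\int[P]_w cos (\sum_(i < n.+1) b i * X i w + t)).
  apply: eq_Rintegral => w _; congr (cos (_ + t)).
  by rewrite big_ord_recl /= mul0r add0r.
rewrite mean_cos_lin; congr (_ * expR (- _ / 2)).
rewrite /cov_form big_ord_recl /= big1 ?add0r; last by move=> i _; rewrite !mul0r.
apply: eq_bigr => i _; rewrite big_ord_recl /= mulr0 mul0r add0r.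
apply: eq_bigr => j _; congr (_ * _); rewrite /c; congr (correlation X `|_|%N).
by rewrite /= /bump /= !add1n; lia.
Qed.

Lemma stationary_gaussian_law i (A : set R) : measurable A ->
  P (X i @^-1` A) = normal_prob 0 1 A.
Proof.
apply: standard_gaussian_law => //.
  by rewrite /Rintegral second_moment.
have := gaussX i.+1 (fun j => (j == i)%:R).
rewrite (_ : (fun w => _) = X i)//; apply/funext => w.
rewrite big_ord_recr/= eqxx mul1r big1 ?add0r// => j _.
by rewrite (_ : (j == i :> nat) = false) ?mul0r//; apply/negbTE; rewrite neq_ltn ltn_ord.
Qed.

Let block T h := [set t : T.-tuple R | forall j, (j < T.+1)%N ->
  \sum_(i < T) (0 <= i < 0 + j)%N%:R * nth 0 t i <= h].

Lemma stationary_block k T (h : R) :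
  P [set w | forall j, (j <= T)%N -> \sum_(k.+1 <= i < k.+1 + j) X i w <= h] =
  P [set w | forall j, (j <= T)%N -> \sum_(0 <= i < j) X i w <= h].
Proof.
have mB : measurable (block h : set (T.-tuple R)).
  exact: (measurable_half_spaces T T.+1 (fun j i => (0 <= i < 0 + j)%N%:R) (fun=> h)
    (@measurable_tuple_nth T)).
have sum_nth (t : T.-tuple R) j : (j <= T)%N ->
    \sum_(i < T) (0 <= i < 0 + j)%N%:R * nth 0 t i = \sum_(0 <= i < j) nth 0 t i.
  by move=> jT; rewrite (sum_indicator_range (nth 0 t))// add0n.
transitivity (P [set w | block h [tuple X (i + k.+1)%N w | i < T]]).
  congr (P _); apply/seteqP; split => w g j jT.
    rewrite sum_nth//; apply: le_trans (g j jT).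
    rewrite -{2}[k.+1]add0n -[(_ + j)%N]addnC big_addn addnK.
    rewrite le_eqVlt; apply/orP; left; apply/eqP.
    by apply: eq_big_nat => i /andP[_ ij]; rewrite nth_path// (leq_trans ij).
  apply: le_trans (g j jT); rewrite sum_nth//.
  rewrite -{1}[k.+1]add0n -[(_ + j)%N]addnC big_addn addnK.
  rewrite le_eqVlt; apply/orP; left; apply/eqP.
  by apply: eq_big_nat => i /andP[_ ij]; rewrite nth_path// (leq_trans ij).
rewrite statX//; congr (P _); apply/seteqP; split => w g j jT.
  apply: le_trans (g j jT); rewrite sum_nth// le_eqVlt; apply/orP; left; apply/eqP.
  by apply: eq_big_nat => i /andP[_ ij]; rewrite nth_path0// (leq_trans ij).
rewrite sum_nth//; apply: le_trans (g j jT); rewrite le_eqVlt; apply/orP; left; apply/eqP.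
by apply: eq_big_nat => i /andP[_ ij]; rewrite nth_path0// (leq_trans ij).
Qed.

Variable Z : nat -> Omega -> R.
Hypothesis ZE : forall n w, Z n w = \sum_(1 <= i < n.+1) X i w.

Let Z_increment k j w : Z (k + j)%N w - Z k w = \sum_(k.+1 <= i < k.+1 + j) X i w.
Proof.
rewrite !ZE (@big_cat_nat _ _ _ k.+1)//=; last by rewrite ltnS leq_addr.
by rewrite addrAC subrr add0r.
Qed.

Lemma stationary_gaussian_persistence :
  persistence_process P Z (fine (normal_prob (0 : R) 1 [set x | x <= -1])) (expR 1 * 2).
Proof.
have mle : measurable [set x : R | x <= -1] by exact: measurable_lower_ray.
have incE k T h : increments_below Z k T h =
    [set w | forall j, (j <= T)%N -> \sum_(k.+1 <= i < k.+1 + j) X i w <= h].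
  by apply/seteqP; split => w g j jT; have := g j jT; rewrite Z_increment.
have c0 i j : 0 <= c i j by exact: corX.
have c1 i : c i i = 1.
  rewrite -covE /Rintegral; under eq_integral do rewrite -expr2.
  by rewrite second_moment.
have cC i j : c i j = c j i by rewrite /c distnC.
split.
- move=> k; rewrite (_ : Z k = fun w => \sum_(1 <= i < k.+1) X i w); last exact/funext.
  by apply: measurable_sum => i; exact: mX.
- by move=> w; rewrite ZE big_geq.
- by move=> k T h h0; rewrite !incE !stationary_block.
- move=> m T h m0 h0 hm.
  have := gaussian_drop_before (stationary_gaussian_vector (m + T)) cC c0 c1 m0 h0 hm.
  have -> : [set w | forall j, (j <= T)%N -> \sum_(m <= i < m + j) X i.+1 w <= h] =
      increments_below Z m T h.
    by rewrite incE; apply/seteqP; split => w g j jT; have := g j jT; rewrite big_add1.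
  have -> : [set w | \sum_(0 <= i < m) X i.+1 w <= - h] = [set w | Z m w <= - h].
    by apply/seteqP; split => w; rewrite /= ZE big_add1.
  by rewrite -(stationary_gaussian_law 1 mle).
- move=> i a a0.
  have -> : big_step Z i a = X i.+1 @^-1` [set x | a < `|x|].
    apply/seteqP; split => w; rewrite /big_step /= -(addn1 i) Z_increment addn1 addn1.
    by rewrite big_nat1.
    by rewrite big_nat1.
  have mA : measurable [set x : R | a < `|x|] by exact: measurable_two_tails.
  rewrite stationary_gaussian_law// -lee_fin fineK ?normal_prob_tail//.
  exact: fin_num_measure.
Qed.

End stationary_gaussian.

(** * Independent standard Gaussian variables *)

Section independence.
Context {d : measure_display} {Omega : measurableType d} {R : realType}.
Variable P : probability Omega R.
Local Notation pr A := (fine (P A)).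

Lemma bounded_rv_comp (U : Omega -> R) (f : R -> R) M :
  measurable_fun setT U -> measurable_fun setT f -> (forall x, `|f x| <= M) ->
  bounded_rv (fun w => f (U w)).
Proof. by move=> mU mf fM; split; [exact: measurableT_comp|exists M]. Qed.

Lemma sum_thresholds (n k : nat) : (k <= n)%N -> (\sum_(i < n) (i < k))%N = k.
Proof.
move=> kn; rewrite -(subnKC kn) big_split_ord /=.
rewrite (eq_bigr (fun=> 1%N)) => [|i _]; last by rewrite ltn_ord.
by rewrite sum1_card card_ord big1 ?addn0// => i _; rewrite ltnNge leq_addr.
Qed.

(** Uniform approximation of [f] by its lower sums
    (1 / n) #{k < n : (k + 1) / n <= f}, which are combinations of indicators. *)
Lemma mean_mul_indep01 (U G : Omega -> R) c : measurable_fun setT U -> bounded_rv G ->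
  (forall A, measurable A ->
     \int[P]_w (\1_A (U w) * G w) = \int[P]_w \1_A (U w) * c) ->
  forall f : R -> R, measurable_fun setT f -> (forall x, 0 <= f x <= 1) ->
  \int[P]_w (f (U w) * G w) = \int[P]_w f (U w) * c.
Proof.
move=> mU bG hA f mf f01.
pose A n k := [set x | k.+1%:R <= n.+1%:R * f x].
have mA n k : measurable (A n k).
  have mle : measurable_fun setT (fun x => k.+1%:R <= n.+1%:R * f x).
    by apply: measurable_fun_ler => //; exact: measurable_funM.
  by have := mle measurableT [set true] I; rewrite setTI.
pose g n x : R := \sum_(k < n.+1) n.+1%:R^-1 * \1_(A n k) x.
have gE n x : g n x = (Num.truncn (n.+1%:R * f x))%:R / n.+1%:R.
  have /andP[f0 f1] := f01 x.
  rewrite /g -mulr_sumr mulrC; congr (_ / _).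
  rewrite -[in RHS](@sum_thresholds n.+1 (Num.truncn (n.+1%:R * f x))); last first.
    rewrite -(@ler_nat R); apply: le_trans (_ : n.+1%:R * f x <= _).
      by rewrite truncn_le// mulr_ge0.
    by rewrite ler_piMr.
  rewrite natr_sum; apply: eq_bigr => k _; rewrite indicE /A; congr (nat_of_bool _)%:R.
  by rewrite truncn_gt_nat; apply/idP/idP => [/set_mem|?]; last exact/mem_set.
have g_le n x : g n x <= f x /\ f x <= g n x + n.+1%:R^-1.
  have /andP[f0 f1] := f01 x.
  have nf0 : 0 <= n.+1%:R * f x by rewrite mulr_ge0.
  rewrite gE; split; first by rewrite ler_pdivrMr// [leRHS]mulrC truncn_le.
  rewrite -[X in _ + X]mul1r -mulrDl ler_pdivlMr// [leLHS]mulrC.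
  by rewrite natr1 ltW// truncnS_gt.
have g_ge0 n x : 0 <= g n x by rewrite gE divr_ge0.
have g_le1 n x : `|g n x| <= 1.
  rewrite ger0_norm//; have [h _] := g_le n x; apply: le_trans h _.
  by case/andP: (f01 x).
have g_cvg x : g n x @[n --> \oo] --> f x.
  have c1 : f x - n.+1%:R^-1 @[n --> \oo] --> f x - 0.
    by apply: cvgB; [exact: cvg_cst|exact: cvg_harmonic].
  rewrite subr0 in c1; apply: (squeeze_cvgr _ c1 (cvg_cst (f x))).
  apply: nearW => n; have [h1 h2] := g_le n x.
  by rewrite h1 andbT lerBlDr.
have mg n : measurable_fun setT (g n).
  apply: measurable_sum => k; apply: measurable_funM; first exact: measurable_cst.
  exact: measurable_indic (mA n k).
have b1 n k : bounded_rv (fun w => \1_(A n k) (U w) : R).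
  apply: (@bounded_rv_comp _ _ 1 mU); first exact: measurable_indic.
  by move=> x; rewrite indicE ger0_norm// lern1 leq_b1.
have step n : \int[P]_w (g n (U w) * G w) = \int[P]_w g n (U w) * c.
  pose h N (w : Omega) : R := \sum_(k < N) n.+1%:R^-1 * \1_(A n k) (U w).
  suff aux N : bounded_rv (h N) /\ \int[P]_w (h N w * G w) = \int[P]_w h N w * c.
    exact: (aux n.+1).2.
  elim: N => [|N [IH1 IH2]].
    have -> : h 0%N = fun=> 0 by apply/funext => w; rewrite /h big_ord0.
    split; first exact: bounded_rv_cst.
    by under eq_Rintegral do rewrite mul0r; rewrite !mean_cst mul0r.
  have b2 := bounded_rvM (bounded_rv_cst (n.+1%:R^-1 : R)) (b1 n N).
  have -> : h N.+1 = fun w => h N w + n.+1%:R^-1 * \1_(A n N) (U w).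
    by apply/funext => w; rewrite /h big_ord_recr.
  split; first exact: bounded_rvD.
  transitivity (\int[P]_w (h N w * G w + n.+1%:R^-1 * (\1_(A n N) (U w) * G w))).
    by apply: eq_Rintegral => w _; ring.
  have b3 := bounded_rvM (b1 n N) bG.
  rewrite (meanD _ (bounded_rvM IH1 bG) (bounded_rvM (bounded_rv_cst _) b3)) (meanZ _ _ b3).
  by rewrite hA// IH2 (meanD _ IH1 b2) (meanZ _ _ (b1 n N)); ring.
have [_ [K GK]] := bG.
have [|||_ L1] := @bounded_rv_cvg _ _ _ P (fun n w => g n (U w) * G w) (fun w => f (U w) * G w) (1 * K).
- by move=> n; apply: measurable_funM; [exact: measurableT_comp|exact: bG.1].
- by move=> n w; rewrite normrM ler_pM.
- by move=> w; apply: cvgM; [exact: g_cvg|exact: cvg_cst].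
have [|||_ L2] := @bounded_rv_cvg _ _ _ P (fun n w => g n (U w)) (fun w => f (U w)) 1.
- by move=> n; exact: measurableT_comp.
- by move=> n w; exact: g_le1.
- by move=> w; exact: g_cvg.
rewrite (_ : (fun n => _) = (fun n => \int[P]_w g n (U w) * c)) in L1; last first.
  by apply/funext => n; exact: step.
have L3 : \int[P]_w g n (U w) * c @[n --> \oo] --> \int[P]_w f (U w) * c.
  by apply: cvgM => //; exact: cvg_cst.
exact: cvg_unique L1 L3.
Qed.

Lemma mean_mul_indep (U G : Omega -> R) c : measurable_fun setT U -> bounded_rv G ->
  (forall A, measurable A ->
     \int[P]_w (\1_A (U w) * G w) = \int[P]_w \1_A (U w) * c) ->
  forall f : R -> R, measurable_fun setT f -> (forall x, `|f x| <= 1) ->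
  \int[P]_w (f (U w) * G w) = \int[P]_w f (U w) * c.
Proof.
move=> mU bG hA f mf f1.
pose g x := 2^-1 * (f x + 1).
have mg : measurable_fun setT g.
  by apply: measurable_funM => //; exact: measurable_funD.
have g01 x : 0 <= g x <= 1.
  by have := f1 x; rewrite ler_norml /g => /andP[h1 h2]; apply/andP; split; lra.
have bf : bounded_rv (fun w => f (U w)) by exact: bounded_rv_comp f1.
have bg : bounded_rv (fun w => g (U w)).
  by apply: bounded_rvM; [exact: bounded_rv_cst|apply: bounded_rvD => //; exact: bounded_rv_cst].
have hg := mean_mul_indep01 mU bG hA mg g01.
have mG : \int[P]_w G w = c.
  have := hA setT measurableT.
  under eq_Rintegral do rewrite indicT mul1r.
  by under [in X in _ = X -> _]eq_Rintegral do rewrite indicT; rewrite mean_cst mul1r.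
have E1 : \int[P]_w (g (U w) * G w) = 2^-1 * (\int[P]_w (f (U w) * G w) + c).
  transitivity (\int[P]_w (2^-1 * (f (U w) * G w + G w))).
    by apply: eq_Rintegral => w _; rewrite /g; ring.
  have bfG := bounded_rvM bf bG.
  by rewrite (meanZ _ _ (bounded_rvD bfG bG)) (meanD _ bfG bG) mG.
have E2 : \int[P]_w g (U w) = 2^-1 * (\int[P]_w f (U w) + 1).
  by rewrite (meanZ _ _ (bounded_rvD bf (bounded_rv_cst 1))) (meanD _ bf (bounded_rv_cst 1)) mean_cst.
by move: hg; rewrite E1 E2; lra.
Qed.

Section iid_gaussian.
Variables (V : countZmodType) (xi : V -> {RV P >-> R}).
Hypothesis iid_xi : iid_standard_gaussian xi.

Let mxi x : measurable_fun setT (xi x : Omega -> R).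
Proof. exact: measurable_funPT. Qed.

Let cyl (s : seq V) (A : V -> set R) := \bigcap_(x in [set` s]) xi x @^-1` A x.

Let mpre x (A : set R) : measurable A -> measurable (xi x @^-1` A).
Proof. by move=> mA; rewrite -[X in measurable X]setTI; exact: mxi. Qed.

Let mcyl s A : (forall x, measurable (A x)) -> measurable (cyl s A).
Proof.
by move=> mA; apply: fin_bigcap_measurable => // x _; exact: mpre.
Qed.

Let cylE s A : uniq s -> (forall x, measurable (A x)) ->
  P (cyl s A) = (\prod_(x <- s) P (xi x @^-1` A x))%E.
Proof.
move=> us mA; apply: iid_xi.1 => // x _.
by exists (A x) => //; rewrite setTI.
Qed.

Let cyl_cons x s A : uniq (x :: s) -> (forall x, measurable (A x)) ->
  pr (cyl (x :: s) A) = pr (xi x @^-1` A x) * pr (cyl s A).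
Proof.
move=> us mA; rewrite cylE// big_cons -cylE//; last by case/andP: us.
by rewrite fineM//; apply: fin_num_measure; [exact: mpre|exact: mcyl].
Qed.

Lemma iid_gaussian_law x (A : set R) : measurable A ->
  P (xi x @^-1` A) = normal_prob 0 1 A.
Proof. exact: iid_xi.2. Qed.

Lemma mean_cos_xi x (b t : R) : \int[P]_w cos (b * xi x w + t) =
  cos t * expR (- b ^+ 2 / 2).
Proof.
have := @mean_cos_normal_law _ _ _ P (xi x) 0 1 (oner_neq0 _) (mxi x)
  (@iid_gaussian_law x) b t.
by rewrite expr1n mulr1 => <-; apply: eq_Rintegral => w _; rewrite subr0.
Qed.

(** Independence is given on events. The variables are turned from events into
    cosines one at a time, which explains the remaining cylinder event: splitting
    off b x * xi x by the addition formula leaves two functions of xi x, each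
    against a weight whose means on the events of xi x are known by induction. *)
Lemma mean_cos_iid (s s' : seq V) (b : V -> R) (A : V -> set R) t :
  uniq (s ++ s') -> (forall x, measurable (A x)) ->
  \int[P]_w (cos (\sum_(x <- s) b x * xi x w + t) * \1_(cyl s' A) w) =
  cos t * expR (- (\sum_(x <- s) b x ^+ 2) / 2) * pr (cyl s' A).
Proof.
elim: s s' A t => [|x s IH] s' A t us mA.
  under eq_Rintegral do rewrite big_nil add0r.
  rewrite meanZ; last by apply: bounded_rv_indic; exact: mcyl.
  by rewrite big_nil oppr0 mul0r expR0 mulr1 mean_indic//; exact: mcyl.
have mlin r : measurable_fun setT (fun w => \sum_(x <- s) b x * xi x w + r).
  apply: measurable_funD => //; apply: measurable_sum => i.
  exact: measurable_funM.
pose G r w := cos (\sum_(x <- s) b x * xi x w + r) * \1_(cyl s' A) w.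
have bG r : bounded_rv (G r).
  apply: bounded_rvM; first exact: bounded_rv_cos.
  by apply: bounded_rv_indic; exact: mcyl.
pose c r := cos r * expR (- (\sum_(x <- s) b x ^+ 2) / 2) * pr (cyl s' A).
have us' : uniq (s ++ x :: s').
  by rewrite -[x :: s']cat1s uniq_catCA.
have us2 : uniq s' by move: us; rewrite cat_uniq => /and3P[].
have xs' : x \notin s' by move: us; rewrite /= mem_cat negb_or => /andP[/andP[]].
have hA r (B : set R) : measurable B ->
    \int[P]_w (\1_B (xi x w) * G r w) = \int[P]_w \1_B (xi x w) * c r.
  move=> mB; pose A' y := if y == x then B else A y.
  have mA' y : measurable (A' y) by rewrite /A'; case: ifP.
  have cA' : cyl s' A' = cyl s' A.
    apply: eq_bigcapr => y /= ys; rewrite /A'; case: eqP => // yx.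
    by move: xs'; rewrite -yx ys.
  have cB : cyl (x :: s') A' = xi x @^-1` B `&` cyl s' A.
    rewrite -cA'; apply/seteqP; split => w.
      move=> h; split; last by move=> y ys; apply: h; rewrite /= inE ys orbT.
      by have := h x; rewrite /= mem_head /A' eqxx; exact.
    move=> [h1 h2] y /=; rewrite inE => /predU1P[->|]; last exact: h2.
    by rewrite /A' eqxx.
  have := IH (x :: s') A' r us' mA'.
  rewrite cyl_cons//; last by rewrite /= xs' us2.
  have Ax : A' x = B by rewrite /A' eqxx.
  rewrite cA' Ax => h.
  transitivity (\int[P]_w (cos (\sum_(x <- s) b x * xi x w + r) * \1_(cyl (x :: s') A') w)).
    apply: eq_Rintegral => w _; rewrite cB indicI /G.
    have -> : (\1_(xi x @^-1` B) \* \1_(cyl s' A)) w = \1_B (xi x w) * \1_(cyl s' A) w :> R.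
      by rewrite /= !indicE.
    by rewrite mulrCA.
  rewrite h /c.
  have -> : \int[P]_w \1_B (xi x w) = pr (xi x @^-1` B).
    by rewrite -mean_indic//; exact: mpre.
  by ring.
have tr r := mean_mul_indep (mxi x) (bG r) (hA r).
have mcos : measurable_fun setT (fun y : R => cos (b x * y)).
  apply: measurableT_comp; first by apply: continuous_measurable_fun; exact: continuous_cos.
  exact: measurable_funM.
have msin : measurable_fun setT (fun y : R => sin (b x * y)).
  apply: measurableT_comp; first by apply: continuous_measurable_fun; exact: continuous_sin.
  exact: measurable_funM.
have cos1 (y : R) : `|cos (b x * y)| <= 1 by rewrite ler_norml cos_geN1 cos_le1.
have sin1 (y : R) : `|sin (b x * y)| <= 1 by rewrite ler_norml sin_geN1 sin_le1.
have E1 := tr t _ mcos cos1.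
have E2 := tr (t - pi / 2) _ msin sin1.
have Ecos : \int[P]_w cos (b x * xi x w) = expR (- b x ^+ 2 / 2).
  have := mean_cos_xi x (b x) 0; rewrite cos0 mul1r => <-.
  by apply: eq_Rintegral => w _; rewrite addr0.
have Esin : \int[P]_w sin (b x * xi x w) = 0.
  have := mean_cos_xi x (b x) (- (pi / 2)).
  rewrite cosN cos_pihalf mul0r => <-; apply: eq_Rintegral => w _.
  by rewrite cosB cos_pihalf sin_pihalf mulr0 add0r mulr1.
rewrite Ecos in E1; rewrite Esin mul0r in E2.
have b1 := bounded_rvM (bounded_rv_comp (mxi x) mcos cos1) (bG t).
have b2 := bounded_rvM (bounded_rv_comp (mxi x) msin sin1) (bG (t - pi / 2)).
transitivity (\int[P]_w (cos (b x * xi x w) * G t w + -1 * (sin (b x * xi x w) * G (t - pi / 2) w))).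
  apply: eq_Rintegral => w _; rewrite big_cons /G.
  set L := \sum_(_ <- _) _.
  have -> : cos (L + (t - pi / 2)) = sin (L + t).
    by rewrite addrA cosB cos_pihalf sin_pihalf mulr0 add0r mulr1.
  by rewrite -addrA cosD; ring.
rewrite (meanD _ b1 (bounded_rvM (bounded_rv_cst (-1)) b2)) (meanZ _ _ b2) E1 E2 mulr0 addr0.
rewrite /c big_cons.
have -> : - (b x ^+ 2 + \sum_(j <- s) b j ^+ 2) / 2 =
   - b x ^+ 2 / 2 + - (\sum_(j <- s) b j ^+ 2) / 2 by field.
by rewrite expRD; ring.
Qed.

(** Sites may be visited several times: collecting the coefficients at each site
    gives distinct, hence independent variables. *)
Lemma iid_gaussian_vector N (s : nat -> V) :
  gaussian_vector P N (fun i => xi (s i)) (fun i j => (s i == s j)%:R).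
Proof.
split=> [i|a t]; first exact: mxi.
pose S := undup [seq s (nat_of_ord i) | i <- enum 'I_N].
pose b x := \sum_(i < N | s i == x) a i.
have sS (i : 'I_N) : s i \in S by rewrite mem_undup map_f// mem_enum.
have sumS (f : V -> R) (i : 'I_N) : \sum_(x <- S) (s i == x)%:R * f x = f (s i).
  rewrite (bigD1_seq (s i))//= ?undup_uniq// eqxx mul1r big1 ?addr0// => x xs.
  by rewrite eq_sym (negbTE xs) mul0r.
have bE x : b x = \sum_(i < N) (s i == x)%:R * a i.
  by rewrite /b big_mkcond; apply: eq_bigr => i _; case: ifP; rewrite ?mul1r ?mul0r.
have linE w : \sum_(i < N) a i * xi (s i) w = \sum_(x <- S) b x * xi x w.
  under [RHS]eq_bigr do rewrite bE mulr_suml.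
  rewrite exchange_big; apply: eq_bigr => i _ /=.
  rewrite -(sumS (fun x => a i * xi x w)); apply: eq_bigr => x _; ring.
have formE : cov_form N (fun i j => (s i == s j)%:R) a a = \sum_(x <- S) b x ^+ 2.
  under [RHS]eq_bigr => x _.
    rewrite expr2 {1}bE mulr_suml; over.
  rewrite exchange_big; apply: eq_bigr => i _ /=.
  transitivity (a i * b (s i)).
    rewrite bE mulr_sumr; apply: eq_bigr => j _.
    by rewrite (eq_sym (s i)); ring.
  rewrite -(sumS (fun x => a i * b x)); apply: eq_bigr => x _; ring.
have := @mean_cos_iid S [::] b (fun=> setT) t.
rewrite cats0 undup_uniq => /(_ isT (fun=> measurableT)).
have -> : cyl [::] (fun=> setT) = setT by apply/seteqP; split.
rewrite probability_setT mulr1 formE => <-.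
by apply: eq_Rintegral => w _; rewrite linE indicT mulr1.
Qed.

End iid_gaussian.

Lemma gaussian_law_eq N (X X' : nat -> Omega -> R) c :
  gaussian_vector P N X c -> gaussian_vector P N X' c ->
  forall K (a : nat -> nat -> R) t,
  pr [set w | forall k, (k < K)%N -> \sum_(i < N) a k i * X i w <= t k] =
  pr [set w | forall k, (k < K)%N -> \sum_(i < N) a k i * X' i w <= t k].
Proof.
move=> gX gX' K a t.
have ag : cosines_agree P N X X' (fun=> 1) (fun=> 1) (fun=> 1).
  move=> x r.
  under eq_Rintegral do rewrite !mul1r; under [RHS]eq_Rintegral do rewrite !mul1r.
  by rewrite gX.2 gX'.2.
have := cramer_wold gX.1 gX'.1 (bounded_rv_cst 1) (bounded_rv_cst 1) ag K a t.
under eq_Rintegral do rewrite mul1r.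
under [in X in _ = X -> _]eq_Rintegral do rewrite mul1r.
by rewrite !mean_indic//; apply: measurable_half_spaces; [exact: gX'.1|exact: gX.1].
Qed.

End independence.

(** * Random walk in random scenery *)

Section countable_partition.
Context {d : measure_display} {Omega : measurableType d} {R : realType}.
Variable P : probability Omega R.
Local Notation pr A := (fine (P A)).

Lemma pr_countable_partition (T : countType) (U : Omega -> T) (A : set Omega) :
  measurable A -> (forall e, measurable [set w | U w = e]) ->
  P A = (\sum_(0 <= n <oo) P (A `&` [set w | pickle (U w) = n]))%E.
Proof.
move=> mA mU; pose F n := A `&` [set w | pickle (U w) = n].
have mF n : measurable (F n).
  apply: measurableI => //; case E : (@unpickle T n) => [e|].
    have [en|en] := eqVneq (pickle e) n.
      rewrite (_ : [set w | _] = [set w | U w = e]); first exact: mU.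
      apply/seteqP; split => w /=; last by move=> ->.
      by rewrite -en => /(pcan_inj pickleK).
    rewrite (_ : [set w | _] = set0)//; apply/seteqP; split => w //= h.
    by move: E; rewrite -h pickleK => -[ew]; rewrite -ew h eqxx in en.
  rewrite (_ : [set w | _] = set0)//; apply/seteqP; split => w //= h.
  by move: E; rewrite -h pickleK.
rewrite -(measure_semi_bigcup P mF).
- congr (P _); apply/seteqP; split => w.
    by move=> Aw; exists (pickle (U w)).
  by move=> [n _ []].
- by apply/trivIsetP => i j _ _ ij; apply/seteqP; split => w //= -[[_ h1] [_ h2]];
    rewrite -h1 -h2 eqxx in ij.
- exact: bigcupT_measurable.
Qed.

(** Conditioning on a variable with countably many values. Two such variables are
    allowed, since the events compared may be described by different windows of
    increments. *)
Lemma countable_partition_le (T : countType) (U U' : Omega -> T)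
    (A B : set Omega) (k k' : R) :
  measurable A -> measurable B ->
  (forall e, measurable [set w | U w = e]) ->
  (forall e, measurable [set w | U' w = e]) -> 0 <= k -> 0 <= k' ->
  (forall e, k * pr (A `&` [set w | U w = e]) <= k' * pr (B `&` [set w | U' w = e])) ->
  k * pr A <= k' * pr B.
Proof.
move=> mA mB mU mU' k0 k'0 h.
have fin_ (S : set Omega) : measurable S -> P S \is a fin_num by exact: fin_num_measure.
rewrite -lee_fin !EFinM -!prE//.
rewrite (pr_countable_partition mA mU) (pr_countable_partition mB mU').
rewrite -!nneseriesZl//; apply: lee_nneseries => n _.
  by rewrite mule_ge0// lee_fin.
case E : (@unpickle T n) => [e|]; last first.
  rewrite (_ : A `&` _ = set0); first by rewrite measure0 mule0 mule_ge0// lee_fin.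
  by apply/seteqP; split => w //= -[_ g]; move: E; rewrite -g pickleK.
have [en|en] := eqVneq (pickle e) n; last first.
  rewrite (_ : A `&` _ = set0); first by rewrite measure0 mule0 mule_ge0// lee_fin.
  apply/seteqP; split => w //= -[_ g].
  by move: E; rewrite -g pickleK => -[ew]; rewrite -ew g eqxx in en.
have -> : [set w | pickle (U w) = n] = [set w | U w = e].
  by apply/seteqP; split => w /=; [rewrite -en => /(pcan_inj pickleK)|move=> ->].
have -> : [set w | pickle (U' w) = n] = [set w | U' w = e].
  by apply/seteqP; split => w /=; [rewrite -en => /(pcan_inj pickleK)|move=> ->].
rewrite (prE _ (measurableI _ _ mA (mU e))) (prE _ (measurableI _ _ mB (mU' e))).
by rewrite -!EFinM lee_fin.
Qed.

Lemma countable_partition_eq (T : countType) (U U' : Omega -> T)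
    (A B : set Omega) (k k' : R) :
  measurable A -> measurable B ->
  (forall e, measurable [set w | U w = e]) ->
  (forall e, measurable [set w | U' w = e]) -> 0 <= k -> 0 <= k' ->
  (forall e, k * pr (A `&` [set w | U w = e]) = k' * pr (B `&` [set w | U' w = e])) ->
  k * pr A = k' * pr B.
Proof.
move=> mA mB mU mU' k0 k'0 h; apply/eqP; rewrite eq_le.
by rewrite !(countable_partition_le (T := T) mA mB mU mU')// ?(countable_partition_le (T := T) mB mA mU' mU)// => e; rewrite h.
Qed.

Lemma measurable_countable_comp (T : countType) (U : Omega -> T) (B : T -> set Omega) :
  (forall e, measurable [set w | U w = e]) -> (forall e, measurable (B e)) ->
  measurable [set w | B (U w) w].
Proof.
move=> mU mB.
rewrite (_ : [set w | _] = \bigcup_e ([set w | U w = e] `&` B e)).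
  apply: countable_bigcupT_measurable; first exact: countableP.
  by move=> e; exact: measurableI.
by apply/seteqP; split => w; [move=> h; exists (U w)|move=> [e _ [/= <-]]].
Qed.

End countable_partition.

Section random_scenery.
Context {d : measure_display} {Omega : measurableType d} {R : realType}.
Variable P : probability Omega R.
Local Notation pr A := (fine (P A)).
Context {V : countZmodType}.
Variables (X : nat -> Omega -> V) (xi : V -> {RV P >-> R}) (Z : nat -> Omega -> R).
Hypothesis rwrsZ : is_rwrs X xi Z.

Let mXv k v : measurable [set w | X k w = v].
Proof.
have [[mX _ _] _ _ _] := rwrsZ.
by apply: mX; exists [set v] => //; rewrite setTI.
Qed.

Let mxi v : measurable_fun setT (xi v : Omega -> R).
Proof. exact: measurable_funPT. Qed.

Let gxi : iid_standard_gaussian xi. Proof. by have [] := rwrsZ. Qed.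

Definition window k n w : n.-tuple V := [tuple X (k + i)%N w | i < n].

Definition cylinder k n (g : nat -> V) : set Omega :=
  [set w | forall i, (i < n)%N -> X (k + i)%N w = g i].

Let window_cylinder k n (e : n.-tuple V) :
  [set w | window k n w = e] = cylinder k n (nth 0 e).
Proof.
apply/seteqP; split => w.
  move=> <- i ni; rewrite /window.
  by rewrite -[i in RHS]/(nat_of_ord (Ordinal ni)) -tnth_nth tnth_mktuple.
move=> h; apply: eq_from_tnth => i.
by rewrite tnth_mktuple (tnth_nth 0) h.
Qed.

Let mcylinder k n g : measurable (cylinder k n g).
Proof.
case: n => [|n].
  by rewrite (_ : cylinder _ _ _ = setT)//; apply/seteqP; split.
by apply: (measurable_upto (A := fun i => [set w | X (k + i)%N w = g i])) => j.
Qed.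

Let mwindow k n e : measurable [set w | window k n w = e].
Proof. by rewrite window_cylinder. Qed.

Let pr_cylinder k n g : P (cylinder k n g) = P (cylinder 0 n g).
Proof.
have [[mX indX idX] _ _ _] := rwrsZ.
have E j : P (cylinder j n g) = (\prod_(i <- iota 0 n) P [set w | X 0%N w = g i])%E.
  have := indX (iota j n) (fun i => [set w | X i w = g (i - j)%N]) (iota_uniq _ _).
  have h i : i \in iota j n -> discrete_events (X i) [set w | X i w = g (i - j)%N].
    by move=> _; exists [set g (i - j)%N] => //; rewrite setTI.
  move=> /(_ h) {h}.
  rewrite (_ : \bigcap_(i in _) _ = cylinder j n g); last first.
    apply/seteqP; split => w.
      move=> h i ni; have := h (j + i)%N; rewrite /= mem_iota leq_addr ltn_add2l => /(_ ni).
      by rewrite addKn.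
    move=> h i /=; rewrite mem_iota => /andP[ji ij].
    by have := h (i - j)%N; rewrite subnKC// => ->//; rewrite ltn_subLR.
  move=> ->; rewrite -[X in iota X]addn0 iotaDl big_map.
  apply: eq_bigr => i _; rewrite addKn.
  exact: (idX (j + i)%N [set g i]).
by rewrite !E.
Qed.

Let scenery := <<s \bigcup_x g_sigma_algebra_preimage (xi x) >>.

Let scenery_type := g_sigma_algebraType (\bigcup_x g_sigma_algebra_preimage (xi x)).

Let mscenery x : measurable_fun [set: scenery_type] (xi x : scenery_type -> R).
Proof.
move=> _ B mB; rewrite setTI; apply: sub_sigma_algebra.
by exists x => //; exists B => //; rewrite setTI.
Qed.

Let scenery_half_spaces N K (s : nat -> V) (a : nat -> nat -> R) t :
  scenery [set w | forall k, (k < K)%N -> \sum_(i < N) a k i * xi (s i) w <= t k].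
Proof.
exact: (@measurable_half_spaces _ scenery_type R N (fun i => xi (s i)) K a t
  (fun i => mscenery (s i))).
Qed.

Let indep_scenery n g (B : set Omega) : scenery B ->
  P (cylinder 0 n g `&` B) = (P (cylinder 0 n g) * P B)%E.
Proof.
have [_ _ ind _] := rwrsZ => SB; apply: ind => //.
pose WS := g_sigma_algebraType (\bigcup_n discrete_events (walk X n)).
rewrite (_ : cylinder 0 n g = [set w | forall i, (i <= n)%N -> walk X i w = \sum_(k < i) g k]).
  apply: (@measurable_upto _ WS (fun i => [set w | walk X i w = \sum_(k < i) g k])) => i.
  apply: sub_sigma_algebra; exists i => //.
  by exists [set \sum_(k < i) g k] => //; rewrite setTI.
apply/seteqP; split => w h i ni.
  rewrite /walk; apply: eq_bigr => k _; apply: (h k).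
  exact: leq_trans (ltn_ord k) ni.
have := h i.+1 ni; rewrite /walk !big_ord_recr /=.
by have := h i (ltnW ni); rewrite /walk => -> /addrI.
Qed.

Let walk_cylinder n g w k : cylinder 0 n g w -> (k <= n)%N ->
  walk X k w = \sum_(i < k) g i.
Proof.
move=> h kn; apply: eq_bigr => i _; apply: (h i).
exact: leq_trans (ltn_ord i) kn.
Qed.

Let ZE n w : Z n w = \sum_(1 <= k < n.+1) xi (walk X k w) w.
Proof. by have [_ _ _ ->] := rwrsZ. Qed.

Let Z_increment k j w :
  Z (k + j)%N w - Z k w = \sum_(k <= i < k + j) xi (walk X i.+1 w) w.
Proof.
rewrite !ZE (@big_cat_nat _ _ _ k.+1)//=; last by rewrite ltnS leq_addr.
by rewrite addrAC subrr add0r big_add1.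
Qed.

Let mwalk k v : measurable [set w | walk X k w = v].
Proof.
pose B (e : k.-tuple V) : set Omega := [set w | \sum_(i < k) nth 0 e i = v].
rewrite (_ : [set w | _] = [set w | B (window 0 k w) w]).
  apply: measurable_countable_comp => e; first exact: mwindow.
  rewrite /B; have [->|h] := eqVneq (\sum_(i < k) nth 0 e i) v.
    by rewrite (_ : [set w | _] = setT)//; apply/seteqP; split.
  by rewrite (_ : [set w | _] = set0)//; apply/seteqP; split => w //= /eqP; rewrite (negbTE h).
have windowE w : \sum_(i < k) nth 0 (window 0 k w) i = walk X k w.
  by apply: eq_bigr => i _; rewrite -tnth_nth tnth_mktuple.
by apply/seteqP; split => w h; [rewrite /B/= windowE|rewrite /= -windowE].
Qed.

Let mxiwalk k : measurable_fun setT (fun w => xi (walk X k w) w).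
Proof.
move=> _ A mA; rewrite setTI.
apply: (measurable_countable_comp (B := fun v => xi v @^-1` A)) => // v.
by rewrite -[X in measurable X]setTI; exact: mxi.
Qed.

Let mZ k : measurable_fun setT (Z k).
Proof.
rewrite (_ : Z k = fun w => \sum_(1 <= i < k.+1) xi (walk X i w) w); last exact/funext.
by apply: measurable_sum => i; exact: mxiwalk.
Qed.

Let site (g : nat -> V) i : V := \sum_(k < i) g k.

Let mincrements k T h : measurable (increments_below Z k T h).
Proof.
by apply: measurable_upto => j; apply: measurable_rv_le; exact: measurable_funB.
Qed.

Let increments_path k T h g w : cylinder 0 (k + T) g w ->
  increments_below Z k T h w <->
  forall j, (j < T.+1)%N -> \sum_(i < T) (0 <= i < 0 + j)%N%:R * xi (site g (k + i).+1) w <= h.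
Proof.
move=> cw.
have E j : (j <= T)%N -> Z (k + j)%N w - Z k w =
    \sum_(i < T) (0 <= i < 0 + j)%N%:R * xi (site g (k + i).+1) w.
  move=> jT; rewrite Z_increment (@sum_indicator_range R T 0 j (fun i => xi (site g (k + i).+1) w))// add0n.
  rewrite -[X in \sum_(X <= _ < _) _]add0n big_addn addKn; apply: eq_big_nat => i /andP[_ ij].
  by rewrite (walk_cylinder cw) 1?addnC//; lia.
by split => H j jT; have := H j jT; rewrite E.
Qed.

Let block_pr T h (s : nat -> V) := pr [set w | forall j, (j < T.+1)%N ->
  \sum_(i < T) (0 <= i < 0 + j)%N%:R * xi (s i) w <= h].

(** The covariances of a scenery along a path only depend on which of its sites
    coincide, hence not on where the path starts. *)
Let block_pr_shift T h (s s' : nat -> V) v : (forall i, s i = v + s' i) ->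
  block_pr T h s = block_pr T h s'.
Proof.
move=> ss'; have g1 := iid_gaussian_vector gxi T s.
have g2 := iid_gaussian_vector gxi T s'.
have E : (fun i j => (s i == s j)%:R : R) = (fun i j => (s' i == s' j)%:R).
  apply/funext => i; apply/funext => j; congr (nat_of_bool _)%:R.
  by rewrite !ss'; apply/eqP/eqP => [/addrI|->].
rewrite E in g1.
exact: (gaussian_law_eq g1 g2 T.+1 (fun j i => (0 <= i < 0 + j)%N%:R) (fun=> h)).
Qed.

Let pr_increments_cylinder k T h g :
  pr (increments_below Z k T h `&` cylinder 0 (k + T) g) =
  pr (cylinder 0 (k + T) g) * block_pr T h (fun i => site g (k + i).+1).
Proof.
rewrite (_ : _ `&` _ = cylinder 0 (k + T) g `&` [set w | forall j, (j < T.+1)%N ->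
   \sum_(i < T) (0 <= i < 0 + j)%N%:R * xi (site g (k + i).+1) w <= h]).
  have S := scenery_half_spaces T T.+1 (fun i => site g (k + i).+1)
    (fun j i => (0 <= i < 0 + j)%N%:R) (fun=> h).
  rewrite indep_scenery// fineM//; apply: fin_num_measure => //.
  exact: (measurable_half_spaces T T.+1 (fun j i => (0 <= i < 0 + j)%N%:R) (fun=> h)
    (fun i => mxi (site g (k + i).+1))).
by apply/seteqP; split => w; [move=> [/[swap] cw /(increments_path h cw)]|
  move=> [cw /(increments_path h cw)]].
Qed.

(** Given the increments of the walk in the window, the earlier increments only
    translate the path, which leaves the law of the scenery unchanged; and the
    window itself has the same law wherever it is placed. *)
Lemma rwrs_stationary k T h :
  pr (increments_below Z k T h) = pr (increments_below Z 0 T h).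
Proof.
pose psi (e : T.-tuple V) := block_pr T h (fun i => site (nth 0 e) i.+1).
have key j (e : T.-tuple V) :
    pr (increments_below Z j T h `&` [set w | window j T w = e]) =
    psi e * pr [set w | window j T w = e].
  rewrite -[LHS]mul1r.
  apply: (countable_partition_eq (U := window 0 j) (U' := window 0 j)) => //.
  - exact: measurableI.
  - by move=> f; exact: mwindow.
  - by move=> f; exact: mwindow.
  - exact: pr_ge0.
  move=> f; rewrite mul1r.
(* the increments before the window, followed by those of the window *)
  pose g i := if (i < j)%N then nth 0 f i else nth 0 e (i - j).
  have gE : [set w | window j T w = e] `&` [set w | window 0 j w = f] = cylinder 0 (j + T) g.
    rewrite !window_cylinder; apply/seteqP; split => w.
      move=> [h1 h2] i ij; rewrite /g; case: ltnP => ji; first exact: h2.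
      by have := h1 (i - j)%N; rewrite subnKC// add0n => ->//; rewrite ltn_subLR.
    move=> H; split => i ij.
      by have := H (j + i)%N; rewrite ltn_add2l => /(_ ij); rewrite add0n /g ltnNge leq_addr /= addKn.
    by have := H i; rewrite add0n => ->; [rewrite /g ij|rewrite (leq_trans ij)// leq_addr].
  rewrite -setIA gE pr_increments_cylinder mulrC; congr (_ * _).
  apply: (@block_pr_shift _ _ _ _ (site g j)) => i.
  rewrite /site -addnS -(big_mkord xpredT g) (@big_cat_nat _ _ _ j)//= ?leq_addr//.
  rewrite big_mkord; congr (_ + _).
  rewrite -[X in \sum_(X <= _ < _) _]add0n big_addn addKn big_mkord; apply: eq_bigr => l _.
  by rewrite /g ltnNge leq_addl /= addnK.
have := @countable_partition_eq _ _ _ P _ (window k T) (window 0 T)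
  (increments_below Z k T h) (increments_below Z 0 T h) 1 1.
rewrite !mul1r; apply => // e; [exact: mwindow|exact: mwindow|].
by rewrite !mul1r !key !window_cylinder pr_cylinder.
Qed.

(** Given the walk, Z is the partial sum process of a Gaussian vector whose
    covariances are 1 or 0 according as two visited sites coincide or not. *)
Lemma rwrs_drop m T h : (0 < m)%N -> 0 <= h -> h ^+ 2 <= m%:R ->
  fine (normal_prob (0 : R) 1 [set x | x <= -1]) * pr (increments_below Z m T h) <=
  pr (increments_below Z m T h `&` [set w | Z m w <= - h]).
Proof.
move=> m0 h0 hm.
have mle : measurable [set x : R | x <= -1] by exact: measurable_lower_ray.
have mG := mincrements m T h.
have mW : measurable [set w | Z m w <= - h] by exact: measurable_rv_le.
rewrite -[leRHS]mul1r.
apply: (countable_partition_le (U := window 0 (m + T)) (U' := window 0 (m + T))) => //.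
- exact: measurableI.
- by move=> e; exact: mwindow.
- by move=> e; exact: mwindow.
- exact: fine_ge0.
move=> e; rewrite mul1r window_cylinder; set g := nth 0 e; set D := cylinder _ _ _.
pose s i := site g i.+1.
have gs := iid_gaussian_vector gxi (m + T) s.
have cC i j : (s i == s j)%:R = (s j == s i)%:R :> R by rewrite eq_sym.
have c0 i j : 0 <= (s i == s j)%:R :> R by [].
have c1 i : (s i == s i)%:R = 1 :> R by rewrite eqxx.
have main := gaussian_drop_before gs cC c0 c1 m0 h0 hm.
have law0 : P [set w | xi (s 0%N) w <= -1] = normal_prob 0 1 [set x : R | x <= -1].
  exact: (iid_gaussian_law gxi (s 0%N) mle).
rewrite law0 in main.
set S1 := [set w | forall j, _] in main; set S2 := [set w | \sum_(0 <= i < m) xi (s i) w <= - h] in main.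
have sumE (w : Omega) j k : D w -> (j + k <= m + T)%N ->
    Z (j + k)%N w - Z j w = \sum_(j <= i < j + k) xi (s i) w.
  move=> Dw jk; rewrite Z_increment; apply: eq_big_nat => i /andP[_ ij].
  by rewrite (walk_cylinder Dw)// (leq_trans _ jk).
have Z0 w : Z 0%N w = 0 by rewrite ZE big_geq.
have incE (w : Omega) : D w -> increments_below Z m T h w <-> S1 w.
  by move=> Dw; split => H j jT; have := H j jT; rewrite sumE// leq_add2l.
have dropE (w : Omega) : D w -> Z m w <= - h <-> S2 w.
  move=> Dw; have := @sumE w 0 m Dw; rewrite add0n leq_addr Z0 subr0 => /(_ isT).
  by rewrite /S2 /= => ->.
have mS1 : scenery S1.
  apply: (@measurable_upto _ scenery_type (fun j =>
    [set w | \sum_(m <= i < m + j) xi (s i) w <= h])) => j.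
  apply: (@measurable_rv_le _ scenery_type R).
  by apply: measurable_sum => i; exact: mscenery.
have mS2 : scenery S2.
  apply: (@measurable_rv_le _ scenery_type R).
  by apply: measurable_sum => i; exact: mscenery.
have mS12 : scenery (S1 `&` S2).
  exact: (@measurableI _ scenery_type _ _ mS1 mS2).
have mS1' : measurable S1.
  apply: (@measurable_upto _ Omega (fun j =>
    [set w | \sum_(m <= i < m + j) xi (s i) w <= h])) => j.
  by apply: measurable_rv_le; apply: measurable_sum => i; exact: mxi.
have mS2' : measurable S2.
  by apply: measurable_rv_le; apply: measurable_sum => i; exact: mxi.
have -> : increments_below Z m T h `&` D = D `&` S1.
  by apply/seteqP; split => w; [move=> [/[swap] Dw /(incE w Dw)]|move=> [Dw /(incE w Dw)]].
have -> : increments_below Z m T h `&` [set w | Z m w <= - h] `&` D = D `&` (S1 `&` S2).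
  apply/seteqP; split => w.
    by move=> [[h1 h2] Dw]; split=> //; split; [exact/incE|exact/dropE].
  by move=> [Dw [h1 h2]]; split=> //; split; [exact/incE|exact/(dropE w Dw)].
rewrite !indep_scenery//.
have fin_ S : measurable S -> P S \is a fin_num by exact: fin_num_measure.
rewrite !fineM ?fin_//; last exact: measurableI.
by rewrite mulrCA ler_wpM2l// pr_ge0.
Qed.

Lemma rwrs_step i a : 0 <= a -> pr (big_step Z i a) <= expR 1 * 2 * expR (- a).
Proof.
move=> a0.
have mA : measurable [set x : R | a < `|x|] by exact: measurable_two_tails.
have stepE : big_step Z i a = [set w | a < `|xi (walk X i.+1 w) w|].
  apply/seteqP; split => w; rewrite /big_step /= -(addn1 i) Z_increment addn1 big_nat1;
  by rewrite ?addn1.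
have mstep : measurable (big_step Z i a).
  by rewrite stepE; have := mxiwalk i.+1 measurableT mA; rewrite setTI.
set c := expR 1 * 2 * expR (- a).
have c0 : 0 <= c by rewrite !mulr_ge0// expR_ge0.
suff : 1 * pr (big_step Z i a) <= c * pr setT by rewrite mul1r probability_setT mulr1.
apply: (countable_partition_le (U := window 0 i.+1) (U' := window 0 i.+1)) => //.
- by move=> e; exact: mwindow.
- by move=> e; exact: mwindow.
move=> e; rewrite mul1r setTI window_cylinder; set g := nth 0 e; set D := cylinder _ _ _.
have walkE w : D w -> walk X i.+1 w = site g i.+1.
  by move=> Dw; rewrite (walk_cylinder Dw).
have -> : big_step Z i a `&` D = D `&` xi (site g i.+1) @^-1` [set x | a < `|x|].
  by rewrite stepE; apply/seteqP; split => w;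
    [move=> [/= h Dw]|move=> [Dw /= h]]; split => //=; move: h; rewrite walkE.
rewrite indep_scenery; last first.
  by apply: sub_sigma_algebra; exists (site g i.+1) => //; exists [set x | a < `|x|] => //; rewrite setTI.
rewrite iid_gaussian_law// fineM ?fin_num_measure// mulrC ler_wpM2r ?pr_ge0//.
rewrite -lee_fin fineK ?normal_prob_tail//.
exact: fin_num_measure.
Qed.

Lemma rwrs_persistence :
  persistence_process P Z (fine (normal_prob (0 : R) 1 [set x | x <= -1])) (expR 1 * 2).
Proof.
split.
- exact: mZ.
- by move=> w; rewrite ZE big_geq.
- by move=> k T h _; exact: rwrs_stationary.
- exact: rwrs_drop.
- exact: rwrs_step.
Qed.

End random_scenery.

Theorem theorem4 (R : realType) (d : measure_display)
    (Omega : measurableType d) (P : probability Omega R)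
    (Z : nat -> Omega -> R)
    (hZ : type_A P Z \/ type_B P Z \/ type_C P Z)
    (n : nat -> nat) (n_pos : forall T, (0 < n T)%N)
    (n_subpoly : subpolynomial (fun T => (n T)%:R : R)) :
  (exists q : nat -> R, subpolynomial q /\
     \forall T \near \oo,
       (P [set w | (running_max Z T w <= 0)%R]
          <= P [set w | (argmax_time Z T w < n T)%N]
          <= P [set w | (running_max Z T w <= 0)%R] * (q T)%:E)%E) /\
  (exists q : nat -> R, subpolynomial q /\
     \forall T \near \oo,
       (P [set w | (running_max Z T w <= 0)%R]
          <= P [set w | (positive_count Z T w < n T)%N]
          <= P [set w | (running_max Z T w <= 0)%R] * (q T)%:E)%E).
Proof.
pose kappa := fine (normal_prob (0 : R) 1 [set x | x <= -1]).
have kappa_gt0 : 0 < kappa.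
  apply: fine_gt0; rewrite normal_prob_below_gt0 /= -ge0_fin_numE//.
  by apply: fin_num_measure; exact: measurable_lower_ray.
suff pp : persistence_process P Z kappa (expR 1 * 2).
  exact: (persistence_process_comparison (pp_measurable pp) kappa_gt0 pp).
case: hZ => [[X [xi [rwrsZ _ _]]]|[[m [X [xi [_ rwrsZ _]]]]|]].
- exact: rwrs_persistence rwrsZ.
- exact: rwrs_persistence rwrsZ.
- move=> [X [[statX gaussX] momX corX _ ZE]].
  exact: (stationary_gaussian_persistence statX gaussX momX corX ZE).
Qed.
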